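(* Let $d\ge 2$ be an integer, $0<r_0<r<1$, and let $f\in\mathcal F_r$. Let $1\le p,p'\le\infty$ with $\frac1p+\frac1{p'}=1$ and let $\sigma\in\mathcal M_d$. Suppose moreover that $$f_r(\eta)=\sum_{l=0}^\infty\sum_{k=1}^{Z(d,l)}\hat f_r(l,k)\,Y_{l,k}(\eta),\qquad \eta\in S^d .$$ Then $$\left|\int_{S^d} f(x)\,d\sigma(x)\right|\le \frac1{r_0}\,\|D(f)\|_{L_p(rS^d)}\,\|U^\sigma\|_{L_{p'}(rS^d)} .$$
   Context: $S^d=\{x\in\mathbb R^{d+1}:\|x\|=1\}$, with $\|\cdot\|$ the Euclidean norm; $rS^d$ is the sphere of radius $r$ centred at $0$. $\mu_d$ denotes the ($d$-dimensional, unnormalized) surface measure on $S^d$, respectively on $rS^d$, and $\omega_d=2\pi^{(d+1)/2}/\Gamma((d+1)/2)=\mu_d(S^d)$. For $1\le p<\infty$, $\|g\|_{L_p(rS^d)}=\left(\int_{rS^d}|g|^p\,d\mu_d\right)^{1/p}$, and $\|g\|_{L_\infty(rS^d)}$ is the essential supremum of $|g|$ over $rS^d$. A spherical harmonic of degree $l$ is the restriction to $S^d$ of a homogeneous harmonic polynomial of degree $l$ on $\mathbb R^{d+1}$; the space of these has dimension $Z(d,l)=\frac{2l+d-1}{l+d-1}\binom{l+d-1}{l}$ for $l\ge1$ and $Z(d,0)=1$. $\{Y_{l,k}: l\ge0,\ 1\le k\le Z(d,l)\}$ is a fixed real orthonormal basis of $L^2(S^d)$ (with respect to $\mu_d$),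 with $Y_{l,k}$ a spherical harmonic of degree $l$. For $f:\mathbb R^{d+1}\to\mathbb R$, $f_r:S^d\to\mathbb R$ is $f_r(x)=f(rx)$, and $\hat f_r(l,k)=\int_{S^d}f_r Y_{l,k}\,d\mu_d$. The operator $D$ is defined (formally) by the series $$D(f_r)=\sum_{l=0}^\infty\sum_{k=1}^{Z(d,l)}\frac{2l+d-1}{(d-1)\omega_d}\,\hat f_r(l,k)\,Y_{l,k}$$ on $S^d$, and $D(f)$ denotes the function on $rS^d$ given by $D(f)(r\eta)=D(f_r)(\eta)$, $\eta\in S^d$. Let $G=(\mathbb R^{d+1}\setminus\{x:\|x\|\le r\})\cup\{\infty\}$, so $\partial G=rS^d$. $\mathcal F_r$ is the class of functions $f:\mathbb R^{d+1}\to\mathbb R$ that are harmonic on $G$, continuous on $\overline G$, vanish at infinity, and satisfy $\|D(f)\|_{L_\infty(rS^d)}<\infty$ (i.e. the series defining $D(f)$ represents an essentially bounded function on $rS^d$). $\mathcal M_d$ is the class of finite signed measures $\sigma=\sigma^+-\sigma^-$ whose positive and negative parts $\sigma^\pm$ are supported on $S^d$ and have finite energy, i.e. $\iint\|x-y\|^{-(d-1)}d\sigma^\pm(x)\,d\sigma^\pm(y)<\infty$. The Newtonian potential of $\sigma$ is $U^\sigma(x)=\int_{S^d}\|x-y\|^{-(d-1)}\,d\sigma(y)$, $x\in\mathbb R^{d+1}$. *)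

(* Defs.v *)
(* R^n is 'rV[R]_n; the matrix norm of MathComp-Analysis
   is the sup norm, so the Euclidean norm is the explicit [enorm].  The
   topology (hence continuity and directional derivatives) is the same. *)
From HB Require Import structures.
From mathcomp Require Import all_boot all_order all_algebra.
From mathcomp Require Import all_classical all_reals all_analysis.
From mathcomp Require Import measurable_realfun.
From mathcomp Require mpoly.
From mathcomp Require Import zify.

Set Implicit Arguments.
Unset Strict Implicit.
Unset Printing Implicit Defensive.

Import Order.TTheory GRing.Theory Num.Theory.
Import numFieldNormedType.Exports.

Local Open Scope classical_set_scope.
Local Open Scope ring_scope.

Definition rV_display : measure_display.
Proof. exact: default_measure_display. Qed.

(* The sigma-algebra of R^n is generated by the coordinates, as the library does
   for tuples; it is the Borel one (see [measurable_open_rV]). *)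
Section measurable_rV.
Context {R : realType} (n : nat).

Definition rV_sigma : set (set 'rV[R]_n) :=
  g_sigma_preimage (fun (i : 'I_n) (x : 'rV[R]_n) => x 0 i).

Let rV0 : rV_sigma set0.
Proof. exact: sigma_algebra0. Qed.

Let rVC A : rV_sigma A -> rV_sigma (~` A).
Proof. exact: sigma_algebraC. Qed.

Let rV_bigcup (F : (set 'rV[R]_n)^nat) :
  (forall i, rV_sigma (F i)) -> rV_sigma (\bigcup_i (F i)).
Proof. exact: sigma_algebra_bigcup. Qed.

HB.instance Definition _ := @isMeasurable.Build rV_display 'rV[R]_n
  rV_sigma rV0 rVC rV_bigcup.

End measurable_rV.

Section rV_measurability.
Context {R : realType}.

Lemma measurable_coord n (i : 'I_n) :
  measurable_fun [set: 'rV[R]_n] (fun x : 'rV[R]_n => x 0 i).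
Proof.
move=> _ Y mY; rewrite setTI; apply: sub_sigma_algebra => /=.
rewrite -bigcup_seq/=; exists i => /=; first by rewrite mem_index_enum.
by exists Y => //; rewrite setTI.
Qed.

Lemma measurable_fun_rV d (T : measurableType d) n (f : T -> 'rV[R]_n) :
  (forall i, measurable_fun [set: T] (fun t => f t 0 i)) ->
  measurable_fun [set: T] f.
Proof.
move=> mf; apply: (@measurability _ _ _ _ _ _
  (\big[setU/set0]_(i < n) preimage_set_system setT
     (fun x : 'rV[R]_n => x 0 i) measurable)) => //.
move=> _ [A + <-].
rewrite -bigcup_seq => -[i _ [B mB <-]]; rewrite !setTI.
by have := mf i measurableT _ mB; rewrite setTI.
Qed.

Lemma measurable_open_rV n (A : set 'rV[R]_n) : open A -> measurable A.
Proof.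
move=> oA.
pose box (qk : 'rV[rat]_n * nat) : set 'rV[R]_n :=
  [set x | forall i, `|ratr (qk.1 0 i) - x 0 i| < qk.2.+1%:R^-1].
have mbox qk : measurable (box qk).
  have -> : box qk = \bigcap_(i in [set: 'I_n])
      ((fun x : 'rV[R]_n => x 0 i) @^-1`
        [set t : R | `|ratr (qk.1 0 i) - t| < qk.2.+1%:R^-1]).
    by apply/seteqP; split => x /=; [move=> h i _|move=> h i]; exact: h.
  apply: fin_bigcap_measurable => // i _.
  rewrite -[X in measurable X]setTI; apply: measurable_coord => //.
  have -> : [set t : R | `|ratr (qk.1 0 i) - t| < qk.2.+1%:R^-1] =
      ball (ratr (qk.1 0 i) : R) (qk.2.+1%:R^-1).
    by [].
  by exact: measurable_ball.
have -> : A = \bigcup_k [set x | exists2 qk, unpickle k = Some qk &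
                                     box qk x /\ box qk `<=` A].
  apply/seteqP; split => [x Ax|x [k _ [qk _ [bx]]]]; last by apply.
  have /nbhs_ballP[e /= e0 xeA] : nbhs x A by exact: open_nbhs_nbhs.
  have [k ke] : exists k : nat, k.+1%:R^-1 < e / 2.
    have e20 : 0 < e / 2 by rewrite divr_gt0.
    have [k _ /(_ k (leqnn k))] := near_infty_natSinv_lt (PosNum e20).
    by exists k.
  have hq i : exists q : rat, `|ratr q - x 0 i| < k.+1%:R^-1 :> R.
    have xk : x 0 i < x 0 i + k.+1%:R^-1 by rewrite ltrDl invr_gt0.
    have [q] := rat_in_itvoo xk.
    rewrite in_itv/= => /andP[h1 h2]; exists q.
    by rewrite gtr0_norm ?subr_gt0// ltrBlDl.
  have [q hqx] := choice hq.
  exists (pickle (\row_i q i, k)) => //=.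
  exists (\row_i q i, k); first by rewrite pickleK.
  split; first by move=> i /=; rewrite mxE.
  move=> y /= hy; apply: xeA; split => // i j; rewrite ord1 /ball/=.
  have := hy j; have := hqx j; rewrite mxE => h1 h2.
  rewrite -[X in X < _]normrN opprB -(subrKA (ratr (q j))) -[ltLHS]normrN opprD.
  rewrite !opprB addrC (le_lt_trans (ler_normD _ _))//.
  by rewrite [e]splitr ltrD// ?(lt_trans _ ke)// distrC.
apply: bigcupT_measurable => k.
case: (unpickle k) => [qk|].
  have [bA|nbA] := pselect (box qk `<=` A).
    rewrite (_ : [set x | _] = box qk)//.
    by apply/seteqP; split => [x [_ [<-] []]//|x bx]; exists qk.
  rewrite (_ : [set x | _] = set0)//.
  by apply/seteqP; split => // x [_ [<-] []].
rewrite (_ : [set x | _] = set0)//.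
by apply/seteqP; split => // x [].
Qed.

End rV_measurability.

Section lebesgue_rV.
Context {R : realType}.

Definition rV_cons n (tx : (measurableTypeR R * 'rV[R]_n)%type) : 'rV[R]_n.+1 :=
  \row_i oapp (fun j => tx.2 0 j) tx.1 (unlift ord0 i).

Lemma measurable_rV_cons n : measurable_fun [set: _] (@rV_cons n).
Proof.
apply: measurable_fun_rV => i; rewrite /rV_cons.
case: (unliftP ord0 i) => [j|] ->.
  under eq_fun do rewrite mxE liftK/=.
  exact: measurableT_comp (measurable_coord j) measurable_snd.
under eq_fun do rewrite mxE unlift_none/=.
exact: measurable_fst.
Qed.

Lemma rV_cons_sigma_finite n
    (m : set (measurableTypeR R * 'rV[R]_n)%type -> \bar R) :
  sigma_finite setT m -> sigma_finite setT (pushforward m (@rV_cons n)).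
Proof.
move=> [F FT Ffin].
pose uncons (x : 'rV[R]_n.+1) : (measurableTypeR R * 'rV[R]_n)%type :=
  (x 0 ord0, \row_j x 0 (lift ord0 j)).
have muncons : measurable_fun [set: _] uncons.
  apply/measurable_fun_pairP; split; first exact: measurable_coord.
  apply: measurable_fun_rV => j /=.
  by under eq_fun do rewrite mxE; exact: measurable_coord.
have consK tx : uncons (rV_cons tx) = tx.
  case: tx => t x; rewrite /uncons /rV_cons mxE unlift_none/=; congr pair.
  by apply/rowP => j; rewrite !mxE liftK.
exists (fun k => uncons @^-1` F k) => [|k].
  by rewrite -preimage_bigcup -FT preimage_setT.
have [mF Fk] := Ffin k; split.
  by rewrite -[X in measurable X]setTI; exact: muncons.
rewrite /pushforward (_ : _ @^-1` _ = F k)//.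
by apply/seteqP; split => tx /=; rewrite consK.
Qed.

End lebesgue_rV.

Section lebesgue_rV_rec.
Context {R : realType}.
Local Open Scope ereal_scope.

Definition leb_cons n (m : {sigma_finite_measure set 'rV[R]_n -> \bar R}) :
  set 'rV[R]_n.+1 -> \bar R :=
  pushforward (@lebesgue_measure R \x m) (@rV_cons R n).

Section instances.
Variables (n : nat) (m : {sigma_finite_measure set 'rV[R]_n -> \bar R}).
Let mcons := @measurable_rV_cons R n.

Let leb_cons0 : leb_cons m set0 = 0.
Proof. exact: measure0. Qed.

Let leb_cons_ge0 A : 0 <= leb_cons m A.
Proof. exact: measure_ge0. Qed.

Let leb_cons_sigma_additive : semi_sigma_additive (leb_cons m).
Proof. exact: measure_semi_sigma_additive. Qed.

HB.instance Definition _ := isMeasure.Build _ _ _ (leb_cons m)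
  leb_cons0 leb_cons_ge0 leb_cons_sigma_additive.

Let leb_cons_sigma_finite : sigma_finite setT (leb_cons m).
Proof.
apply: rV_cons_sigma_finite.
have /sigma_finiteP[F [TF ndF Foo]] := sigma_finiteT (@lebesgue_measure R).
have /sigma_finiteP[G [TG ndG Goo]] := sigma_finiteT m.
exists (fun k => F k `*` G k) => [|k].
  rewrite -setXTT TF TG; apply/seteqP; split => [[x y] [[i _ /= Fx] [j _ /= Gy]]|].
    exists (maxn i j) => //; split.
    - by move: x Fx; exact/subsetPset/ndF/leq_maxl.
    - by move: y Gy; exact/subsetPset/ndG/leq_maxr.
  by move=> [x y] [k _ [/= Fx Gy]]; split; exists k.
have [mF Fk] := Foo k; have [mG Gk] := Goo k.
split; first exact: measurableX.
by rewrite product_measure1E// lte_mul_pinfty// ge0_fin_numE.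
Qed.

HB.instance Definition _ := @Measure_isSigmaFinite.Build _ _ _ (leb_cons m)
  leb_cons_sigma_finite.

End instances.

(* n-dimensional Lebesgue measure, as an iterated product measure. *)
Fixpoint leb n : {sigma_finite_measure set 'rV[R]_n -> \bar R} :=
  if n is n'.+1 then leb_cons (leb n') else dirac (0%R : 'rV[R]_0).

End lebesgue_rV_rec.

Section sphere.
Context {R : realType}.

Definition enorm n (x : 'rV[R]_n) : R := Num.sqrt (\sum_(i < n) x 0 i ^+ 2).

Definition esphere n (rho : R) : set 'rV[R]_n := [set x | enorm x = rho].

Definition radial n (rho : R) (x : 'rV[R]_n) : 'rV[R]_n :=
  (rho / enorm x) *: x.

Definition pball n (rho : R) : set 'rV[R]_n :=
  [set x | 0 < enorm x <= rho].

Lemma measurable_enorm n : measurable_fun [set: 'rV[R]_n] (@enorm n).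
Proof.
apply: measurableT_comp; first by apply: continuous_measurable_fun; exact: sqrt_continuous.
apply: measurable_sum => i; apply: measurable_funX; exact: measurable_coord.
Qed.

Lemma measurable_radial n rho : measurable_fun [set: 'rV[R]_n] (@radial n rho).
Proof.
apply: measurable_fun_rV => i; under eq_fun do rewrite mxE.
apply: measurable_funM; last exact: measurable_coord.
apply: measurable_funM; first exact: measurable_cst.
under eq_fun do rewrite -powR_inv1 ?sqrtr_ge0//.
exact: measurableT_comp (measurable_powR _) (@measurable_enorm n).
Qed.

Lemma measurable_pball n rho : measurable (@pball n rho).
Proof.
have -> : @pball n rho = @enorm n @^-1` `]0, rho].
  by apply/seteqP; split => x; rewrite /pball/= in_itv.
by rewrite -[X in measurable X]setTI; exact: measurable_enorm.
Qed.

(* Surface measure on the sphere of radius rho > 0 of R^n: up to the factor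
   n / rho, the volume of the cone {t a | a \in A, enorm a = rho, 0 < t <= 1}.
   It is a measure on the whole of R^n, carried by the sphere.  The absolute
   value only serves to have a measure for every rho. *)
Definition surf n (rho : R) (A : set 'rV[R]_n) : \bar R :=
  (`|n%:R / rho|%:E * leb n (@radial n rho @^-1` A `&` @pball n rho))%E.

Section surf_measure.
Variables (n : nat) (rho : R).
Local Open Scope ereal_scope.

Let msurf A : measurable A -> measurable (@radial n rho @^-1` A `&` @pball n rho).
Proof.
move=> mA; apply: measurableI; last exact: measurable_pball.
by rewrite -[X in measurable X]setTI; exact: measurable_radial.
Qed.

Let surf0 : @surf n rho set0 = 0.
Proof. by rewrite /surf preimage_set0 set0I measure0 mule0. Qed.

Let surf_ge0 A : 0 <= @surf n rho A.
Proof. by rewrite /surf mule_ge0. Qed.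

Let surf_sigma_additive : semi_sigma_additive (@surf n rho).
Proof.
move=> F mF tF mUF; rewrite /surf preimage_bigcup setI_bigcupl.
under eq_fun do rewrite -ge0_sume_distrr//.
apply: cvgeZl => //; apply: measure_semi_sigma_additive.
- by move=> k; exact: msurf.
- apply/trivIsetP => i j _ _ ij; rewrite setIACA setIid -preimage_setI.
  by move/trivIsetP : tF => /(_ _ _ _ _ ij) ->//; rewrite preimage_set0 set0I.
- by rewrite -setI_bigcupl -preimage_bigcup; exact: msurf.
Qed.

HB.instance Definition _ := isMeasure.Build _ _ _ (@surf n rho)
  surf0 surf_ge0 surf_sigma_additive.

End surf_measure.

End sphere.

Import (canonicals, coercions) mpoly.

Section harmonics.
Context {R : realType} (d : nat).
Local Notation E := 'rV[R]_d.+1.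
Local Notation S := (@esphere R d.+1 1).
Local Notation mu := (@surf R d.+1 1).

(* The total surface measure of S^d, i.e. 2 pi^((d+1)/2) / Gamma((d+1)/2). *)
Definition omega : R := fine (mu S).

Definition Zdim (l : nat) : nat :=
  if l is 0 then 1
  else (((2 * l + d - 1) * 'C(l + d - 1, l)) %/ (l + d - 1))%N.

Lemma Zdim_exact l : (0 < l)%N ->
  (Zdim l * (l + d - 1) = (2 * l + d - 1) * 'C(l + d - 1, l))%N.
Proof.
case: l => // l _; rewrite /Zdim divnK//.
have -> : (2 * l.+1 + d - 1 = (l.+1 + d - 1) + l.+1)%N by lia.
rewrite mulnDl dvdn_add//; first exact: dvdn_mulr.
have -> : (l.+1 + d - 1 = l + d)%N by lia.
case: d => [|d']; first by rewrite addn0 bin_small// muln0.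
by rewrite addnS -mul_bin_diag dvdn_mulr.
Qed.

(* Functions on S^d (or rS^d) are functions on R^(d+1) whose values off the
   sphere are irrelevant. *)
Definition spherical_harmonic (l : nat) (g : E -> R) : Prop :=
  exists p : mpoly.mpoly d.+1 R,
    [/\ p \is mpoly.ishomog1 l mpoly.mdeg,
        \sum_(i < d.+1) mpoly.mderiv i (mpoly.mderiv i p) = 0 &
        forall x, S x -> g x = mpoly.meval (fun i => x 0 i) p].

Variable Y : forall l : nat, 'I_(Zdim l) -> E -> R.

Definition partial_sum (c : forall l, 'I_(Zdim l) -> R) (N : nat) (x : E) : R :=
  \sum_(l < N) \sum_(k < Zdim l) c l k * Y k x.

Definition coef (g : E -> R) (l : nat) (k : 'I_(Zdim l)) : R :=
  \int[mu]_(x in S) (g x * Y k x).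

(* The series sum_l sum_k c_{l,k} Y_{l,k} converges to g in L^2(S^d). *)
Definition L2_sum (c : forall l, 'I_(Zdim l) -> R) (g : E -> R) : Prop :=
  measurable_fun S g /\
  (\int[mu]_(x in S) ((g x - partial_sum c N x) ^+ 2)%:E)%E @[N --> \oo] --> 0%E.

(* Orthonormal basis of L^2(S^d): an orthonormal family such that every g in
   L^2(S^d) is the sum of its Fourier series. *)
Definition harmonic_onb : Prop :=
  [/\ forall l (k : 'I_(Zdim l)), spherical_harmonic l (Y k),
      forall l (k : 'I_(Zdim l)) l' (k' : 'I_(Zdim l')),
        \int[mu]_(x in S) (Y k x * Y k' x) =
          ((l == l') && (k == k' :> nat))%:R &
      forall g : E -> R, measurable_fun S g ->
        (\int[mu]_(x in S) (g x ^+ 2)%:E < +oo)%E -> L2_sum (coef g) g].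

(* f_r *)
Definition dilate (r : R) (f : E -> R) : E -> R := fun x => f (r *: x).

Definition D_coef (r : R) (f : E -> R) (l : nat) (k : 'I_(Zdim l)) : R :=
  (2 * l + d - 1)%N%:R / ((d - 1)%N%:R * omega) * coef (dilate r f) k.

(* Df, as a function on rS^d, is represented by the (formal) series D(f); it is
   determined up to a null set. *)
Definition is_D (r : R) (f Df : E -> R) : Prop :=
  L2_sum (@D_coef r f) (dilate r Df).

Definition sphere_norm (r : R) (p : \bar R) (g : E -> \bar R) : \bar R :=
  'N[@surf R d.+1 r]_p [g \_ (@esphere R d.+1 r)].

Definition basis_vec (i : 'I_d.+1) : E := delta_mx 0 i.

Definition C2_at (f : E -> R) (x : E) : Prop :=
  [/\ {for x, continuous f},
      forall i, derivable f x (basis_vec i) /\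
        {for x, continuous ('D_(basis_vec i) f)} &
      forall i j, derivable ('D_(basis_vec i) f) x (basis_vec j) /\
        {for x, continuous ('D_(basis_vec j) ('D_(basis_vec i) f))}].

Definition harmonic_on (U : set E) (f : E -> R) : Prop :=
  forall x, U x -> C2_at f x /\
    \sum_(i < d.+1) 'D_(basis_vec i) ('D_(basis_vec i) f) x = 0.

Definition vanishes_at_infinity (f : E -> R) : Prop :=
  forall e : R, 0 < e -> exists M : R, forall x, M < enorm x -> `|f x| < e.

(* In dimension d + 1 >= 3, harmonicity at infinity is equivalent, for a function
   harmonic outside a ball, to vanishing at infinity (up to Kelvin transform,
   this is the removable singularity theorem). *)
Definition class_F (r : R) (f : E -> R) : Prop :=
  [/\ harmonic_on [set x | r < enorm x] f,
      {within [set x | r <= enorm x], continuous f},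
      vanishes_at_infinity f &
      exists2 Df, is_D r f Df & (sphere_norm r +oo (EFin \o Df) < +oo)%E].

End harmonics.

Section signed_measures.
Context {R : realType} (d : nat).
Local Notation E := 'rV[R]_d.+1.
Local Notation S := (@esphere R d.+1 1).
Local Open Scope ereal_scope.
Implicit Types sigma : {charge set E -> \bar R}.

(* The parts do not depend on the chosen Hahn decomposition
   ([Hahn_decomposition_uniq]). *)
Definition hahn_pos sigma : set E := sval (cid (Hahn_decomposition sigma)).

Definition hahn_neg sigma : set E :=
  sval (cid (svalP (cid (Hahn_decomposition sigma)))).

Lemma hahnP sigma : hahn_decomposition sigma (hahn_pos sigma) (hahn_neg sigma).
Proof. exact: (svalP (cid (svalP (cid (Hahn_decomposition sigma))))). Qed.

Definition pos_part sigma : {finite_measure set E -> \bar R} :=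
  jordan_pos (hahnP sigma).

Definition neg_part sigma : {finite_measure set E -> \bar R} :=
  jordan_neg (hahnP sigma).

Definition charge_integral sigma (D : set E) (g : E -> \bar R) : \bar R :=
  \int[pos_part sigma]_(x in D) g x - \int[neg_part sigma]_(x in D) g x.

(* The inverse is the one of \bar R, so that for d >= 2 the kernel is +oo on the
   diagonal (the inverse of R would give 0 and, e.g., Dirac masses would have
   finite energy). *)
Definition newton_kernel (x y : E) : \bar R := (enorm (x - y) ^+ d.-1)%:E^-1.

Definition energy (nu : {measure set E -> \bar R}) : \bar R :=
  \int[nu]_x \int[nu]_y newton_kernel x y.

Definition class_M sigma : Prop :=
  [/\ pos_part sigma (~` S) = 0, neg_part sigma (~` S) = 0,
      energy (pos_part sigma) < +oo & energy (neg_part sigma) < +oo].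

Definition potential sigma (x : E) : \bar R :=
  charge_integral sigma S (newton_kernel x).

End signed_measures.

(* Main.v *)
From HB Require Import structures.
Require Import Defs.
From mathcomp Require Import all_boot all_order all_algebra.
From mathcomp Require Import all_classical all_reals all_analysis.
From mathcomp Require Import measurable_realfun ess_sup_inf.
From mathcomp Require mpoly.
From mathcomp Require Import zify ring lra.
Set Implicit Arguments.
Unset Strict Implicit.
Unset Printing Implicit Defensive.
Import Order.TTheory GRing.Theory Num.Theory.
Import numFieldNormedType.Exports.
Local Open Scope classical_set_scope.
Local Open Scope ring_scope.
Import (canonicals, coercions) mpoly.

(** Notation: n = d + 1, N(x) = |x|^-(d-1), S is the unit sphere, sg its surface
    measure and omega the mass of sg.

    The inequality comes from a representation of f by its image under D: for
    |x| = 1,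

      f(x) = r^(d-1) int_S N(x - r z) Df(r z) dsg(z)

    ([exterior_representation]).  Integrate this against sigma and exchange the
    integrals, which is harmless because the kernel is bounded by (1-r)^-(d-1):
    the integral of f is r^-1 times the integral over rS of Df U^sigma.  Hoelder's
    inequality on rS gives the bound with the constant 1/r, which is at most 1/r0.

    Both sides of the representation are continuous on S, so by completeness of
    the basis it suffices to compare Fourier coefficients.  Let Q be a homogeneous
    harmonic polynomial of degree l and let k = 2l + d - 1.  Three facts are used.

    - int_S f Q = r^(l+d-1) int_S f(r z) Q(z) dsg(z) ([exterior_moment]).
    - k int_S N(x - y) Q(x) dsg(x) = (d-1) omega Q(y) for |y| < 1
      ([kernel_moment]).
    - The coefficients of z |-> Df(r z) are k / ((d-1) omega) times those of
      z |-> f(r z) ([L2_sum_coef]).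

    By the second one, forming the potential multiplies a coefficient by
    r^l (d-1) omega / k.  This undoes the multiplier of D and leaves the factor
    r^(l+d-1) of the first one.

    The first two facts are obtained without integrating by parts on spheres.
    Take w(x) = Q(x) P(|x|^-k).  As Q and Q |x|^-k are both harmonic, the Laplacian
    of w is k^2 |x|^(-2k-2) Q(x) P''(|x|^-k) ([laplacian_radial_mult]).  When P is a
    combination of smoothed positive parts of t - s_j^-k, this Laplacian is carried
    by thin shells around the spheres |x| = s_j, and polar coordinates show that
    integrating u against it yields, in the limit, k times the combination of the
    numbers s_j^-l int_S u(s_j z) Q(z) dsg(z) ([shell_limit]).  Green's identity
    ([green]) only requires that a partial derivative with compact support has
    integral 0; it moves the Laplacian to u.  If u is harmonic and w vanishes near
    the hole, the result is 0.  If u = N(. - y), capping and smoothing N turns its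
    Laplacian into a thin shell of mass -(d-1) omega around y ([mass_Nreg]), and the
    result is -(d-1) omega w(y).  The radii s_j are finally sent to infinity, where
    the moments vanish, or to r. *)


(** * Affine changes of variables for Lebesgue measure *)

(** The pushforward as a bundled measure: the measurability proof that the bundle
    needs cannot be recovered from the function by unification. *)
Definition image_measure d d' (T1 : measurableType d) (T2 : measurableType d')
    (R : realFieldType) (m : {measure set T1 -> \bar R}) (f : T1 -> T2)
    (mf : measurable_fun setT f) : {measure set T2 -> \bar R} :=
  measure_function_pushforward__canonical__measure_function_Measure m mf.

Section affine1.
Context {R : realType}.
Local Notation mu := (@lebesgue_measure R).

Lemma measurable_affine1 (c a : R) :
  measurable_fun [set: measurableTypeR R] (fun t : measurableTypeR R => c * t + a : measurableTypeR R).
Proof. by apply: measurable_funD => //; apply: measurable_funM. Qed.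

Lemma lebesgue_affine (c a : R) (A : set (measurableTypeR R)) : 0 < c ->
  measurable A -> (mu A = c%:E * mu ((fun t => (c * t + a)%R) @^-1` A))%E.
Proof.
move=> c0 mA.
pose m := mscale (NngNum (ltW c0)) (image_measure mu (measurable_affine1 c a)).
have : mu A = m A.
  apply: lebesgue_measure_unique => // X /ocitvP => -[->|[[x y]/= xy ->]]; first by rewrite !measure0.
  rewrite /m /mscale/= /pushforward.
  have -> : (fun t : R => c * t + a) @^-1` `]x, y] = `](x - a) / c, (y - a)/c]%classic.
    apply/seteqP; split => t /=; rewrite !in_itv/= ltr_pdivrMr// ler_pdivlMr// ltrBlDr lerBrDr mulrC//.
  rewrite !lebesgue_measure_itv/= !lte_fin xy ltr_pM2r ?invr_gt0// ltrD2r xy -!EFinD -EFinM; congr EFin.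
  by field; rewrite gt_eqF.
by [].
Qed.

Lemma integral_affine1 (c a : R) (g : measurableTypeR R -> \bar R) : 0 < c ->
  measurable_fun setT g -> (forall t, 0 <= g t)%E ->
  (\int[mu]_t g t = c%:E * \int[mu]_t g (c * t + a)%R)%E.
Proof.
move=> c0 mg g0.
have := ge0_integral_pushforward (measurable_affine1 c a) mu measurableT mg (fun y _ => g0 y).
rewrite preimage_setT /comp => <-.
rewrite -(@ge0_integral_mscale _ _ _ (image_measure mu (measurable_affine1 c a)) _ measurableT (NngNum (ltW c0)))//.
by apply: eq_measure_integral => A mA _; exact: lebesgue_affine.
Qed.
End affine1.

Section affine.
Context {R : realType}.
Local Notation mu := (@lebesgue_measure R).

Definition aff n (c : R) (a : 'rV[R]_n) (x : 'rV[R]_n) : 'rV[R]_n := c *: x + a.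

Lemma measurable_aff n (c : R) (a : 'rV[R]_n) : measurable_fun setT (aff c a).
Proof.
apply: measurable_fun_rV => i; rewrite /aff; under eq_fun do rewrite !mxE.
by apply: measurable_funD => //; apply: measurable_funM => //; exact: measurable_coord.
Qed.

Lemma rV_consE n (x : 'rV[R]_n.+1) : exists t y, x = rV_cons (t, y).
Proof.
exists (x 0 0), (\row_i x 0 (lift 0 i)); apply/rowP => i; rewrite mxE.
by case: unliftP => [j ->|->]//=; rewrite mxE.
Qed.

Lemma aff_cons n c (t a : R) (x b : 'rV[R]_n) :
  aff c (rV_cons (a, b)) (rV_cons (t, x)) = rV_cons ((c * t + a)%R, aff c b x).
Proof.
by apply/rowP => i; rewrite !mxE/=; case: unliftP => [j _|_] /=; rewrite ?mxE.
Qed.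

Lemma leb_consE n (A : set 'rV[R]_n.+1) :
  leb n.+1 A = (\int[mu]_t leb n [set x | A (rV_cons (t, x))])%E.
Proof.
rewrite /= /leb_cons /pushforward /product_measure1/=.
apply: eq_integral => t _ /=; congr (leb n _).
by apply/seteqP; split => x /=; rewrite /xsection/= inE.
Qed.

Lemma measurable_section n (A : set 'rV[R]_n.+1) t : measurable A ->
  measurable [set x : 'rV[R]_n | A (rV_cons (t, x))].
Proof.
move=> mA; rewrite -[X in measurable X]setTI.
have := measurableT_comp (@measurable_rV_cons R n) (measurable_pair1 t).
by move=> /(_ measurableT _ mA).
Qed.

Lemma measurable_leb_section n (A : set 'rV[R]_n.+1) : measurable A ->
  measurable_fun [set: measurableTypeR R] (fun t => leb n [set x | A (rV_cons (t, x))]).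
Proof.
move=> mA.
have mA' : measurable (@rV_cons R n @^-1` A).
  by rewrite -[X in measurable X]setTI; exact: measurable_rV_cons.
apply: eq_measurable_fun (measurable_fun_xsection (leb n) mA').
move=> t _ /=; congr (leb n _).
by apply/seteqP; split => x /=; rewrite /xsection/= inE.
Qed.

(** Induction along the recursive definition of [leb]: the first coordinate follows
    the one-dimensional rule and the sections follow the induction hypothesis. *)
Lemma leb_affine n c (a : 'rV[R]_n) (A : set 'rV[R]_n) : 0 < c -> measurable A ->
  (leb n A = (c ^+ n)%:E * leb n (aff c a @^-1` A))%E.
Proof.
move=> c0; elim: n a A => [|n IH] a A mA.
  rewrite expr0 mul1e /= !diracE; congr (_%:R%:E); rewrite [a]thinmx0.
  have -> // : (aff c (0 : 'rV[R]_0)) @^-1` A = A.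
  by apply/seteqP; split => x /=; rewrite /aff ?[_ + _]thinmx0 ?[x]thinmx0.
have [b [a' ->]] := rV_consE a.
rewrite !leb_consE exprS EFinM -muleA -ge0_integralZl//=; last 2 first.
- rewrite -[X in measurable_fun _ X]/(fun t => leb n [set x | (aff c (rV_cons (b, a')) @^-1` A) (rV_cons (t, x))]).
  apply: measurable_leb_section; rewrite -[X in measurable X]setTI.
  exact: measurable_aff.
- by rewrite lee_fin exprn_ge0// ltW.
rewrite (integral_affine1 b c0)//; last exact: measurable_leb_section.
congr (_ * _)%E; apply: eq_integral => t _.
rewrite (IH a'); last exact: measurable_section.
congr (_ * leb n _)%E; apply/seteqP; split => x /=; rewrite aff_cons//.
Qed.

Lemma ge0_integral_aff n c (a : 'rV[R]_n) (F : 'rV[R]_n -> \bar R) : 0 < c ->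
  measurable_fun setT F -> (forall x, 0 <= F x)%E ->
  (\int[leb n]_x F x = (c ^+ n)%:E * \int[leb n]_x F (aff c a x))%E.
Proof.
move=> c0 mF F0.
have := ge0_integral_pushforward (measurable_aff c a) (leb n) measurableT mF (fun y _ => F0 y).
rewrite preimage_setT /comp => <-.
have cn0 : 0 <= c ^+ n by rewrite exprn_ge0// ltW.
rewrite -(@ge0_integral_mscale _ _ _ (image_measure (leb n) (measurable_aff c a)) _ measurableT (NngNum cn0))//.
by apply: eq_measure_integral => A mA _; exact: leb_affine.
Qed.

Lemma integral_shift n (a : 'rV[R]_n) (F : 'rV[R]_n -> R) :
  measurable_fun setT F ->
  \int[leb n]_x F x = \int[leb n]_x F (x + a).
Proof.
move=> mF; rewrite /Rintegral; congr fine.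
have sh x : aff 1 a x = x + a by rewrite /aff scale1r.
rewrite integralE [in RHS]integralE; congr (_ - _)%E.
- rewrite (ge0_integral_aff a (@ltr01 R))//; last by apply: measurable_funepos; apply/measurable_EFinP.
  by rewrite expr1n mul1e; apply: eq_integral => x _; rewrite !funeposE sh.
- rewrite (ge0_integral_aff a (@ltr01 R))//; last by apply: measurable_funeneg; apply/measurable_EFinP.
  by rewrite expr1n mul1e; apply: eq_integral => x _; rewrite !funenegE sh.
Qed.

Definition box n (a : 'rV[R]_n) (e : R) : set 'rV[R]_n := [set x | forall i, `|x 0 i - a 0 i| <= e].

Lemma measurable_box n (a : 'rV[R]_n) e : measurable (box a e).
Proof.
have -> : box a e = \bigcap_(i in [set: 'I_n]) ((fun x : 'rV[R]_n => x 0 i) @^-1` [set t : R | `|t - a 0 i| <= e]).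
  by apply/seteqP; split => x /=; [move=> h i _|move=> h i]; exact: h.
apply: fin_bigcap_measurable => // i _.
rewrite -[X in measurable X]setTI; apply: measurable_coord => //.
have -> : [set t : R | `|t - a 0 i| <= e] = `[a 0 i - e, a 0 i + e]%classic.
  by apply/seteqP; split => t /=; rewrite in_itv/= ler_distl.
exact: measurable_itv.
Qed.

Lemma leb_box n (a : 'rV[R]_n) e : 0 < e -> leb n (box a e) = ((e *+ 2) ^+ n)%:E.
Proof.
move=> e0; elim: n a => [|n IH] a.
  by rewrite /= diracE expr0 mem_set// => -[].
rewrite leb_consE.
have [b [a' aE]] := rV_consE a.
have ibE t : [set x | box a e (rV_cons (t, x))] = if `|t - b| <= e then box a' e else set0.
  case: ifPn => tb; apply/seteqP; split => x //=.
  - by move=> h i; have := h (lift ord0 i); rewrite aE !mxE liftK.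
  - by move=> h i; rewrite aE !mxE; case: unliftP => [j _|_] /=; [exact: h|exact: tb].
  - by move=> /(_ ord0); rewrite aE !mxE unlift_none/= (negPf tb).
under eq_integral do rewrite ibE (fun_if (leb n)) IH measure0.
rewrite (_ : (fun t => _) = fun t => ((e *+ 2) ^+ n)%:E * (\1_(`[b - e, b + e]%classic) t)%:E)%E; last first.
  apply/funext => t; rewrite indicE; case: ifPn => tb.
    by rewrite mem_set ?mule1//= in_itv/= -ler_distl.
  by rewrite memNset ?mule0//= in_itv/= -ler_distl; apply/negP.
rewrite ge0_integralZl//=; last 2 first.
  by apply/measurable_EFinP; exact: measurable_indic.
  by rewrite lee_fin exprn_ge0// mulrn_wge0// ltW.
rewrite integral_indic// ?setIT.
have -> : lebesgue_measure_lebesgue_measure__canonical__measure_function_Measure R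
   `[b - e, b + e]%classic = (e *+ 2)%:E.
  apply: etrans (lebesgue_measure_itv _) _.
  rewrite /= lte_fin ltrD2l gtrN// -EFinB; congr EFin; ring.
by rewrite -EFinM exprSr.
Qed.

End affine.

(** * Continuous functions and integrals of partial derivatives *)

Section measurability.
Context {R : realType}.

Lemma within_continuous_measurable n (D : set 'rV[R]_n) (f : 'rV[R]_n -> R) :
  measurable D -> {within D, continuous f} -> measurable_fun D f.
Proof.
move=> mD /continuousP cf _; apply: (measurability _ (RGenOpens.measurableE R)) => //.
move=> _ [_ [a [b ->] <-]].
have /open_subspaceP[V oV VD] := cf _ (@interval_open _ (BRight a) (BLeft b) isT isT).
rewrite setIC -VD; apply: measurableI => //; exact: measurable_open_rV.
Qed.

Lemma continuous_measurable n (f : 'rV[R]_n -> R) :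
  continuous f -> measurable_fun setT f.
Proof.
by move=> cf; apply: within_continuous_measurable => //; exact: continuous_subspaceT.
Qed.

Lemma box_compact n (a : 'rV[R]_n) e : compact (box a e).
Proof.
have -> : box a e = [set v : 'rV[R]_n | forall i, `[a 0 i - e, a 0 i + e]%classic (v ord0 i)].
  by apply/seteqP; split => x /= h i; have := h i; rewrite in_itv/= ler_distl.
exact: (rV_compact (fun i => @segment_compact R _ _)).
Qed.

Lemma within_continuous_bounded n (A : set 'rV[R]_n) (f : 'rV[R]_n -> R) :
  compact A -> {within A, continuous f} ->
  exists2 M, 0 < M & forall x, A x -> `|f x| <= M.
Proof.
move=> cA cf; have /compact_bounded[M [_ /(_ (`|M| + 1))]] := continuous_compact cf cA.
rewrite ltr_pwDr ?ler_norm// => /(_ isT) h.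
exists (`|M| + 1); first by rewrite ltr_wpDl.
by move=> x Ax; apply: h; exists x.
Qed.

Lemma bounded_integrable d (T : measurableType d) (mu : {measure set T -> \bar R})
  (A : set T) (f : T -> R) M : measurable A -> (mu A < +oo)%E ->
  measurable_fun A f -> (forall x, A x -> `|f x| <= M) -> mu.-integrable A (EFin \o f).
Proof.
move=> mA Afin mf fM; apply: measurable_bounded_integrable => //.
by exists M; split; [exact: num_real|move=> N MN x Ax; exact: le_trans (fM _ Ax) (ltW MN)].
Qed.

Lemma integrable_leb n (f : 'rV[R]_n -> R) e :
  continuous f -> (forall x, ~ box 0 e x -> f x = 0) ->
  (leb n).-integrable setT (EFin \o f).
Proof.
move=> cf f0.
wlog e0 : e f0 / 0 < e.
  move=> /(_ (`|e| + 1)); apply; last by rewrite ltr_wpDl.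
  move=> x nx; apply: f0 => bx; apply: nx => i.
  by rewrite (le_trans (bx i))// ler_wpDr// ler_norm.
have [M M0 fM] := within_continuous_bounded (@box_compact n 0 e) (continuous_subspaceT cf).
have -> : EFin \o f = (EFin \o f) \_ (box 0 e).
  apply/funext => x; rewrite patchE; case: ifPn => //.
  by rewrite notin_setE => /f0 /= ->.
apply/integrable_restrict => //; first exact: measurable_box.
rewrite setTI.
apply: (@bounded_integrable _ _ _ _ _ M) => //; first exact: measurable_box.
- by have := ltry ((e *+ 2) ^+ n); rewrite -(leb_box (0 : 'rV[R]_n) e0).
- by apply: measurable_funTS; exact: continuous_measurable.
Qed.
End measurability.

Section line_derivatives.
Context {R : realType}.

(** A directional derivative depends only on the restriction of the function to a
    line, so it can be computed in another space that contains the same line. *)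
Lemma is_derive_transfer (V W : normedModType R) (f : V -> R) (g : W -> R) x v y w d :
  (forall h, f (h *: v + x) = g (h *: w + y)) ->
  is_derive x v f d -> is_derive y w g d.
Proof.
move=> fg [df <-].
have fgx : f x = g y by have := fg 0; rewrite !scale0r !add0r.
have E : (fun h => h^-1 *: ((g \o shift y) (h *: w) - g y)) =
         (fun h => h^-1 *: ((f \o shift x) (h *: v) - f x)).
  by apply/funext => h /=; rewrite fg fgx.
by split; rewrite /derivable /derive E.
Qed.

Lemma is_derive_continuous (F : R -> R) (x d : R) : is_derive x 1 F d -> {for x, continuous F}.
Proof. by move=> [dF _]; apply/differentiable_continuous/derivable1_diffP. Qed.

Lemma FTC2 (F f : R -> R) (a b : R) : a < b ->
  (forall x : R, x \in `[a, b] -> is_derive x 1 F (f x)) ->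
  (forall x, x \in `[a, b] -> {for x, continuous f}) ->
  (\int[lebesgue_measure]_(x in `[a, b]) (f x)%:E = (F b - F a)%:E)%E.
Proof.
move=> ab dF cf; rewrite EFinB; apply: continuous_FTC2 => //.
- apply: continuous_in_subspaceT => x; rewrite inE; exact: cf.
- have cF x : x \in `[a, b] -> {for x, continuous F}.
    by move=> /dF; exact: is_derive_continuous.
  split.
  + by move=> x xab; have [] := dF x (subset_itv_oo_cc xab).
  + apply: cvg_at_right_filter; apply: cF; by rewrite in_itv/= lexx ltW.
  + apply: cvg_at_left_filter; apply: cF; by rewrite in_itv/= lexx ltW.
- move=> x xab; rewrite derive1E; by have [_ ->] := dF x (subset_itv_oo_cc xab).
Qed.

Definition bvec n (i : 'I_n) : 'rV[R]_n := delta_mx 0 i.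

Lemma rV_cons_bvec0 n (h t : R) (x : 'rV[R]_n) :
  h *: bvec ord0 + rV_cons (t, x) = rV_cons (h + t, x).
Proof.
apply/rowP => i; rewrite !mxE/=; case: unliftP => [j ->|->]/=; first by rewrite mulr0 add0r.
by rewrite mulr1.
Qed.

Lemma rV_cons_bvecS n j (h t : R) (x : 'rV[R]_n) :
  h *: bvec (lift ord0 j) + rV_cons (t, x) = rV_cons (t, h *: bvec j + x).
Proof.
apply/rowP => i; rewrite !mxE/=; case: unliftP => [k ->|->]/=.
  by rewrite !mxE (inj_eq lift_inj).
by rewrite mulr0 add0r.
Qed.

Lemma rV_cons_box n t (x : 'rV[R]_n) e :
  box 0 e (rV_cons (t, x)) <-> `|t| <= e /\ box 0 e x.
Proof.
split=> [h|[h1 h2] i].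
  split; first by have := h ord0; rewrite !mxE unlift_none/= subr0.
  by move=> i; have := h (lift ord0 i); rewrite !mxE liftK.
rewrite !mxE subr0; case: unliftP => [j _|_] //=.
by have := h2 j; rewrite mxE subr0.
Qed.

Lemma cvg_rV (T : Type) (F : set_system T) {FF : Filter F} n (f : T -> 'rV[R]_n) (l : 'rV[R]_n) :
  (forall i, f t 0 i @[t --> F] --> l 0 i) -> f t @[t --> F] --> l.
Proof.
move=> fl; apply/cvg_ballP => e e0.
have H i : \forall t \near F, `|l 0 i - f t 0 i| < e.
  by have /cvgrPdist_lt/(_ _ e0) := fl i.
have : \forall t \near F, forall i, `|l 0 i - f t 0 i| < e by apply: filter_forall.
by apply: filterS => t h; split => // i j; rewrite ord1; exact: h.
Qed.

Lemma continuous_rV_consl n (x : 'rV[R]_n) : continuous (fun t : R => rV_cons (t, x)).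
Proof.
move=> t; apply: cvg_rV => i; rewrite mxE.
under eq_fun do rewrite mxE.
case: unliftP => [j _|_] /=; [exact: cvg_cst|exact: cvg_id].
Qed.

Lemma continuous_rV_consr n (t : R) : continuous (fun x : 'rV[R]_n => rV_cons (t, x)).
Proof.
move=> x; apply: (@cvg_rV _ (nbhs x) _) => i; rewrite mxE.
under eq_fun do rewrite mxE.
case: unliftP => [j _|_] /=; [exact: coord_continuous|exact: cvg_cst].
Qed.

(** By Fubini the coordinate i can be integrated first, and on each line the
    fundamental theorem of calculus gives a difference of two values of F outside
    its support.  Since [leb] is built one coordinate at a time, a coordinate other
    than the first one is reached by induction on n. *)
Lemma integral_partial_eq0 n (i : 'I_n) (F G : 'rV[R]_n -> R) e :
  continuous G -> (forall x, is_derive x (bvec i) F (G x)) ->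
  (forall x, ~ box 0 e x -> F x = 0 /\ G x = 0) ->
  (\int[leb n]_x (G x)%:E = 0)%E.
Proof.
elim: n i F G => [[]//|n IH] i F G cG dF FG0.
have mG := continuous_measurable cG.
have iG : (leb n.+1).-integrable setT (EFin \o G).
  by apply: (integrable_leb cG) => x /FG0[].
have cons_m := @measurable_rV_cons R n.
have mGc : measurable_fun setT ((EFin \o G) \o @rV_cons R n).
  by apply: measurableT_comp => //; exact/measurable_EFinP.
have iGc : (lebesgue_measure \x leb n)%E.-integrable setT ((EFin \o G) \o @rV_cons R n).
  apply/integrableP; split=> //.
  have /integrableP[_] := iG; apply: le_lt_trans.
  rewrite (ge0_integral_pushforward cons_m)//; last by apply: measurableT_comp => //; exact/measurable_EFinP.
have -> : (\int[leb n.+1]_x (G x)%:E = \int[lebesgue_measure \x leb n]_z (G (rV_cons z))%:E)%E.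
  by apply: (integral_pushforward cons_m) => //; exact/measurable_EFinP.
case: (unliftP ord0 i) => [j|] iE.
- rewrite -(integral12_prod_meas1 iGc)/=.
  apply: integral0_eq => t _; rewrite /fubini_F/=.
  apply: (IH j (fun x => F (rV_cons (t, x)))).
  + move=> x; apply: continuous_comp; [exact: continuous_rV_consr|exact: cG].
  + move=> x; apply: is_derive_transfer (dF (rV_cons (t, x))) => h.
    by rewrite iE rV_cons_bvecS.
  + by move=> x nx; apply: FG0 => /rV_cons_box[].
- rewrite -(integral21_prod_meas1 iGc)/=.
  apply: integral0_eq => x _; rewrite /fubini_G/=.
  pose b := `|e| + 1.
  have b0 : 0 < b by rewrite ltr_wpDl.
  have out t : b <= `|t| -> F (rV_cons (t, x)) = 0 /\ G (rV_cons (t, x)) = 0.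
    move=> bt; apply: FG0 => /rV_cons_box[te _].
    by have := le_trans bt te; rewrite leNgt ltr_pwDr ?ler_norm.
  have dFx (t : R) : is_derive t 1 (fun t => F (rV_cons (t, x))) (G (rV_cons (t, x))).
    apply: is_derive_transfer (dF (rV_cons (t, x))) => h.
    by rewrite iE rV_cons_bvec0 [h *: _]mulr1.
  have : (\int[lebesgue_measure]_(t in `[(- b)%R, b]) (G (rV_cons (t, x)))%:E = 0)%E.
    rewrite (FTC2 _ (fun t _ => dFx t)); first last.
    + move=> t _; apply: continuous_comp; [exact: continuous_rV_consl|exact: cG].
    + by rewrite gtrN.
    by rewrite (out b _).1 ?(out (- b) _).1 ?subrr// ?normrN ler_norm.
  rewrite integral_mkcond => <-; apply: eq_integral => t _.
  rewrite patchE; case: ifPn => //; rewrite notin_setE/= in_itv/= -ler_norml => /negP.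
  by rewrite -ltNge => /ltW /out[_ ->].
Qed.

End line_derivatives.

(** * The Euclidean norm and the surface measure *)

Section euclid.
Context {R : realType}.
Implicit Types c e : R.

Lemma enorm_ge0 n (x : 'rV[R]_n) : 0 <= enorm x.
Proof. exact: sqrtr_ge0. Qed.

Lemma enorm_sqr n (x : 'rV[R]_n) : enorm x ^+ 2 = \sum_(i < n) x 0 i ^+ 2.
Proof. by rewrite sqr_sqrtr// sumr_ge0// => i _; rewrite sqr_ge0. Qed.

Lemma coord_le_enorm n (x : 'rV[R]_n) i : `|x 0 i| <= enorm x.
Proof.
rewrite -(@ler_pXn2r _ 2)// ?nnegrE ?enorm_ge0// enorm_sqr real_normK ?num_real//.
by rewrite (bigD1 i)//= lerDl sumr_ge0// => j _; rewrite sqr_ge0.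
Qed.

Lemma enormZ n c (x : 'rV[R]_n) : enorm (c *: x) = `|c| * enorm x.
Proof.
apply/eqP; rewrite -(@eqrXn2 _ 2)// ?enorm_ge0 ?mulr_ge0 ?enorm_ge0//.
rewrite exprMn !enorm_sqr real_normK ?num_real// mulr_sumr.
by apply/eqP/eq_bigr => i _; rewrite mxE exprMn.
Qed.

Lemma enormN n (x : 'rV[R]_n) : enorm (- x) = enorm x.
Proof. by rewrite -scaleN1r enormZ normrN1 mul1r. Qed.

Lemma enorm0 n : enorm (0 : 'rV[R]_n) = 0.
Proof. by rewrite -(scale0r 0) enormZ normr0 mul0r. Qed.

Lemma enorm_eq0 n (x : 'rV[R]_n) : (enorm x == 0) = (x == 0).
Proof.
apply/eqP/eqP => [x0|->]; last exact: enorm0.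
apply/rowP => i; rewrite mxE; apply/eqP; rewrite -normr_le0 -x0.
exact: coord_le_enorm.
Qed.

Lemma enorm_gt0 n (x : 'rV[R]_n) : (0 < enorm x) = (x != 0).
Proof. by rewrite lt_def enorm_ge0 andbT enorm_eq0. Qed.

Lemma enormD n (x y : 'rV[R]_n) : enorm (x + y) <= enorm x + enorm y.
Proof.
have [->|x0] := eqVneq x 0; first by rewrite add0r enorm0 add0r.
have [->|y0] := eqVneq y 0; first by rewrite addr0 enorm0 addr0.
have a0 : 0 < enorm x by rewrite enorm_gt0.
have b0 : 0 < enorm y by rewrite enorm_gt0.
(* The Cauchy-Schwarz inequality: expand a sum of squares that is nonnegative. *)
have CS : \sum_(i < n) x 0 i * y 0 i <= enorm x * enorm y.
  have : 0 <= \sum_(i < n) (x 0 i * enorm y - y 0 i * enorm x) ^+ 2.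
    by apply: sumr_ge0 => i _; rewrite sqr_ge0.
  have -> : \sum_(i < n) (x 0 i * enorm y - y 0 i * enorm x) ^+ 2 =
      (enorm x * enorm y - \sum_(i < n) x 0 i * y 0 i) * (enorm x * enorm y) *+ 2.
    under eq_bigr do rewrite sqrrB !exprMn.
    rewrite big_split sumrB -!mulr_suml -!enorm_sqr/=.
    under [X in _ - X]eq_bigr => i _.
      rewrite (_ : _ *+ 2 = (x 0 i * y 0 i) * (enorm x * enorm y *+ 2)); last by ring.
      over.
    by rewrite -mulr_suml; ring.
  by rewrite pmulrn_lge0// pmulr_lge0 ?mulr_gt0// subr_ge0.
rewrite -(@ler_pXn2r _ 2)// ?nnegrE ?addr_ge0 ?enorm_ge0// sqrrD !enorm_sqr.
under eq_bigr do rewrite mxE sqrrD.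
rewrite !big_split/= lerD2r lerD2l.
by rewrite mulr2n lerD.
Qed.

Lemma enormB_ge n (x y : 'rV[R]_n) : enorm x - enorm y <= enorm (x - y).
Proof. by rewrite lerBlDr -{1}(subrK y x) enormD. Qed.

Lemma enorm_le_box n (x : 'rV[R]_n) e : enorm x <= e -> box 0 e x.
Proof. by move=> h i; rewrite mxE subr0 (le_trans (coord_le_enorm _ _)). Qed.

Lemma cvg_sumr (T : Type) (F : set_system T) {FF : Filter F} (I : finType)
    (f : I -> T -> R) (l : I -> R) :
  (forall i, f i t @[t --> F] --> l i) ->
  \sum_i f i t @[t --> F] --> \sum_i l i.
Proof. by move=> fl; apply: cvg_big => //; exact: add_continuous. Qed.

Lemma continuous_enorm n : continuous (@enorm R n).
Proof.
move=> x; apply: (@continuous_comp _ _ _ (fun x : 'rV[R]_n => \sum_(i < n) x 0 i ^+ 2) Num.sqrt).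
  apply: (@cvg_sumr _ (nbhs x) _) => i; under eq_fun do rewrite expr2.
  by rewrite expr2; apply: cvgM; exact: coord_continuous.
exact: sqrt_continuous.
Qed.

Lemma enorm_radial n rho (x : 'rV[R]_n) : 0 <= rho -> x != 0 -> enorm (radial rho x) = rho.
Proof.
move=> r0 x0; rewrite /radial enormZ ger0_norm ?divr_ge0 ?enorm_ge0//.
by rewrite divfK// enorm_eq0.
Qed.

End euclid.

Section surf_basic.
Context {R : realType}.

Lemma leb_pball_lty n (rho : R) : (leb n (@pball R n rho) < +oo)%E.
Proof.
have e0 : 0 < `|rho| + 1 by rewrite ltr_wpDl.
have := ltry (((`|rho| + 1) *+ 2) ^+ n); rewrite -(leb_box (0 : 'rV[R]_n) e0).
apply: le_lt_trans; apply: le_measure; rewrite ?inE.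
- exact: measurable_pball.
- exact: measurable_box.
- move=> x /andP[_ xr]; apply: enorm_le_box; rewrite (le_trans xr)//.
  by rewrite (le_trans (ler_norm _))// lerDl.
Qed.

Lemma surf_lty n (rho : R) A : measurable A -> (@surf R n rho A < +oo)%E.
Proof.
move=> mA; rewrite /surf; apply: lte_mul_pinfty => //.
apply: le_lt_trans (@leb_pball_lty n rho); apply: le_measure; rewrite ?inE//.
- apply: measurableI; last exact: measurable_pball.
  by rewrite -[X in measurable X]setTI; exact: measurable_radial.
- exact: measurable_pball.
Qed.

Let surf_fin n (rho : R) : fin_num_fun (@surf R n rho).
Proof. by move=> A mA; rewrite ge0_fin_numE// surf_lty. Qed.

HB.instance Definition _ n (rho : R) := @Measure_isFinite.Build _ _ _ (@surf R n rho) (@surf_fin n rho).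

Lemma measurable_esphere n (rho : R) : measurable (@esphere R n rho).
Proof.
have -> : @esphere R n rho = @enorm R n @^-1` [set rho] by [].
by rewrite -[X in measurable X]setTI; exact: measurable_enorm.
Qed.

Lemma surf_setC n (rho : R) : 0 < rho -> surf rho (~` @esphere R n rho) = 0%E.
Proof.
move=> r0; rewrite /surf (_ : _ `&` _ = set0) ?measure0 ?mule0//.
apply/seteqP; split => x //= [h /andP[x0 _]]; apply: h.
by rewrite /esphere/= enorm_radial ?ltW// -enorm_gt0.
Qed.

(** Dilating by rho maps the unit cone over a set to the cone of height rho, which
    multiplies volumes by rho^(d+1); the normalisation n / rho removes one power. *)
Lemma surf_dilate d (rho : R) A : 0 < rho -> measurable A ->
  surf rho A = ((rho ^+ d)%:E * @surf R d.+1 1 ((fun x => rho *: x) @^-1` A))%E.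
Proof.
move=> r0 mA; rewrite /surf.
rewrite (leb_affine 0 r0); last first.
  apply: measurableI; last exact: measurable_pball.
  by rewrite -[X in measurable X]setTI; exact: measurable_radial.
rewrite !muleA -!EFinM; congr (_ * _)%E.
  congr EFin; rewrite divr1 !ger0_norm ?divr_ge0// ?ltW// exprS.
  by field; rewrite gt_eqF.
have E x : x != 0 -> radial rho (rho *: x) = rho *: radial 1 x.
  move=> x0; rewrite /radial enormZ gtr0_norm// !scalerA; congr (_ *: _).
  by field; rewrite enorm_eq0 x0 gt_eqF.
congr (leb _ _).
apply/seteqP; split => x; rewrite /aff/= addr0 => -[h1] /andP[].
- rewrite enormZ gtr0_norm// pmulr_rgt0// ger_pMr// => h2 h3; split; last by apply/andP.
  by rewrite -E// -enorm_gt0.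
- move=> h2 h3; split; first by rewrite E// -enorm_gt0.
  by rewrite /pball/= enormZ gtr0_norm// pmulr_rgt0// ger_pMr// h2.
Qed.
End surf_basic.

(** * Polar coordinates *)

Section lebesgue_pos.
Context {R : realType}.
Local Notation mu := (@lebesgue_measure R).
Local Notation D := (`]0%R, +oo[%classic : set (measurableTypeR R)).

(** Lebesgue measure restricted to the half-line, as a sigma-finite measure on the
    whole line: this is the first factor of the product measure in polar
    coordinates. *)
Definition lebesgue_pos : set (measurableTypeR R) -> \bar R :=
  mrestr mu (measurable_itv `]0%R, +oo[).

HB.instance Definition _ := Measure.on lebesgue_pos.

Let sigma_finite_lebesgue_pos : sigma_finite setT lebesgue_pos.
Proof.
have [F FT Ffin] := sigma_finiteT mu; exists F => // k; have [mF Fk] := Ffin k.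
split=> //; apply: le_lt_trans Fk; rewrite /lebesgue_pos /mrestr.
by apply: le_measure; rewrite ?inE//; apply: measurableI.
Qed.

HB.instance Definition _ := @Measure_isSigmaFinite.Build _ _ _ lebesgue_pos
  sigma_finite_lebesgue_pos.

Lemma integral_lebesgue_pos (K : R -> \bar R) : (forall t, t <= 0 -> K t = 0%E) ->
  (\int[lebesgue_pos]_t K t = \int[mu]_(t in `]0%R, +oo[) K t)%E.
Proof.
move=> K0; transitivity (\int[lebesgue_pos]_(t in D) K t)%E.
  rewrite [RHS]integral_mkcond; apply: eq_integral => t _.
  rewrite patchE; case: ifPn => //; rewrite notin_setE/= in_itv/= andbT => /negP.
  by rewrite -leNgt => /K0.
apply: eq_measure_integral => A mA AD; rewrite /lebesgue_pos /mrestr; congr (mu _).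
exact/setIidl.
Qed.
End lebesgue_pos.

Section polar.
Context {R : realType} (d : nat).
Local Notation n := d.+1.
Local Notation E := 'rV[R]_n.
Local Notation mu := (@lebesgue_measure R).

Lemma leb_set1 : leb n [set (0 : E)] = 0%E.
Proof.
apply/eqP; rewrite eq_le measure_ge0 andbT; apply/lee_addgt0Pr => e e0; rewrite add0e.
(* A cube of half-side h has volume (2 h)^n <= 2^n h once h <= 1. *)
pose h := Num.min 1 (e / 2 ^+ n).
have h0 : 0 < h by rewrite lt_min ltr01 divr_gt0// exprn_gt0.
apply: (@le_trans _ _ (leb n (box (0 : E) h))).
  apply: le_measure; rewrite ?inE; [|exact: measurable_box|].
    have -> : [set (0 : E)] = \bigcap_(i in [set: 'I_n]) ((fun x : E => x 0 i) @^-1` [set 0]).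
      apply/seteqP; split => [x -> i _ /=|x h1]; first by rewrite mxE.
      by apply/rowP => i; rewrite mxE; exact: h1.
    apply: fin_bigcap_measurable => // i _.
    by rewrite -[X in measurable X]setTI; exact: measurable_coord.
  by move=> x -> i; rewrite !mxE subr0 normr0 ltW.
rewrite leb_box// lee_fin -mulr_natl exprMn -ler_pdivlMl ?exprn_gt0// mulrC.
have h1 : h <= 1 by rewrite ge_min lexx.
apply: (@le_trans _ _ h); last by rewrite ge_min lexx orbT.
by rewrite exprS ger_pMr// exprn_ile1// ltW.
Qed.

(** The n-th root on the positive half-line, in a form that is easy to
    differentiate. *)
Definition nth_root (t : R) : R := expR (ln t / n%:R).

Lemma nth_root_gt0 t : 0 < nth_root t. Proof. exact: expR_gt0. Qed.

Lemma nth_rootK t : 0 < t -> nth_root t ^+ n = t.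
Proof.
move=> t0; rewrite -expRM_natr divfK ?pnatr_eq0//.
by rewrite lnK.
Qed.

Lemma nth_rootXK s : 0 < s -> nth_root (s ^+ n) = s.
Proof.
move=> s0; apply/eqP; rewrite -(@eqrXn2 _ n)// ?nth_rootK ?exprn_gt0//.
- by rewrite ltW// nth_root_gt0.
- by rewrite ltW.
Qed.

Definition cone (A : set E) (t : R) : set E := [set z : E | z != 0 /\ enorm z ^+ n <= t] `&` radial 1 @^-1` A.

Lemma measurable_enormX : measurable_fun [set: E] (fun z : E => enorm z ^+ n : measurableTypeR R).
Proof. exact: measurable_funX (@measurable_enorm R n). Qed.

Lemma measurable_cone (A : set E) t : measurable A -> measurable (cone A t).
Proof.
move=> mA; apply: measurableI; last first.
  by rewrite -[X in measurable X]setTI; exact: measurable_radial.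
have -> : [set z : E | z != 0 /\ enorm z ^+ n <= t] =
    @enorm R n @^-1` `]0, +oo[ `&` (fun z : E => enorm z ^+ n) @^-1` `]-oo, t].
  by apply/seteqP; split => z /=; rewrite !in_itv/= andbT enorm_gt0.
apply: measurableI.
- by rewrite -[X in measurable X]setTI; exact: measurable_enorm.
- by rewrite -[X in measurable X]setTI; exact: measurable_enormX.
Qed.

(** Scaling by the n-th root of t maps the unit cone over A, whose volume defines
    [surf], to the cone truncated at |z|^n = t. *)
Lemma leb_cone (A : set E) t : measurable A ->
  (n%:R%:E * leb n (cone A t) = (Num.max t 0)%:E * surf 1 A)%E.
Proof.
move=> mA; have [t0|t0] := leP t 0.
  rewrite mul0e (_ : cone A t = set0) ?measure0 ?mule0//.
  apply/seteqP; split => z //= -[[z0 h] _].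
  have : 0 < enorm z ^+ n by rewrite exprn_gt0// enorm_gt0.
  by rewrite ltNge (le_trans h).
rewrite (leb_affine 0 (nth_root_gt0 t)) ?nth_rootK//; last exact: measurable_cone.
rewrite /surf divr1 ger0_norm// !muleA -!EFinM mulrC; congr (_ * _)%E; congr (leb _ _).
apply/seteqP; split => z; rewrite /cone/= /aff addr0.
- rewrite scaler_eq0 gt_eqF ?nth_root_gt0//= => -[[z0]].
  rewrite enormZ gtr0_norm ?nth_root_gt0// exprMn nth_rootK// ger_pMr// => h1 h2.
  split; last by rewrite /pball/= enorm_gt0 z0 -(@expr_le1 _ n)// enorm_ge0.
  move: h2; rewrite /radial enormZ gtr0_norm ?nth_root_gt0// scalerA.
  rewrite (_ : _ * nth_root t = 1 / enorm z)//.
  by field; rewrite enorm_eq0 z0 gt_eqF// nth_root_gt0.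
- rewrite /pball/= enorm_gt0 => -[h2] /andP[z0 z1].
  rewrite scaler_eq0 gt_eqF ?nth_root_gt0//= z0; split; last first.
    rewrite /radial enormZ gtr0_norm ?nth_root_gt0// scalerA.
    rewrite (_ : _ * nth_root t = 1 / enorm z)//.
    by field; rewrite enorm_eq0 z0 gt_eqF// nth_root_gt0.
  rewrite enormZ gtr0_norm ?nth_root_gt0// exprMn nth_rootK// ger_pMr// exprn_ile1// enorm_ge0//.
Qed.

Lemma measurable_neq0_radial (A : set E) : measurable A -> measurable ([set~ 0] `&` radial 1 @^-1` A : set E).
Proof.
move=> mA; apply: measurableI; last first.
  by rewrite -[X in measurable X]setTI; exact: measurable_radial.
have -> : [set~ (0:E)] = @enorm R n @^-1` `]0, +oo[.
  by apply/seteqP; split => z /=; rewrite in_itv/= andbT enorm_gt0 => h; exact/eqP.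
rewrite -[X in measurable X]setTI; exact: measurable_enorm.
Qed.

(** For fixed A both sides are measures in X, so it is enough to treat a half-open
    interval, whose preimage is the difference of two cones. *)
Lemma leb_polar_rect (X : set (measurableTypeR R)) (A : set E) :
  measurable X -> measurable A ->
  (n%:R%:E * leb n ((fun z => (enorm z ^+ n)%R) @^-1` X `&` ([set~ (0 : E)%R] `&` radial 1 @^-1` A)) =
  mu (X `&` `]0%R, +oo[) * surf 1 A)%E.
Proof.
move=> mX mA.
have c0 : 0 <= fine (surf 1 A) by rewrite fine_ge0.
have cE : surf 1 A = (fine (surf 1 A))%:E by rewrite fineK// ge0_fin_numE// surf_lty.
pose m1 : {measure set (measurableTypeR R) -> \bar R} := mscale (NngNum (ler0n R n)) (image_measure (mrestr (leb n) (measurable_neq0_radial mA)) measurable_enormX).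
pose m2 : {measure set (measurableTypeR R) -> \bar R} := mscale (NngNum c0) (mrestr mu (measurable_itv `]0%R, +oo[)).
have E2 x : m2 x = (mu (x `&` `]0%R, +oo[) * surf 1 A)%E.
  by rewrite muleC [in RHS]cE.
rewrite -E2 -[LHS]/(m1 X).
(* The truncation at 0 covers the intervals that reach into the negative numbers. *)
have ocE x y : x <= y -> m1 `]x, y]%classic = (surf 1 A * (Num.max y 0 - Num.max x 0)%:E)%E.
  move=> xy; rewrite -[LHS]/(n%:R%:E * leb n ((fun z : E => (enorm z ^+ n)%R) @^-1` `]x, y]%classic `&` ([set~ (0 : E)%R] `&` radial 1 @^-1` A)))%E.
  have -> : (fun z : E => enorm z ^+ d.+1) @^-1` `]x, y] `&` ([set~ 0] `&` radial 1 @^-1` A) =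
      cone A y `\` cone A x.
    apply/seteqP; split => z /=; rewrite in_itv/=.
      move=> [/andP[xz zy] [/eqP z0 zA]]; split=> // -[[_]].
      by rewrite leNgt xz.
    move=> [[[z0 zy] zA] h]; split; last by split=> //; apply/eqP.
    by rewrite zy andbT ltNge; apply/negP => zx; apply: h.
  have Afin : surf 1 A \is a fin_num by rewrite cE.
  have conefin t : leb n (cone A t) \is a fin_num.
    rewrite ge0_fin_numE//; apply: le_lt_trans (@leb_pball_lty R n (nth_root `|t|)).
    apply: le_measure; rewrite ?inE; [exact: measurable_cone|exact: measurable_pball|].
    move=> z [[z0 zt] _]; rewrite /pball/= enorm_gt0 z0/=.
    have t0 : 0 < t by rewrite (lt_le_trans _ zt)// exprn_gt0// enorm_gt0.
    rewrite -(@ler_pXn2r _ n)// ?nnegrE ?enorm_ge0 ?(ltW (nth_root_gt0 _))// nth_rootK ?(le_trans zt) ?ler_norm//.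
    by rewrite gtr0_norm.
  rewrite measureD//; last 3 first.
  - exact: measurable_cone.
  - exact: measurable_cone.
  - by rewrite -ge0_fin_numE//; exact: conefin.
  rewrite (_ : cone A y `&` cone A x = cone A x); last first.
    apply/setIidr => z [[z0 zx] zA].
    by rewrite /cone/=; split=> //; split=> //; rewrite (le_trans zx).
  rewrite muleBr//; last by apply: fin_num_adde_defr; exact: conefin.
  rewrite !leb_cone// EFinB muleBr//.
  by rewrite ![(surf 1 A * _)%E]muleC.
have muE x y : x <= y -> mu (`]x, y] `&` `]0%R, +oo[)%classic = (Num.max y 0 - Num.max x 0)%:E.
  move=> xy.
  have -> : `]x, y] `&` `]0%R, +oo[ = `]Num.max x 0, Num.max y 0]%classic :> set R.
    apply/seteqP; split => t /=; rewrite !in_itv/= ?andbT gt_max le_max.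
      by move=> [/andP[-> ->] ->].
    move=> /andP[/andP[-> t0] /orP[->|]]; first by rewrite t0.
    by rewrite leNgt t0.
  rewrite lebesgue_measure_itv/= lte_fin.
  case: ifPn => // h; apply/eqP; rewrite eq_sym eqe subr_eq0 eq_le; apply/andP; split; first by rewrite leNgt.
  by rewrite ge_max !le_max xy lexx orbT.
apply: (@measure_unique _ R (measurableTypeR R) (@ocitv R) (fun k : nat => `]- k%:R, k%:R]%classic) _ _ _ _ m1 m2) => //.
- exact: ocitvI.
- by move=> k; exact: is_ocitv.
- rewrite -subTset => x _; exists (Num.trunc `|x|).+1 => //=.
  rewrite in_itv/=.
  have := truncnS_gt `|x|.
  by rewrite ltr_norml => /andP[-> /ltW ->].
- move=> _ /ocitvP[->|[[x y]/= /ltW xy ->]]; first by rewrite !measure0.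
  by rewrite ocE// E2 muE// muleC.
- move=> k; rewrite ocE ?ler_oppl; last by rewrite (@le_trans _ _ 0)// oppr_le0.
  by rewrite cE -EFinM ltry.
Qed.

(** Polar coordinates with |x|^n in place of the radius.  With this parameter n times
    [leb] becomes exactly the product of Lebesgue measure on the half-line and
    [surf 1], and no Jacobian appears. *)
Definition polar_map (x : E) : measurableTypeR R * E := (enorm x ^+ n, radial 1 x).

Lemma measurable_polar_map : measurable_fun setT polar_map.
Proof.
apply/measurable_fun_pairP; split; [exact: measurable_enormX|exact: measurable_radial].
Qed.

Lemma measurable_nth_root : measurable_fun [set: measurableTypeR R] (nth_root : measurableTypeR R -> R).
Proof.
apply: measurableT_comp; first exact: measurable_expR.
by apply: measurable_funM => //; exact: measurable_ln.
Qed.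

Local Notation restr := (@lebesgue_pos R).

Definition polar_measure : {measure set (measurableTypeR R * E) -> \bar R} :=
  mscale (NngNum (ler0n R n)) (image_measure (leb n) measurable_polar_map).

Lemma polar_measureX (X : set (measurableTypeR R)) (A : set E) :
  polar_measure (X `*` A) = (n%:R%:E * leb n (polar_map @^-1` (X `*` A)))%E.
Proof. by []. Qed.

(** A product measure is determined by its values on rectangles.  The origin has no
    direction, but it is a null set. *)
Lemma polar_measureE (B : set (measurableTypeR R * E)) : measurable B ->
  ((restr \x (@surf R n 1)) B = polar_measure B)%E.
Proof.
move=> mB; apply: (@product_measure_unique _ _ _ _ _ _ _ polar_measure _ B mB).
move=> X A mX mA; rewrite polar_measureX; transitivity (mu (X `&` `]0%R, +oo[) * surf 1 A)%E; last by [].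
rewrite -leb_polar_rect//.
congr (_ * _)%E.
have mP : measurable (polar_map @^-1` (X `*` A)).
  by rewrite -[X in measurable X]setTI; apply: measurable_polar_map => //; exact: measurableX.
have m0 : measurable [set (0 : E)].
  rewrite -(setCK [set 0]); apply: measurableC.
  by have := measurable_neq0_radial measurableT; rewrite preimage_setT setIT.
rewrite (measureDI _ mP m0) [X in (_ + X)%E](_ : _ = 0%E) ?adde0.
  congr (leb n _); apply/seteqP; split => x /=.
    by move=> [[Xx Ax] x0].
  by move=> [Xx [x0 Ax]].
apply/eqP; rewrite eq_le measure_ge0 andbT -leb_set1.
by apply: le_measure; rewrite ?inE//; exact: measurableI.
Qed.

Section polar_integration.
Variable F : E -> R.
Hypothesis iF : (leb n).-integrable setT (EFin \o F).
Hypothesis F0 : F 0 = 0.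

Let H (z : measurableTypeR R * E) : R := (F (nth_root z.1 *: z.2)) * \1_(`]0, +oo[%classic : set R) z.1.

Let mF : measurable_fun setT F.
Proof. by apply/measurable_EFinP; exact: measurable_int iF. Qed.

Let mH : measurable_fun setT H.
Proof.
have mI : measurable_fun setT (\1_(`]0, +oo[%classic : set (measurableTypeR R)) : measurableTypeR R -> R).
  by apply: measurable_indic; exact: measurable_itv.
apply: measurable_funM; last exact: measurableT_comp mI measurable_fst.
apply: measurableT_comp => //; apply: measurable_fun_rV => i.
under eq_fun do rewrite mxE.
apply: measurable_funM.
- exact: measurableT_comp measurable_nth_root measurable_fst.
- exact: measurableT_comp (measurable_coord i) measurable_snd.
Qed.

Let HE x : H (polar_map x) = F x.
Proof.
have [->|x0] := eqVneq x 0.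
  by rewrite F0 /H /= enorm0 expr0n indicE memNset ?mulr0//= in_itv/= ltxx.
have e0 : 0 < enorm x by rewrite enorm_gt0.
rewrite /H /= indicE mem_set ?mulr1//= ?in_itv/= ?andbT ?exprn_gt0//.
rewrite nth_rootXK// /radial scalerA div1r mulfV ?gt_eqF// scale1r//.
Qed.

Let M1 := polar_measure.

Let ge0_M1 (K : measurableTypeR R * E -> \bar R) : measurable_fun setT K -> (forall z, 0 <= K z)%E ->
  (\int[(restr \x (@surf R n 1))]_z K z = n%:R%:E * \int[leb n]_x K (polar_map x))%E.
Proof.
move=> mK K0; transitivity (\int[M1]_z K z)%E.
  by apply: eq_measure_integral => B mB _; exact: polar_measureE.
rewrite ge0_integral_mscale//; congr (_ * _)%E.
by rewrite (ge0_integral_pushforward measurable_polar_map).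
Qed.

Let iH : (restr \x (@surf R n 1))%E.-integrable setT (EFin \o H).
Proof.
apply/integrableP; split; first exact/measurable_EFinP.
rewrite ge0_M1//; last by apply: measurableT_comp => //; exact/measurable_EFinP.
have /integrableP[_] := iF => h.
rewrite lte_mul_pinfty//; under eq_integral do rewrite /= HE; exact: h.
Qed.

Let int_H : (\int[(restr \x (@surf R n 1))]_z (H z)%:E = n%:R%:E * \int[leb n]_x (F x)%:E)%E.
Proof.
have mEH : measurable_fun setT (fun z => (H z)%:E) by exact/measurable_EFinP.
rewrite integralE [X in (X - _)%E](ge0_M1 (measurable_funepos mEH))//.
rewrite [X in (_ - X)%E](ge0_M1 (measurable_funeneg mEH))//.
have -> : (\int[leb n]_x (fun z => (H z)%:E)^\+ (polar_map x) = \int[leb n]_x (EFin \o F)^\+ x)%E.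
  by apply: eq_integral => x _; rewrite !funeposE/= HE.
have -> : (\int[leb n]_x (fun z => (H z)%:E)^\- (polar_map x) = \int[leb n]_x (EFin \o F)^\- x)%E.
  by apply: eq_integral => x _; rewrite !funenegE/= HE.
rewrite -muleBr//; first by rewrite -integralE.
by apply: fin_num_adde_defr; exact: integrable_pos_fin_num.
Qed.

Let inner (t : R) : (\int[@surf R n 1]_y (H (t, y))%:E)%E =
  (if (0 < t)%R then \int[@surf R n 1]_y (F (nth_root t *: y))%:E else 0)%E.
Proof.
case: ifPn => t0.
  by apply: eq_integral => y _; rewrite /H/= indicE mem_set ?mulr1//= in_itv/= t0.
by apply: integral0_eq => y _; rewrite /H/= indicE memNset ?mulr0//= in_itv/= andbT; exact/negP.
Qed.

(** The integrand on the product is cut off to t > 0, so that it vanishes at the image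
    of the origin; the hypothesis on F 0 makes it the lift of F there too. *)
Lemma integral_polar :
  mu.-integrable `]0, +oo[ (fun t => \int[@surf R n 1]_y (F (nth_root t *: y))%:E)%E /\
  (n%:R%:E * \int[leb n]_x (F x)%:E =
   \int[mu]_(t in `]0%R, +oo[) \int[@surf R n 1]_y (F (nth_root t *: y))%:E)%E.
Proof.
split.
- have := integrable_fubini_F iH.
  rewrite /fubini_F/=.
  move=> /integrableP[mK]; rewrite integral_lebesgue_pos; last first.
    by move=> t; rewrite leNgt => /negbTE t0; rewrite inner t0 abse0.
  move=> h.
  apply/integrableP; split.
    apply: eq_measurable_fun (measurable_funTS mK) => t.
    by rewrite inE/= in_itv/= andbT inner => ->.
  rewrite (_ : (\int[mu]_(t in _) _)%E = (\int[mu]_(t in `]0%R, +oo[) `|\int[@surf R n 1]_y (H (t, y))%:E|)%E)//.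
  by apply: eq_integral => t; rewrite inE/= in_itv/= andbT inner => ->.
- rewrite -int_H -(integral12_prod_meas1 iH)/= integral_lebesgue_pos.
    by apply: eq_integral => t; rewrite inE/= in_itv/= andbT => t0; rewrite /fubini_F inner t0.
  by move=> t; rewrite leNgt => /negbTE t0; rewrite /fubini_F inner t0.
Qed.
End polar_integration.
End polar.

(** * A twice differentiable positive part *)

Section spline.
Context {R : realType}.
Implicit Types t a dl : R.

Lemma is_derive_exprn m t : is_derive t 1 (fun s : R => s ^+ m.+1) (m.+1%:R * t ^+ m).
Proof.
have -> : (fun s : R => s ^+ m.+1) = (id : R -> R) ^+ m.+1.
  by apply/funext => s; rewrite fctE.
by apply: is_derive_eq; rewrite [_ *: _]mulr1.
Qed.

Definition pos_pow (m : nat) t : R := Num.max t 0 ^+ m.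

Lemma pos_pow_neg m t : t <= 0 -> pos_pow m.+1 t = 0.
Proof. by move=> t0; rewrite /pos_pow max_r// expr0n. Qed.

Lemma pos_pow_pos m t : 0 <= t -> pos_pow m t = t ^+ m.
Proof. by move=> t0; rewrite /pos_pow max_l. Qed.

Lemma is_derive_pos_pow m t :
  is_derive t 1 (pos_pow m.+2) (m.+2%:R * pos_pow m.+1 t).
Proof.
have [t0|t0|->] := ltgtP t 0.
- rewrite (pos_pow_neg _ (ltW t0)) mulr0.
  apply: (@near_eq_is_derive _ _ _ (cst 0)).
  by near=> s; rewrite pos_pow_neg// ltW//; near: s; exact: lt_nbhsl.
- rewrite pos_pow_pos ?ltW//.
  have D : is_derive t 1 (fun s : R => s ^+ m.+2) (m.+2%:R * t ^+ m.+1).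
    exact: is_derive_exprn.
  apply: near_eq_is_derive D.
  by near=> s; rewrite pos_pow_pos// ltW//; near: s; exact: lt_nbhsr.
- rewrite pos_pow_neg// mulr0.
  have cv : (fun h : R => h^-1 *: ((pos_pow m.+2 \o shift 0) (h *: 1) - pos_pow m.+2 0)) @ 0^' --> (0 : R).
    have -> : (fun h : R => h^-1 *: ((pos_pow m.+2 \o shift 0) (h *: 1) - pos_pow m.+2 0)) = pos_pow m.+1.
      apply/funext => h; rewrite /= [pos_pow _ 0]pos_pow_neg// subr0 addr0 /GRing.scale/= mulr1.
      have [h0|h0] := leP h 0; first by rewrite !pos_pow_neg// mulr0.
      by rewrite !pos_pow_pos ?ltW// exprS mulKf// gt_eqF.
    rewrite -{2}(@pos_pow_neg m 0)//; apply: cvg_within_filter.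
    rewrite /pos_pow; apply: (@continuous_comp _ _ _ (fun t : R => Num.max t 0) (fun t : R => t ^+ m.+1)); last exact: exprn_continuous.
    apply: continuous_max; [exact: cvg_id|exact: cvg_cst].
  by split; [apply/cvg_ex; exists 0|exact/cvg_lim].
Unshelve. all: by end_near. Qed.

Lemma continuous_pos_pow m : continuous (pos_pow m).
Proof.
move=> t; apply: (@continuous_comp _ _ _ (fun t : R => Num.max t 0) (fun t : R => t ^+ m)); last exact: exprn_continuous.
by apply: continuous_max; [exact: cvg_id|exact: cvg_cst].
Qed.

(** A suitably normalised second difference of the truncated cube is 0 for t <= - dl
    and t for dl <= t, hence a smoothing of the positive part.  It is twice
    continuously differentiable, and its second derivative is a tent of mass 1. *)
Definition sdiff m dl t : R := pos_pow m (t + dl) - pos_pow m t *+ 2 + pos_pow m (t - dl).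
Definition soft_pos dl t : R := sdiff 3 dl t / (dl ^+ 2 *+ 6).
Definition d_soft_pos dl t : R := sdiff 2 dl t / (dl ^+ 2 *+ 2).
Definition tent dl t : R := sdiff 1 dl t / dl ^+ 2.

Lemma sdiff_neg m dl t : 0 < dl -> t <= - dl -> sdiff m.+1 dl t = 0.
Proof.
move=> d0 td; have t0 : t <= 0 by lra.
by rewrite /sdiff !pos_pow_neg ?mul0rn ?subr0 ?addr0//; lra.
Qed.

Lemma soft_pos_neg dl t : 0 < dl -> t <= - dl -> soft_pos dl t = 0.
Proof. by move=> *; rewrite /soft_pos sdiff_neg// mul0r. Qed.
Lemma d_soft_pos_neg dl t : 0 < dl -> t <= - dl -> d_soft_pos dl t = 0.
Proof. by move=> *; rewrite /d_soft_pos sdiff_neg// mul0r. Qed.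
Lemma tent_neg dl t : 0 < dl -> t <= - dl -> tent dl t = 0.
Proof. by move=> *; rewrite /tent sdiff_neg// mul0r. Qed.

Lemma soft_pos_pos dl t : 0 < dl -> dl <= t -> soft_pos dl t = t.
Proof.
move=> d0 td; have t0 : 0 <= t by lra.
rewrite /soft_pos /sdiff !pos_pow_pos//; [|lra|lra].
by field; rewrite gt_eqF.
Qed.
Lemma d_soft_pos_pos dl t : 0 < dl -> dl <= t -> d_soft_pos dl t = 1.
Proof.
move=> d0 td; have t0 : 0 <= t by lra.
rewrite /d_soft_pos /sdiff !pos_pow_pos//; [|lra|lra].
by field; rewrite gt_eqF.
Qed.
Lemma tent_pos dl t : 0 < dl -> dl <= t -> tent dl t = 0.
Proof.
move=> d0 td; have t0 : 0 <= t by lra.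
rewrite /tent /sdiff !pos_pow_pos//; [|lra|lra].
by field; rewrite gt_eqF.
Qed.
Lemma tent_ge0 dl t : 0 < dl -> 0 <= tent dl t.
Proof.
move=> d0; rewrite /tent divr_ge0 ?sqr_ge0// /sdiff /pos_pow !expr1.
by rewrite /Num.max; do 3!case: ifPn; rewrite -?leNgt; lra.
Qed.

Lemma is_derive_sdiff m dl t :
  is_derive t 1 (sdiff m.+2 dl) (m.+2%:R * sdiff m.+1 dl t).
Proof.
have sh a : is_derive t 1 (fun t => pos_pow m.+2 (t + a)) (m.+2%:R * pos_pow m.+1 (t + a)).
  apply: is_derive_transfer (is_derive_pos_pow m (t + a)) => h.
  by rewrite addrA.
rewrite /sdiff.
have -> : m.+2%:R * (pos_pow m.+1 (t + dl) - pos_pow m.+1 t *+ 2 + pos_pow m.+1 (t - dl)) =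
   m.+2%:R * pos_pow m.+1 (t + dl) - (m.+2%:R * pos_pow m.+1 t + m.+2%:R * pos_pow m.+1 t)
   + m.+2%:R * pos_pow m.+1 (t - dl) by ring.
apply: is_deriveD; apply: is_deriveB; apply: is_deriveD; exact: is_derive_pos_pow.
Qed.

Lemma is_derive_soft_pos dl t : 0 < dl -> is_derive t 1 (soft_pos dl) (d_soft_pos dl t).
Proof.
move=> d0; rewrite /soft_pos /d_soft_pos.
have -> : sdiff 2 dl t / (dl ^+ 2 *+ 2) = (dl ^+ 2 *+ 6)^-1 *: (3%:R * sdiff 2 dl t).
  by rewrite /GRing.scale/=; field; rewrite gt_eqF.
under eq_fun do rewrite mulrC.
exact: is_deriveZ (is_derive_sdiff 1 dl t).
Qed.

Lemma is_derive_d_soft_pos dl t : 0 < dl -> is_derive t 1 (d_soft_pos dl) (tent dl t).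
Proof.
move=> d0; rewrite /d_soft_pos /tent.
have -> : sdiff 1 dl t / (dl ^+ 2) = (dl ^+ 2 *+ 2)^-1 *: (2%:R * sdiff 1 dl t).
  by rewrite /GRing.scale/=; field; rewrite gt_eqF.
under eq_fun do rewrite mulrC.
exact: is_deriveZ (is_derive_sdiff 0 dl t).
Qed.

Lemma continuous_tent dl : continuous (tent dl).
Proof.
have sh a : continuous (fun t => pos_pow 1 (t + a)).
  move=> t; apply: (@continuous_comp _ _ _ (fun t => t + a) (pos_pow 1)); last exact: continuous_pos_pow.
  by apply: cvgD; [exact: cvg_id|exact: cvg_cst].
move=> t; rewrite /tent; apply: cvgM; last exact: cvg_cst.
rewrite /sdiff; apply: cvgD; last exact: sh.
apply: cvgB; first exact: sh.
by apply: cvgMn; exact: continuous_pos_pow.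
Qed.
End spline.

(** * Differentiation rules at a point *)

Section calculus_rules.
Context {R : realType}.

(** On the line directed by v this is the chain rule in one variable. *)
Lemma is_derive_comp1 (V : normedModType R) (f : V -> R) (g : R -> R) x v a b :
  is_derive x v f a -> is_derive (f x) 1 g b -> is_derive x v (g \o f) (b * a).
Proof.
move=> df dg; pose phi (h : R) : R := f (h *: v + x).
have dphi : is_derive (0 : R) 1 phi a.
  apply: is_derive_transfer df => h.
  by rewrite /phi addr0 [h *: 1]mulr1.
have phi0 : phi 0 = f x by rewrite /phi scale0r add0r.
have dgp : is_derive (0 : R) 1 (g \o phi) (b * a).
  by move: dg; rewrite -phi0 => dg; exact: is_derive1_comp.
apply: is_derive_transfer dgp => h /=.
by rewrite addr0 [h *: 1]mulr1.
Qed.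

Lemma is_deriveM1 (V : normedModType R) (f g : V -> R) x v a b :
  is_derive x v f a -> is_derive x v g b ->
  is_derive x v (fun y => f y * g y) (a * g x + f x * b).
Proof.
by move=> df dg; apply: is_derive_eq; rewrite addrC [_ *: a]mulrC.
Qed.

Lemma is_derive_exprVn m (t : R) : 0 < t ->
  is_derive t 1 (fun s : R => s ^- m) (- (m%:R * t ^- m.+1)).
Proof.
move=> t0; case: m => [|m].
  under eq_fun do rewrite expr0 invr1.
  by apply: is_derive_eq; rewrite mul0r oppr0.
have tm : t ^+ m.+1 != 0 by rewrite expf_neq0// gt_eqF.
have D := is_derive_exprn m t.
have := @is_deriveV _ (fun s : R => s ^+ m.+1) t _ 1 tm D.
move=> /is_derive_eq; apply.
rewrite /GRing.scale/= !exprS. field.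
by rewrite expf_neq0 gt_eqF.
Qed.

Section continuous_at.
Variables (n : nat) (f g : 'rV[R]_n -> R) (x : 'rV[R]_n).
Hypotheses (cf : {for x, continuous f}) (cg : {for x, continuous g}).

Lemma contM : {for x, continuous (fun y => f y * g y)}.
Proof. exact: continuousM. Qed.
Lemma contD : {for x, continuous (fun y => f y + g y)}.
Proof. exact: continuousD. Qed.
Lemma contB : {for x, continuous (fun y => f y - g y)}.
Proof. exact: continuousB. Qed.
Lemma contN : {for x, continuous (fun y => - f y)}.
Proof. exact: continuousN. Qed.
Lemma contX m : {for x, continuous (fun y => f y ^+ m)}.
Proof.
by apply: (@continuous_comp _ _ _ f (fun t : R => t ^+ m)) => //; exact: exprn_continuous.
Qed.
Lemma contC (c : R) : {for x, continuous (fun _ : 'rV[R]_n => c)}.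
Proof. exact: cst_continuous. Qed.
End continuous_at.

Variable n : nat.
Implicit Types x : 'rV[R]_n.

Lemma is_derive_sqnorm x i :
  is_derive x (bvec i) (fun x => \sum_(j < n) x 0 j ^+ 2) (2 * x 0 i).
Proof.
pose p (h : R) : R := (\sum_(j < n) x 0 j ^+ 2) + 2 * x 0 i * h + h ^+ 2.
have dp : is_derive (0 : R) 1 p (2 * x 0 i).
  have := is_derive_exprn 1 (0 : R); rewrite mulr0 => D2.
  rewrite /p; apply: is_derive_eq.
  by rewrite /GRing.scale/=; ring.
apply: is_derive_transfer dp => h; rewrite /p /GRing.scale/= mulr1 addr0.
rewrite (bigD1 i)//= [in RHS](bigD1 i)//= !mxE !eqxx/= mulr1.
rewrite [in RHS](eq_bigr (fun j => x 0 j ^+ 2)); first by ring.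
by move=> j ji; rewrite !mxE (negbTE ji) andbF mulr0 add0r.
Qed.

Lemma is_derive_coord x i j : is_derive x (bvec i) (fun y : 'rV[R]_n => y 0 j) (i == j)%:R.
Proof.
pose p (h : R) : R := h * (i == j)%:R + x 0 j.
have dp : is_derive (0 : R) 1 p (i == j)%:R.
  rewrite /p; apply: is_derive_eq; rewrite /GRing.scale/=; ring.
apply: is_derive_transfer dp => h; rewrite /p /GRing.scale/= mulr1 addr0 !mxE eqxx eq_sym//.
Qed.

Lemma is_derive_enorm x i : x != 0 -> is_derive x (bvec i) (@enorm R n) (x 0 i / enorm x).
Proof.
move=> x0; have e0 : 0 < enorm x by rewrite enorm_gt0.
have s0 : 0 < \sum_(j < n) x 0 j ^+ 2 by rewrite -enorm_sqr exprn_gt0.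
have := is_derive_comp1 (is_derive_sqnorm x i) (is_derive1_sqrt s0).
move=> /is_derive_eq; apply.
rewrite -/(enorm x); field; exact/lt0r_neq0.
Qed.

Lemma is_derive_enormVn m x i : x != 0 ->
  is_derive x (bvec i) (fun y => enorm y ^- m) (- (m%:R * enorm x ^- m.+2 * x 0 i)).
Proof.
move=> x0; have e0 : 0 < enorm x by rewrite enorm_gt0.
have := is_derive_comp1 (is_derive_enorm i x0) (is_derive_exprVn m e0).
move=> /is_derive_eq; apply.
by rewrite !exprS; field; rewrite expf_neq0 ?gt_eqF.
Qed.

Lemma continuous_enormVn m x : x != 0 -> {for x, continuous (fun y : 'rV[R]_n => enorm y ^- m)}.
Proof.
move=> x0; apply: (@cvgV _ _ (nbhs x) _ (fun y : 'rV[R]_n => enorm y ^+ m) (enorm x ^+ m)).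
  by rewrite expf_neq0// enorm_eq0.
apply: (@continuous_comp _ _ _ (@enorm R n) (fun t : R => t ^+ m)); first exact: continuous_enorm.
exact: exprn_continuous.
Qed.

(** Twofold differentiability at x in the coordinate directions, with the derivatives
    as explicit functions.  Only pure second derivatives appear, as in the
    Laplacian, and unlike iterated [derive] the data can be exchanged for any
    functions that agree with them near x ([near_C2data]). *)
Definition C2data (f : 'rV[R]_n -> R) (g h : 'I_n -> 'rV[R]_n -> R) x : Prop :=
  {for x, continuous f} /\
  forall i, [/\ is_derive x (bvec i) f (g i x), is_derive x (bvec i) (g i) (h i x),
    {for x, continuous (g i)} & {for x, continuous (h i)}].

Lemma near_C2data (f f' : 'rV[R]_n -> R) (g h g' h' : 'I_n -> 'rV[R]_n -> R) x :
  (\near x, f x = f' x) -> (forall i, \near x, g i x = g' i x) ->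
  (forall i, \near x, h i x = h' i x) -> C2data f g h x -> C2data f' g' h' x.
Proof.
have tr (a b : 'rV[R]_n -> R) : (\near x, a x = b x) ->
    {for x, continuous a} -> {for x, continuous b}.
  move=> ab ca; have E : a x = b x := nbhs_singleton ab.
  have : b @ x --> b x by rewrite -E; apply: cvg_trans ca; apply: near_eq_cvg; [exact: nbhs_filter|]; apply: filterS ab => y ->.
  by [].
have trd (a b : 'rV[R]_n -> R) i c : (\near x, a x = b x) ->
    is_derive x (bvec i) a c -> is_derive x (bvec i) b c by exact: near_eq_is_derive.
move=> ff' gg' hh' [cf H]; split; first exact: tr ff' cf.
move=> i; have [d1 d2 c1 c2] := H i; split.
- by rewrite -(nbhs_singleton (gg' i) : g i x = g' i x); exact: trd d1.
- by rewrite -(nbhs_singleton (hh' i) : h i x = h' i x); exact: trd d2.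
- exact: tr c1.
- exact: tr c2.
Qed.

End calculus_rules.

(** * Green's identity and the Laplacian of Q(x) P(|x|^-k) *)

Section green.
Context {R : realType} (n : nat).
Local Notation E := 'rV[R]_n.

Lemma continuous_support (f : E -> R) :
  (forall x, {for x, continuous f} \/ \near x, f x = 0) -> continuous f.
Proof.
move=> H x; have [//|nf] := H x.
have f0 : f x = 0 := nbhs_singleton nf.
have : (cst 0 : E -> R) @ x --> f x by rewrite f0; exact: (@cst_continuous E R 0 x).
apply: cvg_trans; apply: near_eq_cvg; [exact: nbhs_filter|].
by apply: filterS nf => y /= ->.
Qed.

Variables (u w : E -> R) (gu hu gw hw : 'I_n -> E -> R) (e : R).
Hypothesis Cw : forall x, C2data w gw hw x.
Hypothesis w0 : forall x, ~ box 0 e x ->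
  w x = 0 /\ forall i, gw i x = 0 /\ hw i x = 0.
Hypothesis Cu : forall x, C2data u gu hu x \/
  \near x, w x = 0 /\ forall i, gw i x = 0 /\ hw i x = 0.

Let cwhu i : continuous (fun x => w x * hu i x).
Proof.
apply: continuous_support => x; have [[_ Hu]|nw] := Cu x.
  left; apply: contM; first exact: (Cw x).1.
  by have [] := Hu i.
by right; apply: filterS nw => y [-> _]; rewrite mul0r.
Qed.

Let cuhw i : continuous (fun x => u x * hw i x).
Proof.
apply: continuous_support => x; have [[cu _]|nw] := Cu x.
  by left; apply: contM => //; have [] := (Cw x).2 i.
by right; apply: filterS nw => y [_ /(_ i)[_ ->]]; rewrite mulr0.
Qed.

Let green_partial i :
  (\int[leb n]_x (w x * hu i x - u x * hw i x)%:E = 0)%E.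
Proof.
have cG : continuous (fun x : E => w x * hu i x - u x * hw i x).
  by move=> x; apply: contB; [exact: cwhu|exact: cuhw].
apply: (@integral_partial_eq0 R n i (fun x => gu i x * w x - u x * gw i x) _ e).
- exact: cG.
- move=> x; have [[_ Hu]|nw] := Cu x.
    have [du dgu _ _] := Hu i; have [dw dgw _ _] := (Cw x).2 i.
    have D1 := is_deriveM1 dgu dw; have D2 := is_deriveM1 du dgw.
    by apply: is_derive_eq; ring.
  have [-> /(_ i)[gw0 ->]] := nbhs_singleton nw.
  rewrite mul0r mulr0 subr0.
  apply: (@near_eq_is_derive _ _ _ (cst 0)).
  by apply: filterS nw => y [-> /(_ i)[-> _]]; rewrite !mulr0 subr0.
- by move=> x /w0[-> /(_ i)[-> ->]]; rewrite !mulr0 mul0r subr0.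
Qed.

(** The difference of the integrands is the divergence of w grad u - u grad w, a field
    with compact support.  Singularities of u are harmless where w vanishes
    identically nearby. *)
Lemma green :
  \int[leb n]_x (u x * \sum_i hw i x) = \int[leb n]_x (w x * \sum_i hu i x).
Proof.
have i1 i : (leb n).-integrable setT (EFin \o (fun x => u x * hw i x)).
  by apply: (@integrable_leb R n _ e) => // x /w0[_ /(_ i)[_ ->]]; rewrite mulr0.
have i2 i : (leb n).-integrable setT (EFin \o (fun x => w x * hu i x)).
  by apply: (@integrable_leb R n _ e) => // x /w0[-> _]; rewrite mul0r.
rewrite /Rintegral; congr fine.
under eq_integral do rewrite mulr_sumr -sumEFin.
under [RHS]eq_integral do rewrite mulr_sumr -sumEFin.
rewrite !integral_sum//; apply: eq_bigr => i _.
have := green_partial i.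
under [X in X = _ -> _]eq_integral do rewrite EFinB.
rewrite integralB//; [|exact: i2|exact: i1].
have /fineK <- : (\int[leb n]_x (u x * hw i x)%:E)%E \is a fin_num by apply: (integrable_fin_num measurableT); first [exact: i1|exact: i2].
have /fineK <- : (\int[leb n]_x (w x * hu i x)%:E)%E \is a fin_num by apply: (integrable_fin_num measurableT); first [exact: i1|exact: i2].
by rewrite -EFinB => -[] /eqP; rewrite subr_eq0 => /eqP ->.
Qed.

End green.

Section laplacian.
Context {R : realType} (n : nat).
Local Notation E := 'rV[R]_n.
Variables (Q : E -> R) (gQ hQ : 'I_n -> E -> R) (l k : nat).
Hypothesis CQ : forall x, C2data Q gQ hQ x.
Hypothesis harmQ : forall x, \sum_i hQ i x = 0.
Hypothesis eulerQ : forall x : E, \sum_i x 0 i * gQ i x = l%:R * Q x.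
Hypothesis kE : (k + 2 = 2 * l + n)%N.
Hypothesis k0 : (0 < k)%N.

Variables (P P1 P2 : R -> R) (c M : R).
Hypothesis dP : forall t : R, is_derive t 1 P (P1 t).
Hypothesis dP1 : forall t : R, is_derive t 1 P1 (P2 t).
Hypothesis cP2 : continuous P2.
Hypothesis PM : forall t, M <= t -> [/\ P t = c, P1 t = 0 & P2 t = 0].

(** The function Q(x) P(|x|^-k) with the value that extends it smoothly to the
    origin: P is constant, equal to c, for large arguments.  The case x = 0 must be
    singled out because 0^-k is 0 and not infinite. *)
Definition radial_mult (x : E) := Q x * (if x == 0 then c else P (enorm x ^- k)).
Let e1 i (x : E) : R := - (k%:R * enorm x ^- k.+2 * x 0 i).
Let e2 i (x : E) : R := - (k%:R * enorm x ^- k.+2) + k%:R * k.+2%:R * enorm x ^- k.+4 * x 0 i ^+ 2.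
Definition d_radial_mult i (x : E) := gQ i x * (if x == 0 then c else P (enorm x ^- k))
  + Q x * P1 (enorm x ^- k) * e1 i x.
Definition dd_radial_mult i (x : E) := hQ i x * (if x == 0 then c else P (enorm x ^- k))
  + 2 * gQ i x * P1 (enorm x ^- k) * e1 i x
  + Q x * P2 (enorm x ^- k) * e1 i x ^+ 2
  + Q x * P1 (enorm x ^- k) * e2 i x.

Let near_neq0 (x : E) : x != 0 -> \near x, x != 0.
Proof.
move=> x0; have : \forall y \near x, 0 < enorm y.
  have h : 0 < enorm x by rewrite enorm_gt0.
  exact: (@continuous_enorm R n x _ (lt_nbhsr h)).
by apply: filterS => y; rewrite enorm_gt0.
Qed.

(** The condition k + 2 = 2 l + n makes Q |x|^-k, the Kelvin transform of Q, harmonic.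
    Together with the harmonicity of Q this removes the terms in P and P': by
    Euler's identity the cross terms cancel the Laplacian of |x|^-k. *)
Lemma laplacian_radial_mult_neq0 (x : E) : x != 0 ->
  \sum_i dd_radial_mult i x = Q x * P2 (enorm x ^- k) * (k%:R ^+ 2 * enorm x ^- (2 * k + 2)).
Proof.
move=> x0; have e0 : enorm x != 0 by rewrite enorm_eq0.
rewrite /dd_radial_mult !big_split/= -mulr_suml harmQ mul0r add0r.
have S1 : \sum_i x 0 i ^+ 2 = enorm x ^+ 2 by rewrite enorm_sqr.
have -> : \sum_i 2 * gQ i x * P1 (enorm x ^- k) * e1 i x =
    - 2 * P1 (enorm x ^- k) * k%:R * enorm x ^- k.+2 * (l%:R * Q x).
  rewrite -eulerQ mulr_sumr; apply: eq_bigr => i _; rewrite /e1; ring.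
have -> : \sum_i Q x * P2 (enorm x ^- k) * e1 i x ^+ 2 =
    Q x * P2 (enorm x ^- k) * (k%:R ^+ 2 * enorm x ^- (2 * k + 2)).
  rewrite -mulr_sumr; congr (_ * _).
  transitivity (\sum_i (k%:R * enorm x ^- k.+2) ^+ 2 * x 0 i ^+ 2).
    by apply: eq_bigr => i _; rewrite /e1; ring.
  rewrite -mulr_sumr S1 exprMn -mulrA; congr (_ * _).
  rewrite -exprVn -exprM -exprVn (_ : k.+2 * 2 = (2 * k + 2) + 2)%N; last lia.
  by rewrite exprD -mulrA -exprMn mulVf// expr1n mulr1.
have -> : \sum_i Q x * P1 (enorm x ^- k) * e2 i x =
    Q x * P1 (enorm x ^- k) * (k%:R * enorm x ^- k.+2 * (k.+2%:R - n%:R)).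
  rewrite -mulr_sumr; congr (_ * _).
  rewrite /e2 big_split/= sumr_const card_ord -mulr_sumr S1.
  rewrite -[_ * enorm x ^- k.+4 * _]mulrA.
  have -> : enorm x ^- k.+4 * enorm x ^+ 2 = enorm x ^- k.+2.
    by rewrite !exprS; field; rewrite expf_neq0 ?e0.
  by rewrite -mulr_natr; ring.
have -> : k.+2%:R - n%:R = 2 * l%:R :> R.
  have -> : k.+2 = (2 * l + n)%N by lia.
  by rewrite natrD natrM; ring.
ring.
Qed.

Lemma laplacian_radial_mult (x : E) :
  \sum_i dd_radial_mult i x = Q x * P2 (enorm x ^- k) * (k%:R ^+ 2 * enorm x ^- (2 * k + 2)).
Proof.
have [->|/laplacian_radial_mult_neq0//] := eqVneq x 0.
have -> : enorm (0 : E) ^- (2 * k + 2) = 0 by rewrite enorm0 addn2 expr0n/= invr0.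
rewrite !mulr0; transitivity ((\sum_i hQ i 0) * c); last by rewrite harmQ mul0r.
rewrite mulr_suml; apply: eq_bigr => i _.
by rewrite /dd_radial_mult /e1 /e2 eqxx mxE enorm0 !expr0n/= invr0 !mulr0 oppr0 expr0n/= !mulr0 !addr0 mulr0 addr0.
Qed.

(** Near the origin the function is c Q, since |y|^-k is large there; elsewhere the
    usual rules apply. *)
Lemma C2_radial_mult (x : E) : C2data radial_mult d_radial_mult dd_radial_mult x.
Proof.
have [cQ HQ] := CQ x.
have [->|x0] := eqVneq x 0.
  have nM : \forall y \near (0 : E), y == 0 \/ M <= enorm y ^- k.
    pose M' := `|M| + 1; have M'0 : 0 < M' by rewrite ltr_wpDl.
    have : \forall y \near (0 : E), enorm y < Num.min 1 M'^-1.
      have h : enorm (0 : E) < Num.min 1 M'^-1 by rewrite enorm0 lt_min ltr01 invr_gt0.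
      exact: (@continuous_enorm R n 0 _ (lt_nbhsl h)).
    apply: filterS => y; rewrite lt_min => /andP[y1 yM].
    have [->|y0] := eqVneq y 0; [by left; rewrite ?eqxx|right].
    have ey : 0 < enorm y by rewrite enorm_gt0.
    apply: (@le_trans _ _ M'); first by rewrite (le_trans (ler_norm M))// lerDl.
    rewrite -[M']invrK lef_pV2 ?posrE ?exprn_gt0 ?invr_gt0//.
    apply: le_trans (ltW yM); rewrite -[leRHS]expr1; apply: ler_wiXn2l => //; exact: ltW.
  have e10 i : e1 i 0 = 0 by rewrite /e1 mxE mulr0 oppr0.
  have e20 i : e2 i 0 = 0.
    by rewrite /e2 mxE enorm0 !expr0n/= invr0 !mulr0 oppr0 addr0.
  have C0 : C2data (fun x => c * Q x) (fun i x => c * gQ i x) (fun i x => c * hQ i x) 0.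
    have [cQ0 HQ0] := CQ 0; split; first by apply: contM => //; exact: contC.
    move=> i; have [d1 d2 c1 c2] := HQ0 i; split.
    - exact: is_deriveZ.
    - exact: is_deriveZ.
    - by apply: contM => //; exact: contC.
    - by apply: contM => //; exact: contC.
  apply: near_C2data C0.
  - apply: filterS nM => y [/eqP->|My]; rewrite /radial_mult; first by rewrite eqxx mulrC.
    by have [-> _ _] := PM My; rewrite if_same mulrC.
  - move=> i; apply: filterS nM => y [/eqP->|My]; rewrite /d_radial_mult.
      by rewrite eqxx e10 mulr0 addr0 mulrC.
    have [-> -> _] := PM My; rewrite if_same mulr0 mul0r addr0 mulrC//.
  - move=> i; apply: filterS nM => y [/eqP->|My]; rewrite /dd_radial_mult.
      by rewrite eqxx e10 e20 expr0n/= !mulr0 !addr0 mulrC.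
    have [-> -> ->] := PM My; rewrite if_same !mulr0 !mul0r !addr0 mulrC//.
have e0 : 0 < enorm x by rewrite enorm_gt0.
pose Ek (y : E) := enorm y ^- k.
have dE i : is_derive x (bvec i) Ek (e1 i x) by exact: is_derive_enormVn.
have cE m : {for x, continuous (fun y : E => enorm y ^- m)} by exact: continuous_enormVn.
have cc (f : R -> R) : continuous f -> {for x, continuous (fun y => f (Ek y))}.
  by move=> cf; apply: continuous_comp; [exact: cE|exact: cf].
have cP : continuous P by move=> t; exact: is_derive_continuous (dP t).
have cP1 : continuous P1 by move=> t; exact: is_derive_continuous (dP1 t).
have ccoord i : {for x, continuous (fun y : E => y 0 i)} by exact: coord_continuous.
have de1 i : is_derive x (bvec i) (e1 i) (e2 i x).
  have D := is_deriveM1 (is_derive_enormVn k.+2 i x0) (is_derive_coord x i i).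
  have -> : e1 i = fun y => - k%:R *: (enorm y ^- k.+2 * y 0 i).
    by apply/funext => y; rewrite /e1 /GRing.scale/=; ring.
  have := is_deriveZ (- k%:R) D; move=> /is_derive_eq; apply.
  rewrite /e2 /GRing.scale/= eqxx/=; ring.
have ce1 i : {for x, continuous (e1 i)}.
  apply: contN; apply: contM; last exact: ccoord.
  by apply: contM; [exact: contC|exact: cE].
have ce2 i : {for x, continuous (e2 i)}.
  apply: contD.
    by apply: contN; apply: contM; [exact: contC|exact: cE].
  apply: contM; first by apply: contM; [exact: contC|exact: cE].
  by apply: contX; exact: ccoord.
have dPE i : is_derive x (bvec i) (fun y => P (Ek y)) (P1 (Ek x) * e1 i x).
  exact: is_derive_comp1.
have dP1E i : is_derive x (bvec i) (fun y => P1 (Ek y)) (P2 (Ek x) * e1 i x).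
  exact: is_derive_comp1.
have C1 : C2data (fun y => Q y * P (Ek y))
   (fun i y => gQ i y * P (Ek y) + Q y * P1 (Ek y) * e1 i y)
   (fun i y => hQ i y * P (Ek y) + 2 * gQ i y * P1 (Ek y) * e1 i y
     + Q y * P2 (Ek y) * e1 i y ^+ 2 + Q y * P1 (Ek y) * e2 i y) x.
  split; first by apply: contM => //; exact: cc.
  move=> i; have [d1 d2 c1 c2] := HQ i; split.
  - have := is_deriveM1 d1 (dPE i); move=> /is_derive_eq; apply; ring.
  - have D1 := is_deriveM1 d2 (dPE i).
    have D2 := is_deriveM1 (is_deriveM1 d1 (dP1E i)) (de1 i).
    have := is_deriveD D1 D2; move=> /is_derive_eq; apply; ring.
  - apply: contD; first by apply: contM => //; exact: cc.
    by apply: contM; [apply: contM => //; exact: cc|exact: ce1].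
  - apply: contD; last by apply: contM; [apply: contM => //; exact: cc|exact: ce2].
    apply: contD.
      apply: contD; first by apply: contM => //; exact: cc.
      apply: contM; last exact: ce1.
      by apply: contM; [apply: contM => //; exact: contC|exact: cc].
    apply: contM; first by apply: contM => //; exact: cc.
    by apply: contX; exact: ce1.
apply: near_C2data C1.
- by apply: filterS (near_neq0 x0) => y /negbTE y0; rewrite /radial_mult y0.
- by move=> i; apply: filterS (near_neq0 x0) => y /negbTE y0; rewrite /d_radial_mult y0.
- by move=> i; apply: filterS (near_neq0 x0) => y /negbTE y0; rewrite /dd_radial_mult y0.
Qed.

Lemma radial_mult_at0 : c = 0 -> radial_mult 0 = 0 /\ forall i, d_radial_mult i 0 = 0 /\ dd_radial_mult i 0 = 0.
Proof.
move=> c0; rewrite /radial_mult /d_radial_mult /dd_radial_mult eqxx c0 mulr0; split=> // i.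
by rewrite /e1 /e2 mxE enorm0 !expr0n/= invr0 !mulr0 oppr0 expr0n/= !mulr0 !addr0 !mulr0 !addr0.
Qed.

Lemma radial_mult_eq0 (x : E) : x != 0 -> P (enorm x ^- k) = 0 -> P1 (enorm x ^- k) = 0 -> P2 (enorm x ^- k) = 0 ->
  radial_mult x = 0 /\ forall i, d_radial_mult i x = 0 /\ dd_radial_mult i x = 0.
Proof.
move=> /negbTE x0 p p1 p2; split; first by rewrite /radial_mult x0 p mulr0.
by move=> i; split; rewrite /d_radial_mult /dd_radial_mult x0 p p1 ?p2 !mulr0 !mul0r !addr0.
Qed.

End laplacian.

(** * Integrals over a thin shell *)

Section shell.
Context {R : realType} (d : nat).
Local Notation n := d.+1.
Local Notation E := 'rV[R]_n.
Local Notation mu := (@lebesgue_measure R).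
Local Notation S := (@esphere R n 1).
Local Notation sg := (@surf R n 1).
Local Notation nth_root := (@nth_root R d).

Lemma integral_surf_sphere (F : E -> \bar R) : measurable_fun setT F ->
  (\int[sg]_x F x = \int[sg]_(x in S) F x)%E.
Proof.
move=> mF; rewrite [RHS]integral_mkcond; apply: ae_eq_integral => //.
  by apply/(measurable_restrictT _ (measurable_esphere _)); exact: measurable_funTS.
exists (~` S); split; [by apply: measurableC; exact: measurable_esphere|exact: surf_setC|].
by move=> x /= h Sx; apply: h => _; rewrite patchE mem_set.
Qed.

Lemma is_derive_nth_root (t : R) : 0 < t -> is_derive t 1 nth_root (nth_root t / (n%:R * t)).
Proof.
move=> t0; have dln := is_derive1_ln t0.
have D := is_deriveZ (n%:R^-1 : R) dln.
have := is_derive_comp1 D (is_derive_expR _).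
have -> : expR \o ((n%:R^-1 : R) \*: @ln R) = nth_root.
  by apply/funext => s; rewrite /nth_root/= mulrC.
move=> /is_derive_eq; apply.
have -> : ((n%:R^-1 : R) \*: @ln R) t = ln t / n%:R by rewrite -[LHS]/(n%:R^-1 * ln t) mulrC.
rewrite /GRing.scale/= -/(nth_root t); field.
by rewrite gt_eqF//= pnatr_eq0.
Qed.

Variables (k l : nat) (a dl : R).
Hypothesis kE : (k + 2 = 2 * l + n)%N.
Hypothesis k0 : (0 < k)%N.
Hypothesis dl0 : 0 < dl.
Hypothesis adl : dl < a.

(* The weight of the shell in the variable t = s^n: the factor k^2 |x|^(-2k-2) and
   the two factors s^l, from Q and from the normalisation of beta, combine into
   the power k + n. *)
Let W (t : R) : R := k%:R ^+ 2 * nth_root t ^- (k + n) * tent dl (nth_root t ^- k - a).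

Let W_ge0 t : 0 <= W t.
Proof. by rewrite /W mulr_ge0 ?tent_ge0// mulr_ge0 ?sqr_ge0// invr_ge0 exprn_ge0// ltW// nth_root_gt0. Qed.

Let WE (t : R) : 0 < t -> W t = k%:R ^+ 2 / (nth_root t ^+ k * t) * tent dl (nth_root t ^- k - a).
Proof. by move=> t0; rewrite /W exprD nth_rootK. Qed.

(* An antiderivative of the weight: the tent is the derivative of [d_soft_pos]. *)
Let G (t : R) : R := - (n%:R * k%:R) * d_soft_pos dl (nth_root t ^- k - a).

Let is_derive_G (t : R) : 0 < t -> is_derive t 1 G (W t).
Proof.
move=> t0.
have D1 := is_derive_comp1 (is_derive_nth_root t0) (is_derive_exprVn k (nth_root_gt0 d t)).
have D2 : is_derive t 1 (fun t => nth_root t ^- k - a) (- (k%:R * nth_root t ^- k.+1) * (nth_root t / (n%:R * t))).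
  by apply: is_derive_eq; rewrite subr0.
have D3 := is_derive_comp1 D2 (is_derive_d_soft_pos (nth_root t ^- k - a) dl0).
have := is_deriveZ (- (n%:R * k%:R)) D3; move=> /is_derive_eq; apply.
rewrite WE// /GRing.scale/= exprS; field.
by rewrite !gt_eqF//= ?exprn_gt0// ?nth_root_gt0// ltr0n.
Qed.

Let continuous_W (t : R) : 0 < t -> {for t, continuous W}.
Proof.
move=> t0; have cr : {for t, continuous nth_root} := is_derive_continuous (is_derive_nth_root t0).
have cV m : {for t, continuous (fun t => nth_root t ^- m)}.
  apply: (@continuous_comp _ _ _ nth_root (fun s => s ^- m)) => //.
  exact: is_derive_continuous (is_derive_exprVn m (nth_root_gt0 d t)).
apply: cvgM.
  by apply: cvgM; [exact: cvg_cst|exact: cV].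
apply: (@continuous_comp _ _ _ (fun t => nth_root t ^- k - a) (tent dl)); last exact: continuous_tent.
by apply: cvgB; [exact: cV|exact: cvg_cst].
Qed.

(* The tent vanishes for s <= s1 and for s >= s2; the bounds by 1 give s^-k >= s^-1
   and s^-k <= s^-1 respectively. *)
Let s1 : R := Num.min 1 (a + dl)^-1.
Let s2 : R := Num.max 1 (a - dl)^-1.

Let ad1 : 0 < a + dl. Proof. by have := adl; have := dl0; lra. Qed.
Let ad2 : 0 < a - dl. Proof. by have := adl; lra. Qed.

Let s1_gt0 : 0 < s1.
Proof. rewrite lt_min ltr01 invr_gt0; exact: ad1. Qed.
Let s2_gt0 : 0 < s2. Proof. by rewrite lt_max ltr01. Qed.

Let lo (s : R) : 0 < s -> s <= s1 -> dl <= s ^- k - a.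
Proof.
rewrite /s1 le_min => s0 /andP[h1 h2].
rewrite lerBrDr [dl + a]addrC; apply: (@le_trans _ _ s^-1).
  by rewrite -[leLHS]invrK lef_pV2 ?posrE// invr_gt0; exact: ad1.
rewrite lef_pV2 ?posrE ?exprn_gt0// -[leRHS]expr1 ler_wiXn2l// ltW//.
Qed.

Let hi (s : R) : s2 <= s -> s ^- k - a <= - dl.
Proof.
rewrite /s2 ge_max => /andP[h1 h2].
have s0 : 0 < s by apply: lt_le_trans h1.
rewrite lerBlDr [- dl + a]addrC; apply: (@le_trans _ _ s^-1); last first.
  by rewrite -[leRHS]invrK lef_pV2 ?posrE// invr_gt0; exact: ad2.
by rewrite lef_pV2 ?posrE ?exprn_gt0// -[leLHS]expr1 ler_weXn2l.
Qed.

Let t1 := s1 ^+ n.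
Let t2 := s2 ^+ n.

Let s12 : s1 < s2.
Proof.
rewrite ltNge; apply/negP => /hi h.
by have := le_trans (lo s1_gt0 (lexx _)) h; rewrite leNgt gtrN.
Qed.

Let t12 : t1 < t2.
Proof. by rewrite ltr_pXn2r// ?nnegrE ltW. Qed.

Let t1_gt0 : 0 < t1. Proof. by rewrite exprn_gt0. Qed.

Let W_out (t : R) : 0 < t -> ~~ (t \in `[t1, t2]) -> W t = 0.
Proof.
move=> t0; rewrite in_itv/= negb_and -!ltNge => h; rewrite /W.
have r0 := nth_root_gt0 d t.
case/orP : h => h.
- rewrite tent_pos ?mulr0//; apply: lo => //.
  by rewrite -(@ler_pXn2r _ n)// ?nnegrE ?ltW// nth_rootK.
- rewrite tent_neg ?mulr0//; apply: hi.
  by rewrite -(@ler_pXn2r _ n)// ?nnegrE ?ltW// nth_rootK.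
Qed.

Let integral_W : (\int[mu]_(t in `]0%R, +oo[) (W t)%:E = (n%:R * k%:R)%:E)%E.
Proof.
have : (\int[mu]_(t in `[t1, t2]) (W t)%:E = (n%:R * k%:R)%:E)%E.
  have pos t : t \in `[t1, t2] -> 0 < t.
    by rewrite in_itv/= => /andP[/(lt_le_trans t1_gt0)].
  rewrite [LHS](@FTC2 R G W t1 t2 t12 (fun t ht => is_derive_G (pos t ht)) (fun t ht => continuous_W (pos t ht))).
  rewrite /G /t1 /t2 !nth_rootXK// d_soft_pos_neg ?d_soft_pos_pos//; first by congr EFin; ring.
  - exact: lo.
  - exact: hi.
rewrite integral_mkcond => <-.
rewrite [LHS]integral_mkcond.
apply: eq_integral => t _; rewrite !patchE.
case: ifPn => t0; case: ifPn => t1t2 //.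
- rewrite inE/= in_itv/= andbT in t0.
  rewrite W_out//.
  by apply/negP => h; move/negP : t1t2; apply; rewrite inE.
- exfalso; move/negP : t0; apply; rewrite inE/= in_itv/= andbT.
  by move: t1t2; rewrite inE/= in_itv/= => /andP[/(lt_le_trans t1_gt0)].
Qed.

Let W_neq0 (t : R) : 0 < t -> W t != 0 -> `|nth_root t ^- k - a| < dl.
Proof.
move=> t0; apply: contraNT; rewrite -leNgt ler_normr /W => /orP[h|h].
- by rewrite tent_pos ?mulr0.
- by rewrite tent_neg ?mulr0// lerNr.
Qed.

Variables (h Q F : E -> R).
Hypothesis iF : (leb n).-integrable setT (EFin \o F).
Hypothesis FE : forall x, F x =
  h x * (Q x * tent dl (enorm x ^- k - a) * (k%:R ^+ 2 * enorm x ^- (2 * k + 2))).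
Hypothesis homQ : forall s x, 0 < s -> Q (s *: x) = s ^+ l * Q x.
Hypothesis ih : forall s, 0 < s -> `|s ^- k - a| < dl ->
  sg.-integrable S (fun y => (h (s *: y) * Q y)%:E).

Let beta (s : R) := s ^- l * \int[sg]_(y in S) (h (s *: y) * Q y).

Let inner (t : R) : 0 < t ->
  (\int[sg]_y (F (nth_root t *: y))%:E = (W t * beta (nth_root t))%:E)%E.
Proof.
move=> t0; have r0 := nth_root_gt0 d t.
have mF : measurable_fun setT F by apply/measurable_EFinP; exact: measurable_int iF.
rewrite integral_surf_sphere; last first.
  apply/measurable_EFinP; apply: measurableT_comp => //.
  have -> : *:%R (nth_root t) = aff (nth_root t) (0 : E).
    by apply/funext => x; rewrite /aff addr0.
  exact: measurable_aff.
have E1 y : S y -> F (nth_root t *: y) = W t * nth_root t ^- l * (h (nth_root t *: y) * Q y).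
  rewrite /esphere/= => y1; rewrite FE enormZ y1 mulr1 gtr0_norm// homQ// /W.
  have -> : nth_root t ^- (2 * k + 2) = nth_root t ^- (k + n) * (nth_root t ^- l * nth_root t ^- l).
    rewrite -!invfM -!exprD; congr (_ ^+ _)^-1; lia.
  by field; rewrite !expf_neq0 ?gt_eqF.
under eq_integral => y yS do rewrite (E1 _ (set_mem yS)).
have [->|W0] := eqVneq (W t) 0.
  by rewrite [in RHS]mul0r; apply: integral0_eq => y _; rewrite !mul0r.
under eq_integral do rewrite EFinM.
rewrite integralZl//; [|exact: measurable_esphere|by apply: ih => //; exact: W_neq0].
rewrite /beta mulrA [RHS]EFinM; congr (_ * _)%E.
rewrite /Rintegral fineK//; apply: integrable_fin_num; first exact: measurable_esphere.
by apply: ih => //; exact: W_neq0.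
Qed.

(** In polar coordinates the integral is the average of beta against a weight W >= 0
    of total mass n k, which is carried by the radii with |s^-k - a| < dl. *)
Lemma shell_average (A eps : R) :
  (forall s, 0 < s -> `|s ^- k - a| < dl -> `|beta s - A| <= eps) ->
  `|\int[leb n]_x F x - k%:R * A| <= k%:R * eps.
Proof.
move=> hb.
have F0 : F 0 = 0.
  have z : (0 : R) ^- (2 * k + 2) = 0 by rewrite addn2 expr0n/= invr0.
  by rewrite FE enorm0 z !mulr0.
have [iI IE] := integral_polar iF F0.
have mpos : measurable (`]0, +oo[%classic : set (measurableTypeR R)) by exact: measurable_itv.
have posE t : (`]0, +oo[%classic : set R) t -> 0 < t by rewrite /= in_itv/= andbT.
have iW : mu.-integrable `]0, +oo[ (EFin \o W).
  apply/integrableP; split.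
    apply/measurable_EFinP; apply: open_continuous_measurable_fun => //.
    by move=> t; rewrite inE => /posE; exact: continuous_W.
  under eq_integral do rewrite /= ger0_norm ?W_ge0//.
  by rewrite integral_W ltry.
have iWb : mu.-integrable `]0, +oo[ (EFin \o (fun t => W t * beta (nth_root t))).
  apply: eq_integrable iI => // t; rewrite inE => /posE t0; exact: inner.
have IE2 : n%:R * \int[leb n]_x F x = \int[mu]_(t in `]0, +oo[) (W t * beta (nth_root t)).
  have -> : n%:R = fine n%:R%:E :> R by [].
  rewrite /Rintegral -fineM//; last by apply: integrable_fin_num.
  rewrite IE; congr fine; apply: eq_integral => t; rewrite inE => /posE; exact: inner.
have IW : \int[mu]_(t in `]0, +oo[) W t = n%:R * k%:R by rewrite /Rintegral integral_W.
have iWA : mu.-integrable `]0, +oo[ (EFin \o (fun t => W t * A)).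
  by have := integrableZr mpos A iW.
have iWe : mu.-integrable `]0, +oo[ (EFin \o (fun t => W t * eps)).
  by have := integrableZr mpos eps iW.
have n0 : 0 < n%:R :> R by rewrite ltr0n.
have E1 : n%:R * `|\int[leb n]_x F x - k%:R * A| =
    `|\int[mu]_(t in `]0, +oo[) (W t * beta (nth_root t) - W t * A)|.
  rewrite -[X in X * _](gtr0_norm n0) -normrM mulrBr IE2 mulrA -IW.
  by rewrite -RintegralZr// -RintegralB.
have E2 : n%:R * (k%:R * eps) = \int[mu]_(t in `]0, +oo[) (W t * eps).
  by rewrite mulrA -IW -RintegralZr.
rewrite -(ler_pM2l n0) E1 E2.
have iD : mu.-integrable `]0, +oo[ (EFin \o (fun t => W t * beta (nth_root t) - W t * A)).
  by have := integrableB mpos iWb iWA.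
apply: le_trans (le_normr_Rintegral mpos iD) _.
apply: le_Rintegral => //; first exact: integrable_norm iD.
move=> t /posE t0 /=; rewrite -mulrBr normrM ger0_norm//.
have [->|W0] := eqVneq (W t) 0; first by rewrite !mul0r.
by rewrite ler_wpM2l// hb ?nth_root_gt0//; exact: W_neq0.
Qed.
End shell.

(** * Functions defined outside a ball *)

Section annulus.
Context {R : realType} (n : nat).
Local Notation E := 'rV[R]_n.
Local Notation S := (@esphere R n 1).
Local Notation sg := (@surf R n 1).

Lemma measurable_scale (c : R) (D : set E) : measurable_fun D (fun x : E => c *: x).
Proof.
apply: measurable_funTS; have -> : (fun x : E => c *: x) = aff c (0 : E).
  by apply/funext => x; rewrite /aff addr0.
exact: measurable_aff.
Qed.

Lemma closed_enorm (I : interval R) : closed [set` I] -> closed [set x : E | enorm x \in I].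
Proof.
by move=> cI; apply: (@preimage_closed _ _ (@enorm R n) [set` I]) => // x _; exact: continuous_enorm.
Qed.

Lemma measurable_exterior (r : R) : measurable [set x : E | r <= enorm x].
Proof.
have -> : [set x : E | r <= enorm x] = @enorm R n @^-1` `[r, +oo[.
  by apply/seteqP; split => x /=; rewrite in_itv/= andbT.
by rewrite -[X in measurable X]setTI; exact: measurable_enorm.
Qed.

Lemma compact_annulus (r B : R) : compact [set x : E | enorm x \in `[r, B]].
Proof.
apply: (@subclosed_compact _ _ (box 0 B)); [| exact: box_compact|].
  by apply: closed_enorm; exact: itv_closed.
by move=> x /=; rewrite in_itv/= => /andP[_ h]; exact: enorm_le_box.
Qed.

Variables (r : R) (u : E -> R) (Q : E -> R).
Hypothesis r0 : 0 < r.
Hypothesis cu : {within [set x | r <= enorm x], continuous u}.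
Hypothesis cQ : continuous Q.

Lemma exterior_bounded (B : R) : exists2 M, 0 < M & forall x, r <= enorm x -> enorm x <= B -> `|u x| <= M.
Proof.
have [||M M0 h] := @within_continuous_bounded R n [set x : E | enorm x \in `[r, B]] u.
- exact: compact_annulus.
- by apply: continuous_subspaceW cu => x /=; rewrite in_itv/= => /andP[].
- by exists M => // x rx xB; apply: h; rewrite /= in_itv/= rx xB.
Qed.

Lemma sphere_bounded : exists2 M, 0 < M & forall x : E, enorm x = 1 -> `|Q x| <= M.
Proof.
have [||M M0 h] := @within_continuous_bounded R n (box 0 1) Q.
- exact: box_compact.
- exact: continuous_subspaceT.
- by exists M => // x x1; apply: h; apply: enorm_le_box; rewrite x1.
Qed.

Lemma exterior_dilate_measurable (s : R) : r <= s -> measurable_fun S (fun y => u (s *: y)).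
Proof.
move=> rs; apply: (measurable_comp (measurable_exterior r)).
- move=> _ [y /= y1 <-] /=; rewrite enormZ y1 mulr1 ger0_norm//.
  by rewrite (le_trans _ rs)// ltW.
- by apply: within_continuous_measurable => //; exact: measurable_exterior.
- exact: measurable_scale.
Qed.

Lemma exterior_integrable (s : R) : r <= s ->
  sg.-integrable S (fun y => (u (s *: y) * Q y)%:E).
Proof.
move=> rs; have s0 : 0 < s by exact: lt_le_trans rs.
have [M M0 uM] := exterior_bounded s; have [N N0 QN] := sphere_bounded.
apply: (@bounded_integrable R _ _ sg S (fun y => u (s *: y) * Q y) (M * N)).
- exact: measurable_esphere.
- by apply: surf_lty; exact: measurable_esphere.
- apply: measurable_funM; first exact: exterior_dilate_measurable.
  by apply: measurable_funTS; exact: continuous_measurable.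
- move=> y y1; rewrite normrM ler_pM// ?QN// uM// enormZ y1 mulr1 gtr0_norm//.
Qed.

Lemma continuous_exterior_ray (y : E) : S y ->
  continuous (fun s : R => u (Num.max s r *: y)).
Proof.
move=> y1 s; have sr : r <= enorm (Num.max s r *: y).
  by rewrite enormZ y1 mulr1 (le_trans _ (ler_norm _))// le_max lexx orbT.
have cphi : (fun s : R => Num.max s r *: y) @ s --> Num.max s r *: y.
  apply: (@continuous_comp _ _ _ (fun s : R => Num.max s r) (fun c : R => c *: y)).
    by apply: continuous_max; [exact: cvg_id|exact: cvg_cst].
  exact: scalel_continuous.
move/subspace_continuousP : cu => /(_ _ sr) h.
apply: (@cvg_comp _ _ _ (fun t : R => Num.max t r *: y) u _ _ _ _ h) => A hA.
apply: (@filterS _ (nbhs s) _ _ _ _ (cphi _ hA)) => t /=; apply; rewrite enormZ y1 mulr1.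
by rewrite (le_trans _ (ler_norm _))// le_max lexx orbT.
Qed.

(** The radius is truncated from below at r so that the moment is defined for every s
    and is continuous up to the boundary sphere. *)
Lemma continuous_truncated_moment :
  continuous (fun s : R => \int[sg]_(y in S) (u (Num.max s r *: y) * Q y)).
Proof.
move=> x.
have [M M0 uM] := exterior_bounded (Num.max (x + 1) r); have [N N0 QN] := sphere_bounded.
apply: (@continuity_under_integral R _ _ sg (fun s y => u (Num.max s r *: y) * Q y) S
  (measurable_esphere 1) (x - 1) (x + 1) _ _ (cst (M * N)) _ _ x).
- move=> s _; apply: exterior_integrable; by rewrite le_max lexx orbT.
- apply: aeW => y y1 s _; apply: cvgM; last exact: cvg_cst.
  exact: continuous_exterior_ray.
- by apply: finite_measure_integrable_cst; exact: measurable_esphere.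
- move=> s; rewrite /= in_itv/= => /andP[_ sx]; apply: aeW => y y1.
  rewrite normrM ler_pM// ?QN// uM// enormZ y1 mulr1 gtr0_norm ?lt_max ?r0 ?orbT//.
  + by rewrite le_max lexx orbT.
  + by rewrite ge_max !le_max lexx (ltW sx) orbT.
- by rewrite inE/= in_itv/= gtrDl ltrDl ltrN10 ltr01.
Qed.

End annulus.

(** * Test functions whose Laplacian lives on finitely many shells *)

Section finite_sums.
Context d (T : measurableType d) (R : realType) (mu : {measure set T -> \bar R}).
Variables (D : set T) (mD : measurable D).

Lemma Rintegral_sum (I : finType) (f : I -> T -> R) :
  (forall i, mu.-integrable D (EFin \o f i)) ->
  \int[mu]_(x in D) (\sum_i f i x) = \sum_i \int[mu]_(x in D) f i x.
Proof.
move=> fi; rewrite /Rintegral; under eq_integral do rewrite -sumEFin.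
rewrite integral_sum//.
rewrite (eq_bigr (fun i => (fine (\int[mu]_(x in D) (f i x)%:E))%:E)); last first.
  by move=> i _; rewrite fineK//; exact: (integrable_fin_num mD (fi i)).
by rewrite sumEFin.
Qed.
End finite_sums.

Section test_function.
Context {R : realType} (d : nat).
Local Notation n := d.+1.
Local Notation E := 'rV[R]_n.
Local Notation S := (@esphere R n 1).
Local Notation sg := (@surf R n 1).

Variables (m : nat) (c a : 'I_m -> R) (dl : R).
Hypothesis dl0 : 0 < dl.

(** The profile P of the test functions.  It vanishes for small t, that is far from
    the origin.  If the c j add up to 0 it is constant for large t, that is near the
    origin. *)
Definition soft_sum t : R := \sum_j c j * soft_pos dl (t - a j).
Definition d_soft_sum t : R := \sum_j c j * d_soft_pos dl (t - a j).
Definition dd_soft_sum t : R := \sum_j c j * tent dl (t - a j).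

Lemma is_derive_shiftZ (f g : R -> R) (b e t : R) :
  (forall s : R, is_derive s 1 f (g s)) ->
  is_derive t 1 (fun t => b * f (t - e)) (b * g (t - e)).
Proof.
move=> df; have D : is_derive t 1 (fun t => f (t - e)) (g (t - e)).
  by apply: is_derive_transfer (df (t - e)) => h; rewrite addrA.
exact: is_deriveZ.
Qed.

Lemma is_derive_soft_sum (t : R) : is_derive t 1 soft_sum (d_soft_sum t).
Proof.
have -> : soft_sum = \sum_j (fun t => c j * soft_pos dl (t - a j)).
  by apply/funext => s; rewrite fct_sumE.
apply: is_derive_sum => j; apply: is_derive_shiftZ => s; exact: is_derive_soft_pos.
Qed.

Lemma is_derive_d_soft_sum (t : R) : is_derive t 1 d_soft_sum (dd_soft_sum t).
Proof.
have -> : d_soft_sum = \sum_j (fun t => c j * d_soft_pos dl (t - a j)).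
  by apply/funext => s; rewrite fct_sumE.
apply: is_derive_sum => j; apply: is_derive_shiftZ => s; exact: is_derive_d_soft_pos.
Qed.

Lemma continuous_dd_soft_sum : continuous dd_soft_sum.
Proof.
move=> t; apply: cvg_sumr => j; apply: cvgM; first exact: cvg_cst.
apply: (@continuous_comp _ _ _ (fun t => t - a j) (tent dl)); last exact: continuous_tent.
by apply: cvgB; [exact: cvg_id|exact: cvg_cst].
Qed.

Lemma soft_sum_small t : (forall j, t <= a j - dl) ->
  [/\ soft_sum t = 0, d_soft_sum t = 0 & dd_soft_sum t = 0].
Proof.
move=> h; have h' j : t - a j <= - dl by have := h j; lra.
by split; apply: big1 => j _; rewrite ?soft_pos_neg ?d_soft_pos_neg ?tent_neg ?mulr0.
Qed.

Hypothesis c0 : \sum_j c j = 0.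

Lemma soft_sum_large t : (forall j, a j + dl <= t) ->
  [/\ soft_sum t = - \sum_j c j * a j, d_soft_sum t = 0 & dd_soft_sum t = 0].
Proof.
move=> h; have h' j : dl <= t - a j by have := h j; lra.
split.
- rewrite /soft_sum; under eq_bigr do rewrite soft_pos_pos// mulrBr.
  by rewrite sumrB -mulr_suml c0 mul0r sub0r.
- by rewrite /d_soft_sum; under eq_bigr do rewrite d_soft_pos_pos// mulr1.
- by apply: big1 => j _; rewrite tent_pos ?mulr0.
Qed.

Variables (Q : E -> R) (gQ hQ : 'I_n -> E -> R) (l k : nat).
Hypothesis CQ : forall x, C2data Q gQ hQ x.
Hypothesis harmQ : forall x, \sum_i hQ i x = 0.
Hypothesis eulerQ : forall x : E, \sum_i x 0 i * gQ i x = l%:R * Q x.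
Hypothesis homQ : forall (s : R) x, 0 < s -> Q (s *: x) = s ^+ l * Q x.
Hypothesis kE : (k + 2 = 2 * l + n)%N.
Hypothesis k0 : (0 < k)%N.

Variables (amin amax : R).
Hypothesis amin0 : 0 < amin.
Hypothesis aminP : forall j, amin <= a j - dl.
Hypothesis amaxP : forall j, a j + dl <= amax.

Let cst := - \sum_j c j * a j.

Definition shell_test := radial_mult Q k soft_sum cst.
Definition d_shell_test := d_radial_mult Q gQ k soft_sum d_soft_sum cst.
Definition dd_shell_test := dd_radial_mult Q gQ hQ k soft_sum d_soft_sum dd_soft_sum cst.

Let PM t : amax <= t -> [/\ soft_sum t = cst, d_soft_sum t = 0 & dd_soft_sum t = 0].
Proof. by move=> h; apply: soft_sum_large => j; exact: le_trans (amaxP j) h. Qed.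

Lemma C2_shell_test x : C2data shell_test d_shell_test dd_shell_test x.
Proof.
exact: (C2_radial_mult CQ k0 is_derive_soft_sum is_derive_d_soft_sum continuous_dd_soft_sum PM).
Qed.

Lemma laplacian_shell_test x : \sum_i dd_shell_test i x =
  Q x * dd_soft_sum (enorm x ^- k) * (k%:R ^+ 2 * enorm x ^- (2 * k + 2)).
Proof. exact: (laplacian_radial_mult harmQ eulerQ kE). Qed.

Definition shell_test_radius : R := Num.max 1 amin^-1.

Lemma enormVn_small (x : E) : shell_test_radius <= enorm x -> enorm x ^- k <= amin.
Proof.
rewrite ge_max => /andP[h1 h2]; have e0 : 0 < enorm x by apply: lt_le_trans h1.
apply: (@le_trans _ _ (enorm x)^-1).
  by rewrite lef_pV2 ?posrE ?exprn_gt0 // -[leLHS]expr1 ler_weXn2l.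
by rewrite -[leRHS]invrK lef_pV2 ?posrE ?invr_gt0.
Qed.

Lemma notin_box (x : E) : ~ box 0 shell_test_radius x -> shell_test_radius < enorm x.
Proof. by move=> h; rewrite ltNge; apply/negP => /enorm_le_box. Qed.

Lemma shell_test_radius_gt0 : 0 < shell_test_radius.
Proof. by rewrite lt_max ltr01. Qed.

Lemma shell_test_support (x : E) : ~ box 0 shell_test_radius x ->
  shell_test x = 0 /\ forall i, d_shell_test i x = 0 /\ dd_shell_test i x = 0.
Proof.
move=> /notin_box h.
have [|e1 e2 e3] := @soft_sum_small (enorm x ^- k).
  by move=> j; exact: le_trans (enormVn_small (ltW h)) (aminP j).
apply: radial_mult_eq0 => //; rewrite -enorm_gt0; apply: lt_trans h; exact: shell_test_radius_gt0.
Qed.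

Section shell_sum.
Variables (r : R) (u : E -> R).
Hypothesis r0 : 0 < r.
Hypothesis cu : forall x, r < enorm x -> {for x, continuous u}.
Hypothesis ramax : amax < r ^- k.

Let Fj j (x : E) := u x * (Q x * tent dl (enorm x ^- k - a j) * (k%:R ^+ 2 * enorm x ^- (2 * k + 2))).

(** The strict inequality amax < r^-k leaves some room beyond the closed ball of
    radius r, so the profile is constant on a neighbourhood of that ball. *)
Lemma near_inner (x : E) : 0 < amax -> enorm x <= r ->
  \forall y \near x, y = 0 \/ amax <= enorm y ^- k.
Proof.
move=> am0 xr; pose r' := expR (- (ln amax / k%:R)).
have r'0 : 0 < r' by exact: expR_gt0.
have r'k : r' ^- k = amax.
  rewrite -expRM_natr -expRN mulNr opprK divfK ?pnatr_eq0 -?lt0n//.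
  by rewrite lnK.
have rr' : r < r'.
  rewrite ltNge; apply/negP => h; move: ramax; rewrite -r'k ltNge.
  by rewrite lef_pV2 ?posrE ?exprn_gt0// ler_pXn2r ?nnegrE ?(ltW r0) ?(ltW r'0)// h.
have h : enorm x < r' by apply: le_lt_trans rr'.
have : \forall y \near x, enorm y < r' by exact: (@continuous_enorm R n x _ (lt_nbhsl h)).
apply: filterS => y yr'.
have [->|y0] := eqVneq y 0; [by left|right].
by rewrite -r'k lef_pV2 ?posrE ?exprn_gt0 ?enorm_gt0// ler_pXn2r// ?nnegrE ?enorm_ge0// ltW.
Qed.

Hypothesis am0 : 0 < amax.

Let cF j : continuous (Fj j).
Proof.
apply: continuous_support => // x; have [xr|rx] := leP (enorm x) r.
  right; apply: filterS (near_inner am0 xr) => y [->|h]; rewrite /Fj.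
    have -> : enorm (0 : E) ^- (2 * k + 2) = 0 by rewrite enorm0 addn2 expr0n/= invr0.
    by rewrite !mulr0.
  rewrite tent_pos ?mulr0 ?mul0r ?mulr0//.
  by rewrite lerBrDl (le_trans (amaxP j)).
left; have x0 : x != 0 by rewrite -enorm_gt0 (lt_trans r0).
apply: contM; first exact: cu.
apply: contM.
  apply: contM; first exact: (CQ x).1.
  apply: (@continuous_comp _ _ _ (fun y : E => enorm y ^- k - a j) (tent dl)); last exact: continuous_tent.
  by apply: contB; [exact: continuous_enormVn|exact: contC].
by apply: contM; [exact: contC|exact: continuous_enormVn].
Qed.

Let iF j : (leb n).-integrable setT (EFin \o Fj j).
Proof.
apply: (@integrable_leb R n _ shell_test_radius); first exact: cF.
move=> x /notin_box h; rewrite /Fj tent_neg ?mulr0 ?mul0r ?mulr0//.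
by have := enormVn_small (ltW h); have := aminP j; lra.
Qed.

Variables (B : 'I_m -> R) (eps : R).
Hypothesis ih : forall s, r < s -> sg.-integrable S (fun y => (u (s *: y) * Q y)%:E).
Hypothesis hB : forall j s, 0 < s -> `|s ^- k - a j| < dl ->
  `|s ^- l * \int[sg]_(y in S) (u (s *: y) * Q y) - B j| <= eps.

Lemma shell_sum :
  `|\int[leb n]_x (u x * \sum_i dd_shell_test i x) - k%:R * \sum_j c j * B j| <=
   k%:R * eps * \sum_j `|c j|.
Proof.
have -> : \int[leb n]_x (u x * \sum_i dd_shell_test i x) = \sum_j c j * \int[leb n]_x Fj j x.
  have -> : \sum_j c j * \int[leb n]_x Fj j x = \sum_j \int[leb n]_x (c j * Fj j x).
    by apply: eq_bigr => j _; rewrite RintegralZl//; exact: iF.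
  rewrite -Rintegral_sum//; last by move=> j; have := integrableZl measurableT (c j) (iF j).
  apply: eq_Rintegral => x _; rewrite laplacian_shell_test /dd_soft_sum mulr_sumr mulr_suml mulr_sumr.
  by apply: eq_bigr => j _; rewrite /Fj; ring.
rewrite mulr_sumr -sumrB mulr_sumr.
apply: le_trans (ler_norm_sum _ _ _) _; apply: ler_sum => j _.
rewrite mulrCA -mulrBr normrM mulrC ler_wpM2r//.
apply: (@shell_average R d k l (a j) dl kE k0 dl0 _ u Q (Fj j) (iF j)) => //.
- by rewrite -subr_gt0 (lt_le_trans amin0 (aminP j)).
- move=> s s0 h; apply: ih; rewrite ltNge; apply/negP => sr.
  have : amax < s ^- k.
    apply: lt_le_trans ramax _; rewrite lef_pV2 ?posrE ?exprn_gt0//.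
    by rewrite ler_pXn2r// ?nnegrE ltW.
  by have := amaxP j; move: h; rewrite ltr_norml => /andP[_]; lra.
- exact: hB.
Qed.

End shell_sum.
End test_function.

(** * From shells to spheres *)

Section shell_limit.
Context {R : realType} (d : nat).
Local Notation n := d.+1.
Local Notation E := 'rV[R]_n.
Local Notation S := (@esphere R n 1).
Local Notation sg := (@surf R n 1).

Variables (Q : E -> R) (gQ hQ : 'I_n -> E -> R) (l k : nat).
Hypothesis CQ : forall x, C2data Q gQ hQ x.
Hypothesis harmQ : forall x, \sum_i hQ i x = 0.
Hypothesis eulerQ : forall x : E, \sum_i x 0 i * gQ i x = l%:R * Q x.
Hypothesis homQ : forall (s : R) x, 0 < s -> Q (s *: x) = s ^+ l * Q x.
Hypothesis kE : (k + 2 = 2 * l + n)%N.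
Hypothesis k0 : (0 < k)%N.

Variables (r : R) (u : E -> R).
Hypothesis r0 : 0 < r.
Hypothesis cu : {within [set x | r <= enorm x], continuous u}.
Hypothesis cui : forall x, r < enorm x -> {for x, continuous u}.

Let cQ : continuous Q. Proof. by move=> x; exact: (CQ x).1. Qed.

Definition sphere_moment (s : R) : R := \int[sg]_(y in S) (u (s *: y) * Q y).

Let bt (s : R) : R := s ^- l * sphere_moment s.

Lemma continuous_sphere_moment : continuous (fun s => sphere_moment (Num.max s r)).
Proof. exact: continuous_truncated_moment. Qed.

Let btm (s : R) : R := s ^- l * sphere_moment (Num.max s r).

Let cbtm s : 0 < s -> {for s, continuous btm}.
Proof.
move=> s0; apply: cvgM; last exact: continuous_sphere_moment.
exact: is_derive_continuous (is_derive_exprVn l s0).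
Qed.

Let rk (t : R) := expR (- (ln t / k%:R)).

Let rkK s : 0 < s -> rk (s ^- k) = s.
Proof.
move=> s0; rewrite /rk lnV ?posrE ?exprn_gt0// lnXn//.
by rewrite mulNr opprK -[ln s *+ k]mulr_natr mulfK ?pnatr_eq0 -?lt0n// lnK.
Qed.

Let btm_window s eps : 0 < s -> 0 < eps -> \forall dl \near 0^'+,
  forall s', 0 < s' -> `|s' ^- k - s ^- k| < dl -> `|btm s' - btm s| <= eps.
Proof.
move=> s0 eps0; have sk0 : 0 < s ^- k by rewrite invr_gt0 exprn_gt0.
have cg : {for s ^- k, continuous (btm \o rk)}.
  apply: continuous_comp; last by rewrite rkK//; exact: cbtm.
  apply: (@continuous_comp _ _ _ (fun t => - (ln t / k%:R)) expR); last exact: continuous_expR.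
  apply: cvgN; apply: cvgM; last exact: cvg_cst.
  exact: continuous_ln.
move/cvgrPdist_le : cg => /(_ _ eps0) /nbhs_ballP[e /= e0 he].
near=> dl => s' s'0 h.
have := he (s' ^- k); rewrite /= !rkK// distrC; apply.
rewrite /ball/= distrC; apply: lt_le_trans h _.
near: dl; exact: nbhs_right_le.
Unshelve. all: by end_near. Qed.

Variables (m : nat) (c s : 'I_m -> R) (V : R).
Hypothesis rs : forall j, r < s j.

Let a j := s j ^- k.

Hypothesis hV : forall dl, 0 < dl -> (forall j, dl <= a j - dl) ->
  (forall j, a j + dl <= r ^- k - dl) -> dl < r ^- k ->
  \int[leb n]_x (u x * \sum_i dd_shell_test c a dl Q gQ hQ k i x) = V.

(** When dl is small, the tents single out the spheres of radii s j, and the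
    continuous function s |-> s^-l [sphere_moment] s is nearly constant on each
    shell.  The integrals keep the same value V as dl varies, so the limit is V. *)
Lemma shell_limit : k%:R * \sum_j c j * bt (s j) = V.
Proof.
have s0 j : 0 < s j by exact: lt_trans r0 (rs j).
have rk0 : 0 < r ^- k by rewrite invr_gt0 exprn_gt0.
have a0 j : 0 < a j by rewrite invr_gt0 exprn_gt0.
have ark j : a j < r ^- k.
  by rewrite ltf_pV2 ?posrE ?exprn_gt0// ltr_pXn2r ?nnegrE ?ltW.
pose C := k%:R * \sum_j `|c j|.
have C0 : 0 <= C by rewrite mulr_ge0// sumr_ge0.
suff key eps : 0 < eps -> `|V - k%:R * \sum_j c j * bt (s j)| <= C * eps.
  apply/eqP; rewrite eq_sym -subr_eq0 -normr_le0; apply/ler_addgt0Pl => e e0; rewrite addr0.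
  have C1 : 0 < C + 1 by rewrite ltr_wpDl.
  apply: le_trans (key (e / (C + 1)) _) _; first exact: divr_gt0.
  rewrite mulrCA ger_pMr// ler_pdivrMr// mul1r lerDl//.
move=> eps0.
have near_dl : \forall dl \near 0^'+, [/\ 0 < dl, forall j, dl <= a j - dl,
    forall j, a j + dl <= r ^- k - dl, dl < r ^- k &
    forall j s', 0 < s' -> `|s' ^- k - a j| < dl -> `|btm s' - btm (s j)| <= eps].
  near=> dl; split.
  - near: dl; exact: nbhs_right_gt.
  - near: dl; apply: filter_forall => j; near=> dl.
    have : dl <= a j / 2 by near: dl; apply: nbhs_right_le; rewrite divr_gt0.
    by rewrite ler_pdivlMr//; lra.
  - near: dl; apply: filter_forall => j; near=> dl.
    have : dl <= (r ^- k - a j) / 2.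
      by near: dl; apply: nbhs_right_le; rewrite divr_gt0// subr_gt0.
    by rewrite ler_pdivlMr//; lra.
  - near: dl; exact: nbhs_right_lt.
  - near: dl; apply: filter_forall => j; exact: btm_window.
have [dl [dl0 h1 h2 h3 h4]] := filter_ex near_dl.
have gtr_r s' j : 0 < s' -> `|s' ^- k - a j| < dl -> r < s'.
  move=> s'0 h; rewrite ltNge; apply/negP => sr.
  have : r ^- k <= s' ^- k.
    rewrite lef_pV2 ?posrE ?exprn_gt0//.
    by rewrite ler_pXn2r ?nnegrE ?(ltW r0) ?(ltW s'0).
  by have := h2 j; move: h; rewrite ltr_norml => /andP[_]; lra.
rewrite -(hV dl0 h1 h2 h3).
have := @shell_sum R d m c a dl dl0 Q gQ hQ l k CQ harmQ eulerQ homQ kE k0 dl (r ^- k - dl)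
  dl0 h1 h2 r u r0 cui _ _ (bt \o s) eps.
rewrite /C mulrAC; apply.
- by rewrite gtrBl.
- by rewrite subr_gt0.
- move=> s' rs'; apply: (exterior_integrable r0 cu cQ (ltW rs')).
- move=> j s' s'0 h; have rs' := gtr_r _ _ s'0 h.
  by have := h4 j s' s'0 h; rewrite /btm /= (max_l (ltW rs')) (max_l (ltW (rs j))).
Unshelve. all: by end_near. Qed.

End shell_limit.

(** * Moments of exterior harmonic functions *)

Section sphere_moment_decay.
Context {R : realType} (d : nat).
Local Notation n := d.+1.
Local Notation E := 'rV[R]_n.
Local Notation S := (@esphere R n 1).
Local Notation sg := (@surf R n 1).
Variables (Q : E -> R) (r : R) (u : E -> R).
Hypothesis cQ : continuous Q.
Hypothesis r0 : 0 < r.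
Hypothesis cu : {within [set x | r <= enorm x], continuous u}.

Lemma sphere_moment_bound (s e N : R) : r <= s -> (forall x, enorm x = s -> `|u x| <= e) ->
  (forall x, S x -> `|Q x| <= N) -> `|sphere_moment Q u s| <= e * N * fine (sg S).
Proof.
move=> rs ue QN; have mS := @measurable_esphere R n 1.
have s0 : 0 < s by apply: lt_le_trans rs.
have i1 := exterior_integrable r0 cu cQ rs.
apply: le_trans (le_normr_Rintegral mS i1) _.
rewrite -(Rintegral_cst _ mS); apply: le_Rintegral => //.
- exact: integrable_norm i1.
- by apply: finite_measure_integrable_cst.
- by move=> y y1; rewrite normrM ler_pM ?QN// ue// enormZ y1 mulr1 gtr0_norm.
Qed.

Hypothesis vu : vanishes_at_infinity u.

Lemma sphere_moment_decay (eps : R) : 0 < eps -> exists M, forall s, r <= s -> M < s -> `|sphere_moment Q u s| <= eps.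
Proof.
move=> eps0; have [N N0 QN] := sphere_bounded cQ.
have C0 : 0 <= N * fine (sg S) by rewrite mulr_ge0 ?(ltW N0)// fine_ge0.
have C1 : 0 < N * fine (sg S) + 1 by rewrite ltr_wpDl.
have [M hM] := vu (divr_gt0 eps0 C1); exists M => s rs Ms.
apply: (le_trans (@sphere_moment_bound s (eps / (N * fine (sg S) + 1)) N rs _ QN)).
  by move=> x xs; apply/ltW/hM; rewrite xs.
by rewrite -mulrA mulrAC ler_pdivrMr// ler_pM2l// lerDl.
Qed.

End sphere_moment_decay.

Section exterior.
Context {R : realType} (d : nat).
Local Notation n := d.+1.
Local Notation E := 'rV[R]_n.
Local Notation S := (@esphere R n 1).
Local Notation sg := (@surf R n 1).

Variables (Q : E -> R) (gQ hQ : 'I_n -> E -> R) (l k : nat).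
Hypothesis CQ : forall x, C2data Q gQ hQ x.
Hypothesis harmQ : forall x, \sum_i hQ i x = 0.
Hypothesis eulerQ : forall x : E, \sum_i x 0 i * gQ i x = l%:R * Q x.
Hypothesis homQ : forall (s : R) x, 0 < s -> Q (s *: x) = s ^+ l * Q x.
Hypothesis kE : (k + 2 = 2 * l + n)%N.
Hypothesis k0 : (0 < k)%N.

Variables (r : R) (u : E -> R) (gu hu : 'I_n -> E -> R).
Hypothesis r0 : 0 < r.
Hypothesis cu : {within [set x | r <= enorm x], continuous u}.
Hypothesis Cu : forall x, r < enorm x -> C2data u gu hu x.
Hypothesis harmu : forall x, r < enorm x -> \sum_i hu i x = 0.
Hypothesis vu : vanishes_at_infinity u.

Let cQ : continuous Q. Proof. by move=> x; exact: (CQ x).1. Qed.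
Let bt (s : R) : R := s ^- l * sphere_moment Q u s.

(** The two linear conditions on c make the profile vanish both far away and near the
    ball, so Green's identity applies with u harmonic on the support of the test
    function. *)
Lemma exterior_combination m (c s : 'I_m -> R) : \sum_j c j = 0 ->
  (forall j, r < s j) -> \sum_j c j * s j ^- k = 0 ->
  \sum_j c j * bt (s j) = 0.
Proof.
move=> c0 rs ca0; have kn0 : k%:R != 0 :> R by rewrite pnatr_eq0 -lt0n.
apply: (mulfI kn0); rewrite mulr0.
apply: (shell_limit CQ harmQ eulerQ homQ kE k0 r0 cu (fun x rx => (Cu rx).1) (V := 0) rs).

move=> dl dl0 h1 h2 h3.
pose a j := s j ^- k.
have am0 : 0 < r ^- k - dl by rewrite subr_gt0.
have am1 : r ^- k - dl < r ^- k by rewrite gtrBl.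
have PM t : r ^- k - dl <= t -> [/\ soft_sum c a dl t = 0, d_soft_sum c a dl t = 0 & dd_soft_sum c a dl t = 0].
  move=> h; have := @soft_sum_large R m c a dl dl0 c0 t _.
  by rewrite ca0 oppr0; apply => j; exact: le_trans (h2 j) h.
pose w := @shell_test R d m c a dl Q k.
have w00 (y : E) : y = 0 \/ r ^- k - dl <= enorm y ^- k ->
    w y = 0 /\ forall i, d_shell_test c a dl Q gQ k i y = 0 /\ dd_shell_test c a dl Q gQ hQ k i y = 0.
  have [-> _|y0 [/eqP|/PM[p p1 p2]]] := eqVneq y 0.
  - by apply: radial_mult_at0; rewrite ca0 oppr0.
  - by rewrite (negbTE y0).
  - exact: radial_mult_eq0.
rewrite (@green R n u w gu hu (d_shell_test c a dl Q gQ k) (dd_shell_test c a dl Q gQ hQ k) (shell_test_radius dl)).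
- rewrite /Rintegral (_ : (\int[leb n]_x _)%E = 0%E)//.
  apply: integral0_eq => x _; have [xr|rx] := leP (enorm x) r.
    have [-> _] := w00 _ (nbhs_singleton (near_inner k0 r0 am1 am0 xr)).
    by rewrite mul0r.
  by rewrite harmu// mulr0.
- exact: (C2_shell_test dl0 c0 CQ k0 h2).
- move=> x; exact: (shell_test_support c dl0 Q gQ hQ k0 dl0 h1).
- move=> x; have [xr|rx] := leP (enorm x) r; last by left; exact: Cu.
  right; apply: filterS (near_inner k0 r0 am1 am0 xr) => y; exact: w00.
Qed.

(** Three spheres of radii s1, s2, s3 satisfy a linear relation, whose coefficients
    are the differences of the numbers s j^-k; let s3 tend to infinity. *)
Lemma exterior_ratio s1 s2 : r < s1 -> r < s2 -> s2 ^- k * bt s1 = s1 ^- k * bt s2.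
Proof.
move=> rs1 rs2; apply/eqP; rewrite -subr_eq0 -normr_le0; apply/ler_addgt0Pl => e e0; rewrite addr0.
pose C := `|bt s1 - bt s2| + `|s1 ^- k - s2 ^- k|.
have C1 : 0 < C + 1 by rewrite ltr_wpDl// addr_ge0.
pose eps := e / (C + 1); have eps0 : 0 < eps by rewrite divr_gt0.
have [M hM] := sphere_moment_decay cQ r0 cu vu eps0.
(* Large enough for s3^-k and for the moment at s3 to be at most eps. *)
pose s3 := Num.max (Num.max (r + 1) (M + 1)) (Num.max 1 eps^-1).
have rs3 : r < s3 by rewrite !lt_max ltrDl ltr01.
have Ms3 : M < s3 by rewrite !lt_max ltrDl ltr01 orbT.
have s31 : 1 <= s3 by rewrite !le_max lexx !orbT.
have s3e : eps^-1 <= s3 by rewrite !le_max lexx !orbT.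
have s30 : 0 < s3 by apply: lt_le_trans s31.
have p1 i : s3 ^- i <= 1 by rewrite invf_le1 ?exprn_gt0// exprn_ege1.
have a3 : s3 ^- k <= eps.
  apply: (@le_trans _ _ s3^-1); first by rewrite lef_pV2 ?posrE ?exprn_gt0// -[leLHS]expr1 ler_weXn2l.
  by rewrite -[leRHS]invrK lef_pV2 ?posrE ?invr_gt0.
have b3 : `|bt s3| <= eps.
  rewrite /bt normrM ger0_norm ?invr_ge0 ?exprn_ge0 ?(ltW s30)//.
  apply: le_trans (hM s3 (ltW rs3) Ms3).
  by rewrite ler_piMl.
pose s (j : 'I_3) := nth 0 [:: s1; s2; s3] j.
pose c (j : 'I_3) := nth 0 [:: s2 ^- k - s3 ^- k; s3 ^- k - s1 ^- k; s1 ^- k - s2 ^- k] j.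
have := @exterior_combination 3 c s.
rewrite !big_ord_recl !big_ord0 /c /s /= => H.
have {H} : (s2 ^- k - s3 ^- k) * bt s1 + ((s3 ^- k - s1 ^- k) * bt s2 + ((s1 ^- k - s2 ^- k) * bt s3 + 0)) = 0.
  apply: H; [by ring| |by ring].
  by case; case=> [|[|[|]]].
move=> H.
have -> : s2 ^- k * bt s1 - s1 ^- k * bt s2 = s3 ^- k * (bt s1 - bt s2) - (s1 ^- k - s2 ^- k) * bt s3.
  by apply/eqP; rewrite -subr_eq0 -H; apply/eqP; ring.
apply: le_trans (ler_normB _ _) _; rewrite [X in X + _]normrM [X in _ + X]normrM.
have -> : e = eps * (C + 1) by rewrite /eps mulfVK// gt_eqF.
apply: (@le_trans _ _ (eps * C)); last by rewrite ler_pM2l// lerDl.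
rewrite mulrDr lerD//.
  by rewrite ler_wpM2r// ger0_norm ?invr_ge0 ?exprn_ge0 ?(ltW s30).
by rewrite mulrC; apply: ler_wpM2r b3; exact: normr_ge0.
Qed.

(** This is [exterior_ratio] between the unit sphere and a sphere whose radius
    decreases to r. *)
Lemma exterior_moment : r < 1 -> r ^+ l * sphere_moment Q u 1 = r ^+ k * sphere_moment Q u r.
Proof.
move=> r1.
pose g (s : R) := 1 ^- k * (s ^- l * sphere_moment Q u (Num.max s r)) - s ^- k * bt 1.
have cg : {for r, continuous g}.
  apply: cvgB.
    apply: cvgM; first exact: cvg_cst.
    apply: cvgM; last exact: (continuous_sphere_moment CQ r0 cu).
    exact: is_derive_continuous (is_derive_exprVn l r0).
  apply: cvgM; last exact: cvg_cst.
  exact: is_derive_continuous (is_derive_exprVn k r0).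
have g0 : g r = 0.
  have H1 : g s @[s --> r^'+] --> g r by exact: cvg_at_right_filter.
  have H2 : g s @[s --> r^'+] --> (0 : R).
    suff E0 : \forall s \near r^'+, (fun _ : R => 0 : R) s = g s.
      by apply: cvg_trans (near_eq_cvg E0) _; exact: cvg_cst.
    near=> s.
    have rs : r < s by near: s; exact: nbhs_right_gt.
    have := exterior_ratio rs r1.
    by rewrite /g max_l ?(ltW rs)// -/(bt s) => ->; rewrite subrr.
  by rewrite -(cvg_lim _ H1)// (cvg_lim _ H2).
move: g0; rewrite /g /bt max_l// !expr1n invr1 !mul1r => /eqP; rewrite subr_eq0 => /eqP h.
have rl : r ^+ l != 0 by rewrite expf_neq0// gt_eqF.
have rkn : r ^+ k != 0 by rewrite expf_neq0// gt_eqF.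
apply: (mulfI (invr_neq0 rl)); apply: (mulfI (invr_neq0 rkn)).
by rewrite mulKf// -h; field; rewrite rl.
Unshelve. all: by end_near. Qed.

End exterior.

(** * The regularised Newtonian kernel *)

Section sphere_integrable.
Context {R : realType} (d : nat).
Local Notation n := d.+1.
Local Notation E := 'rV[R]_n.
Local Notation S := (@esphere R n 1).
Local Notation sg := (@surf R n 1).

Lemma continuous_sphere_integrable (f : E -> R) : continuous f ->
  sg.-integrable S (EFin \o f).
Proof.
move=> cf; have [N N0 fN] := sphere_bounded cf.
apply: (@bounded_integrable R _ _ sg S f N) => //.
- exact: measurable_esphere.
- by apply: surf_lty; exact: measurable_esphere.
- by apply: measurable_funTS; exact: continuous_measurable.
Qed.

Lemma continuous_aff (s : R) (y : E) : continuous (aff s y).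
Proof.
move=> z; apply: (@cvg_rV R _ (nbhs z) _) => i; rewrite /aff !mxE; under eq_fun do rewrite !mxE.
suff : {for z, continuous (fun x : E => s * x 0 i + y 0 i)} by [].
apply: contD; last exact: contC.
apply: contM; first exact: contC.
exact: coord_continuous.
Qed.

Lemma continuous_translate (f : E -> R) (s : R) (y : E) : continuous f ->
  continuous (fun z : E => f (s *: z + y)).
Proof.
move=> cf z; apply: (@continuous_comp _ _ _ (aff s y) f); last exact: cf.
exact: continuous_aff.
Qed.

Lemma near_translate (f : E -> R) (y : E) eps : {for y, continuous f} -> 0 < eps ->
  exists2 e, 0 < e & forall z, enorm z < e -> `|f (z + y) - f y| <= eps.
Proof.
move=> /cvgrPdist_le/[apply] /nbhs_ballP[e /= e0 he]; exists e => // z ze.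
rewrite distrC; apply: he; split=> // i j; rewrite ord1 /ball/= mxE.
have -> : y 0 j - (z 0 j + y 0 j) = - z 0 j by ring.
rewrite normrN.
exact: le_lt_trans (coord_le_enorm _ _) ze.
Qed.

Lemma C2data_translate (f : E -> R) (g h : 'I_n -> E -> R) (y x : E) : C2data f g h (x - y) ->
  C2data (fun z => f (z - y)) (fun i z => g i (z - y)) (fun i z => h i (z - y)) x.
Proof.
have tr (p : E -> R) : {for (x - y), continuous p} -> {for x, continuous (fun z : E => p (z - y))}.
  have shE z : aff 1 (- y) z = z - y by rewrite /aff scale1r.
  rewrite -(shE x) => cp; have -> : (fun z : E => p (z - y)) = p \o aff 1 (- y).
    by apply/funext => z; rewrite /= shE.
  by apply: continuous_comp => //; exact: continuous_aff.
have trd (p : E -> R) i b : is_derive (x - y) (bvec i) p b ->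
    is_derive x (bvec i) (fun z : E => p (z - y)) b.
  by move=> dp; apply: is_derive_transfer dp => t; rewrite addrA.
move=> [cf H]; split; first exact: tr.
move=> i; have [d1 d2 c1 c2] := H i; split; [exact: trd|exact: trd|exact: tr|exact: tr].
Qed.

End sphere_integrable.

Section kernel.
Context {R : realType} (d : nat).
Local Notation n := d.+1.
Local Notation E := 'rV[R]_n.
Local Notation S := (@esphere R n 1).
Local Notation sg := (@surf R n 1).
Local Notation omega := (@omega R d).
Hypothesis d2 : (2 <= d)%N.
Local Notation kd := (d.-1).

Let kd0 : (0 < kd)%N. Proof. by lia. Qed.
Let kdE : (kd + 2 = 2 * 0 + n)%N. Proof. by lia. Qed.

Section regularised.
Variable A : R.
(** A smoothing of min(t, A). *)
Definition soft_min (t : R) : R := t - soft_pos 1 (t - A).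
Definition d_soft_min (t : R) : R := 1 - d_soft_pos 1 (t - A).
Definition dd_soft_min (t : R) : R := - tent 1 (t - A).

Lemma is_derive_soft_min (t : R) : is_derive t 1 soft_min (d_soft_min t).
Proof.
have D : is_derive t 1 (fun t => soft_pos 1 (t - A)) (d_soft_pos 1 (t - A)).
  by apply: is_derive_transfer (is_derive_soft_pos (t - A) ltr01) => h; rewrite addrA.
by apply: is_derive_eq.
Qed.

Lemma is_derive_d_soft_min (t : R) : is_derive t 1 d_soft_min (dd_soft_min t).
Proof.
have D : is_derive t 1 (fun t => d_soft_pos 1 (t - A)) (tent 1 (t - A)).
  by apply: is_derive_transfer (is_derive_d_soft_pos (t - A) ltr01) => h; rewrite addrA.
have := is_deriveB (is_derive_cst (1 : R) t (1 : R)) D; rewrite sub0r; exact.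
Qed.

Lemma continuous_dd_soft_min : continuous dd_soft_min.
Proof.
move=> t; apply: cvgN.
apply: (@continuous_comp _ _ _ (fun t => t - A) (tent 1)); last exact: continuous_tent.
by apply: cvgB; [exact: cvg_id|exact: cvg_cst].
Qed.

Lemma soft_min_large t : A + 1 <= t -> [/\ soft_min t = A, d_soft_min t = 0 & dd_soft_min t = 0].
Proof.
move=> h; have h1 : 1 <= t - A by lra.
by rewrite /soft_min /d_soft_min /dd_soft_min soft_pos_pos// d_soft_pos_pos// tent_pos// subrr oppr0; split=> //; lra.
Qed.

Let one := (fun _ : E => 1 : R).
Let zero := (fun (_ : 'I_n) (_ : E) => 0 : R).

Let C2one x : C2data one zero zero x.
Proof.
split; first exact: contC.
by move=> i; split; [exact: is_derive_cst|exact: is_derive_cst|exact: contC|exact: contC].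
Qed.

(** The Newtonian kernel, capped at height A and smoothed.  It is twice
    differentiable everywhere, and its Laplacian is carried by a thin shell around
    the origin. *)
Definition Nreg : E -> R := radial_mult one kd soft_min A.
Definition d_Nreg := d_radial_mult one zero kd soft_min d_soft_min A.
Definition dd_Nreg := dd_radial_mult one zero zero kd soft_min d_soft_min dd_soft_min A.

Lemma C2_Nreg x : C2data Nreg d_Nreg dd_Nreg x.
Proof. exact: (C2_radial_mult C2one kd0 is_derive_soft_min is_derive_d_soft_min continuous_dd_soft_min soft_min_large). Qed.

Lemma laplacian_Nreg x : \sum_i dd_Nreg i x =
  - (1 * tent 1 (enorm x ^- kd - A) * (kd%:R ^+ 2 * enorm x ^- (2 * kd + 2))).
Proof.
have hz (z : E) : \sum_i zero i z = 0 by apply: big1.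
have ez (z : E) : \sum_i z 0 i * zero i z = 0%:R * one z.
  by rewrite mul0r; apply: big1 => i _; rewrite mulr0.
rewrite /dd_Nreg (laplacian_radial_mult hz ez kdE kd0).
by rewrite -[RHS]mulNr -[X in _ = X * _]mulrN.
Qed.

Lemma NregE x : x != 0 -> enorm x ^- kd <= A - 1 -> Nreg x = enorm x ^- kd.
Proof.
move=> /negbTE x0 h; rewrite /Nreg /radial_mult x0 /soft_min soft_pos_neg ?subr0 /one ?mul1r//; lra.
Qed.

(** This is [shell_average] for the constant polynomial: the Laplacian of [Nreg] is
    close to - (d-1) omega times the point mass at the origin.  The condition on A
    places the shell in the ball of radius e, where w (. + y) is almost constant. *)
Lemma mass_Nreg (w : E -> R) (y : E) (e eps : R) : 2 <= A -> continuous w ->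
  0 < e -> e ^- kd <= A - 1 ->
  (forall z, enorm z < e -> `|w (z + y) - w y| <= eps) ->
  `|\int[leb n]_x (w x * \sum_i dd_Nreg i (x - y)) + kd%:R * (omega * w y)| <=
  kd%:R * (eps * omega).
Proof.
move=> A2 cw e0 eA hw.
have cs : continuous (fun x : E => \sum_i dd_Nreg i x).
  move=> x; suff : {for x, continuous (fun x : E => \sum_i dd_Nreg i x)} by [].
  apply: (@cvg_sumr R _ (nbhs x) _).
  by move=> i; have [_ /(_ i)[_ _ _]] := C2_Nreg x.
have cwt : continuous (fun x : E => w (x + y)).
  have <- : (fun z : E => w (1 *: z + y)) = (fun z : E => w (z + y)).
    by apply/funext => z; rewrite scale1r.
  exact: (@continuous_translate R d w 1 y cw).
pose F (x : E) := w (x + y) * (1 * tent 1 (enorm x ^- kd - A) * (kd%:R ^+ 2 * enorm x ^- (2 * kd + 2))).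
have FE x : w (x + y) * \sum_i dd_Nreg i x = - F x by rewrite laplacian_Nreg mulrN.
have cF : continuous F.
  have -> : F = fun x => - (w (x + y) * \sum_i dd_Nreg i x) by apply/funext => x; rewrite FE opprK.
  by move=> x; apply: contN; apply: contM; [exact: cwt|exact: cs].
have iF : (leb n).-integrable setT (EFin \o F).
  apply: (@integrable_leb R n _ 1) => // x hx.
  have x1 : 1 < enorm x by rewrite ltNge; apply/negP => /enorm_le_box.
  rewrite /F tent_neg ?mulr0 ?mul0r ?mulr0//.
  have : enorm x ^- kd <= 1.
    by rewrite invf_le1 ?exprn_ege1 ?ltW// exprn_gt0// (lt_trans _ x1).
  lra.
have -> : \int[leb n]_x (w x * \sum_i dd_Nreg i (x - y)) = - \int[leb n]_x F x.
  (* Centre the kernel at the origin. *)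
  rewrite (integral_shift y); last first.
    apply: continuous_measurable.
    have csy : continuous (fun x : E => \sum_i dd_Nreg i (x - y)).
      have <- : (fun x : E => \sum_i dd_Nreg i (1 *: x + - y)) = (fun x : E => \sum_i dd_Nreg i (x - y)).
        by apply/funext => z; rewrite scale1r.
      exact: (@continuous_translate R d _ 1 (- y) cs).
    by move=> x; apply: contM; [exact: cw|exact: csy].
  rewrite -mulN1r -RintegralZl//; apply: eq_Rintegral => x _.
  by rewrite addrK FE mulN1r.
rewrite -normrN opprD opprK.
apply: (@shell_average R d kd 0 A 1 kdE kd0 ltr01 _ (fun x => w (x + y)) one F iF) => //.
- by lra.
- by move=> s x _; rewrite expr0 mul1r.
- move=> s s0 _; under eq_fun do rewrite mulr1.
  by apply: continuous_sphere_integrable; exact: continuous_translate.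
- move=> s s0 h; rewrite expr0 invr1 mul1r.
  have se : s < e.
    rewrite ltNge; apply/negP => es.
    have : s ^- kd <= e ^- kd.
      by rewrite lef_pV2 ?posrE ?exprn_gt0// ler_pXn2r ?nnegrE ?(ltW e0) ?(ltW s0).
    by move: h; rewrite ltr_norml => /andP[+ _]; lra.
  have mS := @measurable_esphere R n 1.
  have i1 : sg.-integrable S (EFin \o (fun z => w (s *: z + y))).
    by apply: continuous_sphere_integrable; exact: continuous_translate.
  have i2 (c : R) : sg.-integrable S (EFin \o (fun z : E => c)) by apply: finite_measure_integrable_cst.
  under eq_Rintegral do rewrite mulr1.
  rewrite [omega * _]mulrC -(Rintegral_cst sg mS (w y)) -RintegralB//.
  have i3 : sg.-integrable S (EFin \o (fun z => w (s *: z + y) - w y)) by have := integrableB mS i1 (i2 (w y)).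
  apply: le_trans (le_normr_Rintegral mS i3) _.
  rewrite -(Rintegral_cst sg mS eps); apply: le_Rintegral => //.
    exact: integrable_norm i3.
  move=> z z1; apply: hw; rewrite enormZ z1 mulr1 gtr0_norm//.
Qed.

End regularised.
End kernel.

(** * Moments of the Newtonian kernel *)

Section kernel_mean.
Context {R : realType} (d : nat).
Local Notation n := d.+1.
Local Notation E := 'rV[R]_n.
Local Notation S := (@esphere R n 1).
Local Notation sg := (@surf R n 1).
Local Notation omega := (@omega R d).
Hypothesis d2 : (2 <= d)%N.
Local Notation kd := (d.-1).

Variables (Q : E -> R) (gQ hQ : 'I_n -> E -> R) (l k : nat).
Hypothesis CQ : forall x, C2data Q gQ hQ x.
Hypothesis harmQ : forall x, \sum_i hQ i x = 0.
Hypothesis eulerQ : forall x : E, \sum_i x 0 i * gQ i x = l%:R * Q x.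
Hypothesis homQ : forall (s : R) x, 0 < s -> Q (s *: x) = s ^+ l * Q x.
Hypothesis kE : (k + 2 = 2 * l + n)%N.

Let k0 : (0 < k)%N. Proof. by lia. Qed.
Let kd0 : (0 < kd)%N. Proof. by lia. Qed.
Let cQ : continuous Q. Proof. by move=> x; exact: (CQ x).1. Qed.

Variable y : E.
Hypothesis y1 : enorm y < 1.

(* Any radius between |y| and 1: the pole is inside and the unit sphere outside. *)
Let r : R := (enorm y + 1) / 2.
Let yr : enorm y < r. Proof. by have [] := midf_lt y1. Qed.
Let r1 : r < 1. Proof. by have [] := midf_lt y1. Qed.
Let r0 : 0 < r. Proof. by apply: le_lt_trans (enorm_ge0 y) yr. Qed.
Let u (x : E) : R := enorm (x - y) ^- kd.

Let dist_y x : r <= enorm x -> r - enorm y <= enorm (x - y).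
Proof. by move=> h; apply: le_trans (enormB_ge x y); rewrite lerB. Qed.

Let cu x : r <= enorm x -> {for x, continuous u}.
Proof.
move=> rx; have xy : x - y != 0.
  by rewrite -enorm_gt0; apply: lt_le_trans (dist_y rx); rewrite subr_gt0.
have -> : u = (fun z : E => enorm z ^- kd) \o aff 1 (- y).
  by apply/funext => z; rewrite /= /aff scale1r.
apply: continuous_comp; first exact: continuous_aff.
have -> : aff 1 (- y) x = x - y by rewrite /aff scale1r.
exact: continuous_enormVn.
Qed.

Let wcu : {within [set x | r <= enorm x], continuous u}.
Proof. by apply: continuous_in_subspaceT => x; rewrite inE => /cu. Qed.

Let vu : vanishes_at_infinity u.
Proof.
move=> e e0; pose M := Num.max 1 e^-1; exists (M + 1) => x Mx.
have h : M < enorm (x - y).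
  by apply: (lt_le_trans _ (enormB_ge x y)); rewrite ltrBrDr (le_lt_trans _ Mx)// lerD2l ltW.
have M1 : 1 <= M by rewrite le_max lexx.
have h1 : 1 <= enorm (x - y) by rewrite (le_trans M1)// ltW.
have hp : 0 < enorm (x - y) by apply: lt_le_trans h1.
rewrite /u ger0_norm ?invr_ge0 ?exprn_ge0 ?(ltW hp)//.
apply: (@le_lt_trans _ _ (enorm (x - y))^-1).
  by rewrite lef_pV2 ?posrE ?exprn_gt0// -[leLHS]expr1 ler_weXn2l.
rewrite -[ltRHS]invrK ltf_pV2 ?posrE ?invr_gt0//.
by apply: le_lt_trans h; rewrite le_max lexx orbT.
Qed.

(** The test function vanishes outside a large ball and equals - (sum c j s j^-k) Q on
    the ball of radius r, which contains y; there its Laplacian is 0.  So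
    N(. - y) may be replaced by [Nreg] with a high cap, and Green's identity
    evaluates the test function at y. *)
Lemma kernel_combination m (c s : 'I_m -> R) : \sum_j c j = 0 -> (forall j, r < s j) ->
  k%:R * \sum_j c j * (s j ^- l * sphere_moment Q u (s j)) =
  kd%:R * (omega * (Q y * \sum_j c j * s j ^- k)).
Proof.
move=> c0 rs; apply: (shell_limit CQ harmQ eulerQ homQ kE k0 r0 wcu (fun x rx => cu (ltW rx)) rs).
move=> dl dl0 h1 h2 h3; pose a j := s j ^- k.
have am0 : 0 < r ^- k - dl by rewrite subr_gt0.
have am1 : r ^- k - dl < r ^- k by rewrite gtrBl.
pose w := @shell_test R d m c a dl Q k.
pose hw := @dd_shell_test R d m c a dl Q gQ hQ k.
have inner (x : E) : enorm x <= r -> w x = Q x * - (\sum_j c j * a j) /\ \sum_i hw i x = 0.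
  move=> xr; rewrite /hw (laplacian_shell_test _ _ _ harmQ eulerQ kE k0) /w /shell_test /radial_mult.
  have := nbhs_singleton (near_inner k0 r0 am1 am0 xr).
  have [-> _|x0 [/eqP|h]] := eqVneq x 0.
  - split=> //; have -> : enorm (0 : E) ^- (2 * k + 2) = 0 by rewrite enorm0 addn2 expr0n/= invr0.
    by rewrite !mulr0.
  - by rewrite (negbTE x0).
  - have [-> _ ->] := @soft_sum_large R m c a dl dl0 c0 (enorm x ^- k) (fun j => le_trans (h2 j) h).
    by rewrite mulr0 mul0r.
have Cw := C2_shell_test dl0 c0 CQ k0 h2.
have cw : continuous w by move=> x; exact: (Cw x).1.
apply/eqP; rewrite -subr_eq0 -normr_le0; apply/ler_addgt0Pl => e e0; rewrite addr0.
have om0 : 0 <= omega by exact: fine_ge0.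
pose C := kd%:R * omega; have C0 : 0 <= C by rewrite mulr_ge0.
have C1 : 0 < C + 1 by rewrite ltr_wpDl.
have eps0 : 0 < e / (C + 1) by rewrite divr_gt0.
have [e' e'0 he'] := near_translate (cw y) eps0.
(* The cap must clear the shell of [mass_Nreg] and the values of N(. - y) outside the
   ball of radius r. *)
pose A := Num.max 2 (Num.max (e' ^- kd + 1) ((r - enorm y) ^- kd + 1)).
have A2 : 2 <= A by rewrite le_max lexx.
have Ae : e' ^- kd <= A - 1 by rewrite lerBrDr !le_max lexx orbT.
have Ar : (r - enorm y) ^- kd <= A - 1 by rewrite lerBrDr !le_max lexx !orbT.
have ry0 : 0 < r - enorm y by rewrite subr_gt0.
have NE (x : E) : u x * \sum_i hw i x = Nreg A (x - y) * \sum_i hw i x.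
  have [xr|rx] := leP (enorm x) r; first by rewrite (inner _ xr).2 !mulr0.
  have h := dist_y (ltW rx); have hp := lt_le_trans ry0 h.
  rewrite NregE// -?enorm_gt0//.
  apply: le_trans Ar; rewrite lef_pV2 ?posrE ?exprn_gt0//.
  by rewrite ler_pXn2r ?nnegrE ?(ltW ry0) ?(ltW hp).
under eq_Rintegral do rewrite NE.
rewrite (@green R n (fun x => Nreg A (x - y)) w (fun i x => d_Nreg A i (x - y)) (fun i x => dd_Nreg A i (x - y))
  (d_shell_test c a dl Q gQ k) hw (shell_test_radius dl)).
- have := mass_Nreg d2 A2 cw e'0 Ae he'; rewrite (inner y (ltW yr)).1.
  have -> : kd%:R * (omega * (Q y * - \sum_j c j * a j)) =
      - (kd%:R * (omega * (Q y * \sum_j c j * s j ^- k))) by rewrite !mulrN.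
  move=> /le_trans; apply.
  have -> : kd%:R * (e / (C + 1) * omega) = C * e / (C + 1) by rewrite /C; ring.
  by rewrite ler_pdivrMr// mulrC ler_pM2l// lerDl.
- exact: Cw.
- move=> x; exact: (shell_test_support c dl0 Q gQ hQ k0 dl0 h1).
- by move=> x; left; apply: C2data_translate; exact: C2_Nreg.
Qed.

(** This is [kernel_combination] for the spheres of radii 1 and t, when t tends to
    infinity. *)
Lemma kernel_moment : k%:R * sphere_moment Q u 1 = kd%:R * (omega * Q y).
Proof.
apply/eqP; rewrite -subr_eq0 -normr_le0; apply/ler_addgt0Pl => e e0; rewrite addr0.
pose V := kd%:R * (omega * Q y).
pose C := k%:R + `|V|.
have C0 : 0 <= C by rewrite addr_ge0.
have C1 : 0 < C + 1 by rewrite ltr_wpDl.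
pose eps := e / (C + 1); have eps0 : 0 < eps by rewrite divr_gt0.
have [M hM] := sphere_moment_decay cQ r0 wcu vu eps0.
pose t := Num.max (M + 1) (Num.max 1 eps^-1).
have Mt : M < t by rewrite !lt_max ltrDl ltr01.
have t1 : 1 <= t by rewrite !le_max lexx !orbT.
have te : eps^-1 <= t by rewrite !le_max lexx !orbT.
have t0 : 0 < t by apply: lt_le_trans t1.
have rt : r < t by apply: lt_le_trans t1.
have at' : t ^- k <= eps.
  apply: (@le_trans _ _ t^-1); first by rewrite lef_pV2 ?posrE ?exprn_gt0// -[leLHS]expr1 ler_weXn2l.
  by rewrite -[leRHS]invrK lef_pV2 ?posrE ?invr_gt0.
have bt : `|t ^- l * sphere_moment Q u t| <= eps.
  rewrite normrM ger0_norm ?invr_ge0 ?exprn_ge0 ?(ltW t0)//.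
  apply: le_trans (hM t (ltW rt) Mt).
  by rewrite ler_piMl// invf_le1 ?exprn_gt0// exprn_ege1.
pose s (j : 'I_2) := nth 0 [:: 1; t] j.
pose c (j : 'I_2) : R := nth 0 [:: 1; -1] j.
have := @kernel_combination 2 c s.
rewrite !big_ord_recl !big_ord0 /c /s /= !expr1n invr1 => H.
have {H} H : k%:R * (1 * (1 * sphere_moment Q u 1) + (-1 * (t ^- l * sphere_moment Q u t) + 0)) =
  kd%:R * (omega * (Q y * (1 * 1 + (-1 * t ^- k + 0)))).
  apply: H; first by ring.
  by case; case=> [|[|]].
have -> : k%:R * sphere_moment Q u 1 - kd%:R * (omega * Q y) = k%:R * (t ^- l * sphere_moment Q u t) - V * t ^- k.
  by apply/eqP; rewrite -subr_eq0; move: H; rewrite /V => /eqP; rewrite -subr_eq0 => /eqP H; apply/eqP; rewrite -[RHS]H; ring.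
apply: le_trans (ler_normB _ _) _; rewrite normrM [X in _ + X]normrM.
have -> : e = C * eps + eps by rewrite /eps; field; rewrite gt_eqF.
rewrite -[leLHS]addr0 lerD ?(ltW eps0)// /C mulrDl lerD//.
  by rewrite ger0_norm ?ler_wpM2l.
by rewrite [X in _ * X]ger0_norm ?invr_ge0 ?exprn_ge0 ?(ltW t0)// ler_wpM2l.
Qed.

End kernel_mean.

(** * Polynomial functions *)

Section polynomial_functions.
Context {R : realType} (n : nat).
Local Notation E := 'rV[R]_n.
Implicit Types p q : mpoly.mpoly n R.

Definition peval p (x : E) : R := mpoly.meval (fun i => x 0 i) p.

(** Differentiation and continuity obey rules for sums and products, and this
    principle extends them to all polynomials. *)
Lemma mpoly_ring_ind (P : mpoly.mpoly n R -> Prop) :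
  (forall c, P (mpoly.mpolyC n c)) -> (forall i, P (mpoly.mpolyX R (mpoly.mnm1 i))) ->
  (forall p q, P p -> P q -> P (p + q)) -> (forall p q, P p -> P q -> P (p * q)) ->
  forall p, P p.
Proof.
move=> PC PX PD PM p; rewrite [p]mpoly.mpolyE.
have P0 : P 0 by rewrite -(mpoly.mpolyC0 n); exact: PC.
have P1 : P 1 by rewrite -(mpoly.mpolyC1 n R); exact: PC.
apply: big_ind; [exact: P0|exact: PD|move=> m _]; rewrite -mpoly.mul_mpolyC; apply: (PM) => //.
rewrite mpoly.mpolyXE_id; apply: big_ind; [exact: P1|exact: PM|move=> i _].
by elim: (m i) => [|j IH]; [rewrite expr0|rewrite exprS; exact: PM].
Qed.

Lemma continuous_peval p (x : E) : {for x, continuous (peval p)}.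
Proof.
move: p; apply: mpoly_ring_ind => [c|i|p q cp cq|p q cp cq].
- have -> : peval (mpoly.mpolyC n c) = (fun=> c) by apply/funext => z; exact: mpoly.mevalC.
  exact: contC.
- have -> : peval (mpoly.mpolyX R (mpoly.mnm1 i)) = (fun z => z 0 i).
    by apply/funext => z; exact: mpoly.mevalXU.
  exact: coord_continuous.
- have -> : peval (p + q) = (fun z => peval p z + peval q z) by apply/funext => z; exact: mpoly.mevalD.
  exact: contD.
- have -> : peval (p * q) = (fun z => peval p z * peval q z) by apply/funext => z; exact: mpoly.mevalM.
  exact: contM.
Qed.

Lemma is_derive_peval p (x : E) (i : 'I_n) :
  is_derive x (bvec i) (peval p) (peval (mpoly.mderiv i p) x).
Proof.
move: p; apply: mpoly_ring_ind => [c|j|p q cp cq|p q cp cq].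
- have -> : peval (mpoly.mpolyC n c) = (fun=> c) by apply/funext => z; exact: mpoly.mevalC.
  by rewrite mpoly.mderivC /peval mpoly.meval0; exact: is_derive_cst.
- have -> : peval (mpoly.mpolyX R (mpoly.mnm1 j)) = (fun z => z 0 j).
    by apply/funext => z; exact: mpoly.mevalXU.
  have -> : peval (mpoly.mderiv i (mpoly.mpolyX R (mpoly.mnm1 j))) x = (i == j)%:R.
    rewrite /peval mpoly.mderivX mpoly.mevalZ mpoly.mnm1E eq_sym.
    have [->|_] := eqVneq i j; last by rewrite mul0r.
    by rewrite -[X in mpoly.mnm_sub X _]mpoly.add0m mpoly.addmK mpoly.mpolyX0 mpoly.meval1 mulr1.
  exact: is_derive_coord.
- have -> : peval (p + q) = (fun z => peval p z + peval q z) by apply/funext => z; exact: mpoly.mevalD.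
  by rewrite mpoly.mderivD /peval mpoly.mevalD; exact: is_deriveD.
- have -> : peval (p * q) = (fun z => peval p z * peval q z) by apply/funext => z; exact: mpoly.mevalM.
  have := is_deriveM1 cp cq; move=> /is_derive_eq; apply.
  by rewrite mpoly.mderivM /peval mpoly.mevalD !mpoly.mevalM; ring.
Qed.

Lemma C2_peval p (x : E) :
  C2data (peval p) (fun i => peval (mpoly.mderiv i p))
    (fun i => peval (mpoly.mderiv i (mpoly.mderiv i p))) x.
Proof.
split; first exact: continuous_peval.
by move=> i; split; [exact: is_derive_peval|exact: is_derive_peval|exact: continuous_peval|exact: continuous_peval].
Qed.

Variables (l : nat) (p : mpoly.mpoly n R).
Hypothesis hp : p \is mpoly.ishomog1 l mpoly.mdeg.

Let homE m : m \in mpoly.msupp p -> mpoly.mdeg m = l.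
Proof. exact: (mpoly.dhomogP _ _ _ hp). Qed.

Lemma peval_homog (s : R) (x : E) : peval p (s *: x) = s ^+ l * peval p x.
Proof.
rewrite /peval !mpoly.mevalE mulr_sumr !big_seq; apply: eq_bigr => m mp.
rewrite -(homE mp) mulrCA; congr (_ * _); rewrite mpoly.mdegE -prodrXr -big_split/=.
by apply: eq_bigr => i _; rewrite mxE exprMn.
Qed.

(** Both sides are linear in p, so it is enough to check monomials. *)
Lemma peval_euler (x : E) : \sum_i x 0 i * peval (mpoly.mderiv i p) x = l%:R * peval p x.
Proof.
have mono (m : mpoly.multinom n) : \sum_i x 0 i * peval (mpoly.mderiv i (mpoly.mpolyX R m)) x =
    (mpoly.mdeg m)%:R * peval (mpoly.mpolyX R m) x.
  rewrite mpoly.mdegE natr_sum mulr_suml; apply: eq_bigr => i _.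
  rewrite /peval mpoly.mderivX mpoly.mevalZ mulrCA.
  have [->|mi] := eqVneq (m i) 0%N; first by rewrite !mul0r.
  congr (_ * _); rewrite -(mpoly.mevalXU (fun i => x 0 i) i) -mpoly.mevalM -mpoly.mpolyXD.
  by rewrite mpoly.addmC mpoly.submK// mpoly.lep1mP.
rewrite [in LHS](mpoly.mpolyE p) [in RHS](mpoly.mpolyE p).
rewrite /peval (big_morph _ (mpoly.mevalD _) (mpoly.meval0 _)) mulr_sumr.
transitivity (\sum_i \sum_(m <- mpoly.msupp p)
    mpoly.mcoeff m p * (x 0 i * peval (mpoly.mderiv i (mpoly.mpolyX R m)) x)).
  apply: eq_bigr => i _; rewrite (big_morph _ (mpoly.mderivD i) (mpoly.mderiv0 R i)).
  rewrite (big_morph _ (mpoly.mevalD _) (mpoly.meval0 _)) mulr_sumr; apply: eq_bigr => m _.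
  by rewrite mpoly.mderivZ mpoly.mevalZ mulrCA.
rewrite exchange_big/= !big_seq; apply: eq_bigr => m mp.
by rewrite -mulr_sumr mono /peval mpoly.mevalZ mulrCA homE.
Qed.

Hypothesis harmp : \sum_i mpoly.mderiv i (mpoly.mderiv i p) = 0.

Lemma peval_harmonic (x : E) : \sum_i peval (mpoly.mderiv i (mpoly.mderiv i p)) x = 0.
Proof. by rewrite /peval -(big_morph _ (mpoly.mevalD _) (mpoly.meval0 _)) harmp mpoly.meval0. Qed.

End polynomial_functions.

(** * Fubini's theorem for a bounded kernel *)

Section fubini_kernel.
Context d1 d2 (T1 : measurableType d1) (T2 : measurableType d2) (R : realType).
Variables (m1 : {finite_measure set T1 -> \bar R}) (m2 : {finite_measure set T2 -> \bar R}).
Variables (D1 : set T1) (D2 : set T2) (K : T1 * T2 -> R) (h : T2 -> R) (C : R).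
Hypothesis mD1 : measurable D1.
Hypothesis mD2 : measurable D2.
Hypothesis mK : measurable_fun setT K.
Hypothesis KC : forall x y, D1 x -> D2 y -> `|K (x, y)| <= C.
Hypothesis ih : m2.-integrable D2 (EFin \o h).

Let mh : measurable_fun D2 h.
Proof. by apply/measurable_EFinP; exact: measurable_int ih. Qed.

Lemma kernel_integrable1 y : D2 y -> m1.-integrable D1 (fun x => (K (x, y))%:E).
Proof.
move=> Dy; apply: (@bounded_integrable R _ _ m1 D1 (fun x => K (x, y)) C) => //.
- apply: le_lt_trans (fin_num_fun_lty (fin_num_measure m1)); apply: le_measure => //; rewrite ?inE//.
- by apply: measurable_funTS; apply: measurableT_comp mK _; exact: pair2_measurable.
- by move=> x Dx; exact: KC.
Qed.

Lemma kernel_integrable2 x : D1 x -> m2.-integrable D2 (fun y => (K (x, y) * h y)%:E).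
Proof.
move=> Dx; have mKx : measurable_fun setT (fun y => K (x, y)).
  by apply: measurableT_comp mK _; exact: pair1_measurable.
apply: (@le_integrable _ _ _ m2 D2 mD2 _ (EFin \o (fun y => C * h y))).
- by apply/measurable_EFinP; apply: measurable_funM => //; exact: measurable_funTS.
- move=> y Dy /=; rewrite lee_fin normrM normrM ler_wpM2r//.
  by apply: le_trans (KC Dx Dy) (ler_norm _).
- by have := integrableZl mD2 C ih.
Qed.

Let F (z : T1 * T2) := (K z * h z.2)%:E.

Let iF : (m1 \x m2)%E.-integrable (D1 `*` D2) F.
Proof.
have ih0 : m2.-integrable setT (fun y => ((h \_ D2) y)%:E).
  have -> : (fun y => ((h \_ D2) y)%:E) = (EFin \o h) \_ D2.
    by apply/funext => y; rewrite !patchE; case: ifP.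
  exact: (integrable_mkcond _ mD2).1 ih.
have mh0 : measurable_fun setT (h \_ D2).
  by apply/measurable_EFinP; exact: measurable_int ih0.
have iG : (m1 \x m2)%E.-integrable setT (fun z : T1 * T2 => (C * (h \_ D2) z.2)%:E).
  apply/integrable12ltyP.
    apply/measurable_EFinP; apply: measurable_funM; first exact: measurable_cst.
    exact: measurableT_comp mh0 measurable_snd.
  have : m2.-integrable setT (fun y => (C * (h \_ D2) y)%:E).
    by have := integrableZl measurableT C ih0.
  move=> /integrableP[_ /=]; set I := (\int[m2]_y _)%E => Ioo.
  rewrite integral_cst// lte_mul_pinfty//.
  - exact: integral_ge0.
  - by rewrite ge0_fin_numE// integral_ge0.
  - by rewrite (fin_num_fun_lty (fin_num_measure m1)).
apply: (@le_integrable _ _ _ (m1 \x m2)%E (D1 `*` D2) _ _ (fun z : T1 * T2 => (C * (h \_ D2) z.2)%:E)).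
- exact: measurableX.
- apply/measurable_EFinP; apply: measurable_funM; first exact: measurable_funTS.
  apply: (measurable_comp mD2 _ mh); last exact: measurable_funTS.
  by move=> _ [z [_ ? <-]].
- move=> [x y] [/= Dx Dy]; rewrite lee_fin patchE mem_set// !normrM ler_wpM2r//.
  by apply: le_trans (KC Dx Dy) (ler_norm _).
- by apply: integrableS iG => //; exact: measurableX.
Qed.

(** Integrability on the product holds because |K h| <= C |h| and the first measure is
    finite. *)
Lemma fubini_kernel :
  \int[m1]_(x in D1) \int[m2]_(y in D2) (K (x, y) * h y) =
  \int[m2]_(y in D2) (h y * \int[m1]_(x in D1) K (x, y)).
Proof.
have mX : measurable (D1 `*` D2) by exact: measurableX.
have := Fubini ((integrable_mkcond _ mX).1 iF).
have -> : (\int[m1]_x \int[m2]_y (F \_ (D1 `*` D2)) (x, y) =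
    \int[m1]_(x in D1) (\int[m2]_(y in D2) (K (x, y) * h y))%:E)%E.
  rewrite [RHS]integral_mkcond; apply: eq_integral => x _; rewrite [RHS]patchE.
  case: ifPn => [/set_mem Dx|/negP xD].
    rewrite /Rintegral fineK; last exact: (integrable_fin_num mD2 (kernel_integrable2 Dx)).
    rewrite [RHS]integral_mkcond; apply: eq_integral => y _; rewrite !patchE.
    by rewrite in_setX mem_set//.
  by apply: integral0_eq => y _; rewrite patchE in_setX; case: ifP => // /andP[/xD].
have -> : (\int[m2]_y \int[m1]_x (F \_ (D1 `*` D2)) (x, y) =
    \int[m2]_(y in D2) (h y * \int[m1]_(x in D1) K (x, y))%:E)%E.
  rewrite [RHS]integral_mkcond; apply: eq_integral => y _; rewrite [RHS]patchE.
  case: ifPn => [/set_mem Dy|/negP yD].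
    have i1 := kernel_integrable1 Dy.
    rewrite EFinM /Rintegral fineK; last exact: (integrable_fin_num mD1 i1).
    rewrite -integralZl//.
    rewrite [RHS]integral_mkcond; apply: eq_integral => x _; rewrite !patchE.
    by rewrite in_setX [y \in _]mem_set// andbT; case: ifP => // _; rewrite -EFinM mulrC.
  by apply: integral0_eq => x _; rewrite patchE in_setX; case: ifP => // /andP[_ /yD].
by rewrite /Rintegral => ->.
Qed.

End fubini_kernel.

(** * Fourier coefficients on the sphere *)

Lemma integrableM_bounded d (T : measurableType d) (R : realType)
    (mu : {measure set T -> \bar R}) (D : set T) (f q : T -> R) (M : R) :
  measurable D -> mu.-integrable D (EFin \o f) -> measurable_fun D q ->
  (forall x, D x -> `|q x| <= M) -> mu.-integrable D (fun x => (f x * q x)%:E).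
Proof.
move=> mD fi mq qM; apply: (@le_integrable _ _ _ mu D mD _ (EFin \o (fun x => M * f x))).
- apply/measurable_EFinP; apply: measurable_funM => //.
  by apply/measurable_EFinP; exact: measurable_int fi.
- move=> x Dx /=; rewrite lee_fin !normrM mulrC ler_wpM2r//.
  by apply: le_trans (qM _ Dx) (ler_norm _).
- by have := integrableZl mD M fi.
Qed.

Section fourier.
Context {R : realType} (d : nat).
Local Notation n := d.+1.
Local Notation E := 'rV[R]_n.
Local Notation S := (@esphere R n 1).
Local Notation sg := (@surf R n 1).

(** Functions on the sphere are given by functions on the whole space whose values
    elsewhere are arbitrary; these are the ones that extend continuously. *)
Definition sphere_cont (g : E -> R) := exists2 q : E -> R, continuous q & forall x, S x -> g x = q x.

Let mS : measurable S. Proof. exact: measurable_esphere. Qed.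
Let Sfin : (sg S < +oo)%E. Proof. by apply: surf_lty. Qed.

Lemma sphere_cont_measurable g : sphere_cont g -> measurable_fun S g.
Proof.
move=> [q cq gq]; apply: (@eq_measurable_fun _ _ _ _ S q) => [x|].
  by rewrite inE => /gq.
by apply: measurable_funTS; exact: continuous_measurable.
Qed.

Lemma sphere_cont_bounded g : sphere_cont g -> exists2 M, 0 < M & forall x, S x -> `|g x| <= M.
Proof.
move=> [q cq gq]; have [M M0 qM] := sphere_bounded cq.
by exists M => // x x1; rewrite gq// qM.
Qed.

Lemma sphere_cont_integrable g : sphere_cont g -> sg.-integrable S (EFin \o g).
Proof.
move=> gc; have [M _ gM] := sphere_cont_bounded gc.
apply: (@bounded_integrable R _ _ sg S g M) => //; exact: sphere_cont_measurable.
Qed.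

Lemma sphere_contM g h : sphere_cont g -> sphere_cont h -> sphere_cont (fun x => g x * h x).
Proof.
move=> [p cp gp] [q cq hq]; exists (fun x => p x * q x).
  by move=> x; apply: contM; [exact: cp|exact: cq].
by move=> x x1; rewrite gp// hq.
Qed.

Lemma sphere_contZ (c : R) g : sphere_cont g -> sphere_cont (fun x => c * g x).
Proof.
move=> [p cp gp]; exists (fun x => c * p x).
  by move=> x; apply: contM; [exact: contC|exact: cp].
by move=> x x1; rewrite gp.
Qed.

Lemma sphere_cont_sum (I : finType) (g : I -> E -> R) :
  (forall i, sphere_cont (g i)) -> sphere_cont (fun x => \sum_i g i x).
Proof.
move=> H; have /choice[q hq] i : exists q : E -> R, continuous q /\ forall x, S x -> g i x = q x.
  by have [q cq gq] := H i; exists q.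
exists (fun x => \sum_i q i x).
  move=> x; suff : {for x, continuous (fun x => \sum_i q i x)} by [].
  by apply: (@cvg_sumr R _ (nbhs x) _) => i; exact: (hq i).1.
by move=> x x1; apply: eq_bigr => i _; exact: (hq i).2.
Qed.

Lemma spherical_harmonic_cont l g : spherical_harmonic (d := d) l g -> sphere_cont g.
Proof.
move=> [p [_ _ gp]]; exists (peval p) => //.
by move=> x; exact: continuous_peval.
Qed.

Variable Y : forall l : nat, 'I_(Zdim d l) -> E -> R.
Hypothesis shY : forall l (k : 'I_(Zdim d l)), spherical_harmonic l (Y k).
Hypothesis orthoY : forall l (k : 'I_(Zdim d l)) l' (k' : 'I_(Zdim d l')),
  \int[sg]_(x in S) (Y k x * Y k' x) = ((l == l') && (k == k' :> nat))%:R.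

Let cY l (k : 'I_(Zdim d l)) : sphere_cont (Y k).
Proof. exact: spherical_harmonic_cont (shY k). Qed.

Lemma partial_sum_cont c N : sphere_cont (partial_sum Y c N).
Proof.
by apply: sphere_cont_sum => i; apply: sphere_cont_sum => k; apply: sphere_contZ.
Qed.

Lemma coef_partial_sum c N l (k : 'I_(Zdim d l)) : (l < N)%N ->
  coef Y (partial_sum Y c N) k = c l k.
Proof.
move=> lN; rewrite /coef /partial_sum.
under eq_Rintegral do rewrite mulr_suml.
rewrite (Rintegral_sum mS); last first.
  move=> i; apply: sphere_cont_integrable; apply: sphere_contM => //.
  by apply: sphere_cont_sum => k'; exact: sphere_contZ.
transitivity (\sum_(i < N) \sum_(k' < Zdim d i) c i k' * (((i : nat) == l) && (k' == k :> nat))%:R).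
  apply: eq_bigr => i _; under eq_Rintegral do rewrite mulr_suml.
  rewrite (Rintegral_sum mS); last first.
    by move=> k'; apply: sphere_cont_integrable; apply: sphere_contM => //; exact: sphere_contZ.
  apply: eq_bigr => k' _; rewrite -orthoY.
  rewrite -RintegralZl//; first by apply: eq_Rintegral => x _; rewrite mulrA.
  by apply: sphere_cont_integrable; exact: sphere_contM.
rewrite (bigD1 (Ordinal lN))//= [X in _ + X]big1 ?addr0; last first.
  move=> i; rewrite -val_eqE/= => il; apply: big1 => k' _.
  by rewrite (negbTE il) mulr0.
rewrite (bigD1 k)//= !eqxx mulr1 big1 ?addr0// => k'; rewrite -val_eqE/= => /negbTE ->.
by rewrite mulr0.
Qed.

Variables (c : forall l, 'I_(Zdim d l) -> R) (g : E -> R).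
Hypothesis cg : L2_sum Y c g.

Let h N x := g x - partial_sum Y c N x.

Let mh N : measurable_fun S (h N).
Proof.
apply: measurable_funB; first exact: cg.1.
by apply: sphere_cont_measurable; exact: partial_sum_cont.
Qed.

Let h2 (eps : R) : 0 < eps -> \forall N \near \oo,
  sg.-integrable S (EFin \o (fun x => h N x ^+ 2)) /\ \int[sg]_(x in S) (h N x ^+ 2) <= eps.
Proof.
move=> eps0; have /fine_cvgP[f1 f2] := cg.2.
move/cvgrPdist_le : f2 => /(_ _ eps0) f2.
near=> N; have fN : (\int[sg]_(x in S) ((g x - partial_sum Y c N x) ^+ 2)%:E)%E \is a fin_num.
  by near: N.
split.
  apply/integrableP; split.
    by apply/measurable_EFinP; apply: measurable_funX; exact: mh.
  under eq_integral do rewrite /= ger0_norm ?sqr_ge0//.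
  by rewrite ltey_eq fN.
have : `|0 - fine (\int[sg]_(x in S) ((g x - partial_sum Y c N x) ^+ 2)%:E)%E| <= eps by near: N.
by rewrite sub0r normrN; exact: le_trans (ler_norm _).
Unshelve. all: by end_near. Qed.

(* Either |t| <= eps, or eps |t| <= t^2. *)
Let norm_sqr (t eps : R) : 0 < eps -> `|t| <= eps + t ^+ 2 / eps.
Proof.
move=> e0; rewrite -real_normK ?num_real//; have := normr_ge0 t; set u := `|t| => u0.
have [h1|h1] := leP u eps.
  by rewrite (le_trans h1)// lerDl divr_ge0 ?sqr_ge0// ltW.
by rewrite -[leLHS]add0r lerD ?(ltW e0)// ler_pdivlMr// expr2 ler_wpM2l// ltW.
Qed.

Let ih N : sg.-integrable S (EFin \o (fun x => h N x ^+ 2)) -> sg.-integrable S (EFin \o h N).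
Proof.
move=> i2; apply: (@le_integrable _ _ _ sg S mS _ (EFin \o (fun x => 1 + h N x ^+ 2))).
- exact/measurable_EFinP.
- move=> x Sx /=; rewrite lee_fin [leRHS]ger0_norm ?addr_ge0 ?sqr_ge0//.
  by have := norm_sqr (h N x) ltr01; rewrite divr1.
- have i1 : sg.-integrable S (EFin \o (fun _ : E => 1 : R)) by apply: finite_measure_integrable_cst.
  by have := integrableD mS i1 i2.
Qed.

Lemma L2_sum_integrable : sg.-integrable S (EFin \o g).
Proof.
have [N [/ih iN _]] := filter_ex (h2 ltr01).
have iP := sphere_cont_integrable (partial_sum_cont c N).
have := integrableD mS iN iP; apply: eq_integrable => // x _.
by rewrite /= /h -EFinD subrK.
Qed.

(** The partial sums have the coefficient c as soon as they reach the degree l.  The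
    remainder is small in L2, hence in L1 by |t| <= eps + t^2 / eps, while Y is
    bounded. *)
Lemma L2_sum_coef l (k : 'I_(Zdim d l)) : coef Y g k = c k.
Proof.
have [M M0 YM] := sphere_cont_bounded (cY k).
have mY := sphere_cont_measurable (cY k).
pose om := fine (sg S); have om0 : 0 <= om by exact: fine_ge0.
pose C := M * (om + 1); have C0 : 0 < C by rewrite mulr_gt0// ltr_wpDl.
apply/eqP; rewrite -subr_eq0 -normr_le0; apply/ler_addgt0Pl => e e0; rewrite addr0.
pose eps := e / C; have eps0 : 0 < eps by rewrite divr_gt0.
have [N [[i2 I2] lN]] : exists N, (sg.-integrable S (EFin \o (fun x => h N x ^+ 2)) /\
    \int[sg]_(x in S) (h N x ^+ 2) <= eps ^+ 2) /\ (l < N)%N.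
  have e20 : 0 < eps ^+ 2 by rewrite exprn_gt0.
  have nearN : \forall N \near \oo, (sg.-integrable S (EFin \o (fun x => h N x ^+ 2)) /\
    \int[sg]_(x in S) (h N x ^+ 2) <= eps ^+ 2) /\ (l < N)%N.
    by apply: filterI; [exact: h2|exact: nbhs_infty_gt].
  exact: filter_ex nearN.
have i1 := ih i2.
have iP := sphere_cont_integrable (partial_sum_cont c N).
have iPY : sg.-integrable S (fun x => (partial_sum Y c N x * Y k x)%:E).
  exact: integrableM_bounded iP mY YM.
have igY : sg.-integrable S (fun x => (g x * Y k x)%:E).
  exact: integrableM_bounded L2_sum_integrable mY YM.
have ihY : sg.-integrable S (fun x => (h N x * Y k x)%:E).
  exact: integrableM_bounded i1 mY YM.
rewrite -(@coef_partial_sum c N l k lN) /coef -RintegralB//.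
under eq_Rintegral do rewrite -mulrBl.
apply: le_trans (le_normr_Rintegral mS ihY) _.
have -> : e = M * (eps * om + eps ^+ 2 / eps).
  by rewrite expr2 mulfK ?gt_eqF// -[X in _ + X]mulr1 -mulrDr mulrCA mulfVK// gt_eqF.
have ic : sg.-integrable S (EFin \o (fun _ : E => eps : R)) by apply: finite_measure_integrable_cst.
have i2e : sg.-integrable S (EFin \o (fun x => h N x ^+ 2 / eps)).
  by have := integrableZr mS (eps^-1) i2.
have iD : sg.-integrable S (EFin \o (fun x => eps + h N x ^+ 2 / eps)) by have := integrableD mS ic i2e.
apply: (@le_trans _ _ (\int[sg]_(x in S) (M * (eps + h N x ^+ 2 / eps)))).
  apply: le_Rintegral => //.
  - exact: integrable_norm ihY.
  - by have := integrableZl mS M iD.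
  - move=> x Sx; rewrite normrM mulrC ler_pM//; [exact: YM|exact: norm_sqr].
rewrite RintegralZl// ler_pM2l// RintegralD// Rintegral_cst// lerD2l RintegralZr//.
by rewrite ler_pM2r// invr_gt0.
Qed.

End fourier.

(** * Continuous functions of vanishing L2 norm on the sphere *)

Section sphere_positivity.
Context {R : realType} (d : nat).
Local Notation n := d.+1.
Local Notation E := 'rV[R]_n.
Local Notation S := (@esphere R n 1).
Local Notation sg := (@surf R n 1).

Lemma continuous_radial (x : E) : x != 0 -> {for x, continuous (@radial R n 1)}.
Proof.
move=> x0; apply: (@cvg_rV R _ (nbhs x) _) => i; rewrite mxE; under eq_fun do rewrite mxE.
suff : {for x, continuous (fun y : E => 1 / enorm y * y 0 i)} by [].
apply: contM; last exact: coord_continuous.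
apply: contM; first exact: contC.
have := @continuous_enormVn R n 1 x x0.
by have -> : (fun y : E => enorm y ^- 1) = (fun y : E => (enorm y)^-1) by apply/funext => y; rewrite expr1.
Qed.

(** The cone over a neighbourhood of x contains a cube centred at x / 2. *)
Lemma surf_cap_gt0 (x : E) (U : set E) : S x -> measurable U -> nbhs x U -> (0 < sg U)%E.
Proof.
move=> x1 mU Ux; pose z : E := 2^-1 *: x.
have ez : enorm z = 2^-1 by rewrite enormZ x1 mulr1 gtr0_norm.
have z0 : z != 0 by rewrite -enorm_gt0 ez.
have rz : radial 1 z = x by rewrite /radial ez scalerA div1r invrK mulfV ?scale1r.
have near_z : \forall y \near z, U (radial 1 y) /\ 0 < enorm y <= 1.
  have Uz : nbhs (radial 1 z) U by rewrite rz.
  have n1 : \forall y \near z, U (radial 1 y) by exact: (continuous_radial z0 Uz).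
  have h0 : 0 < enorm z by rewrite ez.
  have h1 : enorm z < 1 by rewrite ez invf_lt1// ltr1n.
  have n2 : \forall y \near z, 0 < enorm y by exact: (@continuous_enorm R n z _ (lt_nbhsr h0)).
  have n3 : \forall y \near z, enorm y < 1 by exact: (@continuous_enorm R n z _ (lt_nbhsl h1)).
  by apply: filterS3 n1 n2 n3 => y yU -> /ltW.
have [e e0 he] : exists2 e : R, 0 < e & box z e `<=` radial 1 @^-1` U `&` @pball R n 1.
  have /nbhs_ballP[e /= e0 he] := near_z; exists (e / 2); first by rewrite divr_gt0.
  move=> y yz; apply: he; split => // i j; rewrite ord1 /ball/= distrC.
  by apply: le_lt_trans (yz j) _; rewrite gtr_pMr// invf_lt1// ltr1n.
rewrite /surf mule_gt0//; first by rewrite lte_fin normr_gt0 divr1 pnatr_eq0.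
apply: (@lt_le_trans _ _ (leb n (box z e))).
  by have := lte_fin 0 ((e *+ 2) ^+ n); rewrite -(leb_box z e0) => ->; rewrite exprn_gt0// mulrn_wgt0.
apply: le_measure; rewrite ?inE//; first exact: measurable_box.
apply: measurableI; last exact: measurable_pball.
by rewrite -[X in measurable X]setTI; exact: measurable_radial.
Qed.

Lemma omega_gt0 : 0 < @omega R d.
Proof.
have mS := @measurable_esphere R n 1.
have x1 : S (bvec (0 : 'I_n)).
  rewrite /esphere/= /enorm (bigD1 (0 : 'I_n))//= big1.
    by rewrite mxE !eqxx expr1n addr0 sqrtr1.
  by move=> i i0; rewrite mxE eqxx/= (negbTE i0) expr0n.
have : (0 < sg setT)%E by apply: (surf_cap_gt0 x1) => //; exact: filterT.
have -> : sg setT = sg S.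
  rewrite -(setUv S) measureU//; [|exact: measurableC|by rewrite setICr].
  by have /= -> := @surf_setC R n 1 ltr01; rewrite adde0.
by rewrite /omega => h; rewrite fine_gt0// h/= surf_lty.
Qed.

(** Otherwise |q| would be bounded below on a cap, and caps have positive measure. *)
Lemma sphere_integral_sqr_eq0 (q : E -> R) : measurable_fun S q ->
  (forall x, S x -> {for x, continuous q}) ->
  (\int[sg]_(x in S) (q x ^+ 2)%:E = 0)%E -> forall x, S x -> q x = 0.
Proof.
move=> mq cq q0 x x1; apply/eqP/negPn/negP => qx.
have mS := @measurable_esphere R n 1.
pose b := `|q x| / 2; have b0 : 0 < b by rewrite divr_gt0// normr_gt0.
have : \forall y \near x, b <= `|q y|.
  have /cvgrPdist_le/(_ _ b0) := cq _ x1; apply: filterS => y h.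
  have := ler_normB (q x) (q x - q y); rewrite opprB addrC subrK => h2.
  have : `|q x| <= `|q y| + b by apply: le_trans (lerD (lexx _) h); have := ler_normD (q y) (q x - q y); rewrite addrC subrK.
  by rewrite [X in X <= _]splitr lerD2r.
move=> /nbhs_ballP[e /= e0 he].
pose U := box x (e / 2).
have mU : measurable U by exact: measurable_box.
have nU : nbhs x U.
  apply/nbhs_ballP; exists (e / 2); first by rewrite /= divr_gt0.
  by move=> y [_ yx] i; rewrite distrC; apply: ltW; exact: yx.
have Uq y : U y -> b <= `|q y|.
  move=> Uy; apply: he; split => // i j; rewrite ord1 /ball/= distrC.
  by apply: le_lt_trans (Uy j) _; rewrite gtr_pMr// invf_lt1// ltr1n.
have SU : sg (S `&` U) = sg U.
  rewrite -[in RHS](setTI U) -(setUv S) setIUl measureU//; last first.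
  - by rewrite setIACA setICr set0I.
  - by apply: measurableI => //; exact: measurableC.
  - exact: measurableI.
  rewrite [X in _ = (_ + X)%E](_ : _ = 0%E) ?adde0//.
  apply/eqP; rewrite -measure_le0 -(@surf_setC R n 1 ltr01); apply: le_measure; rewrite ?inE//.
  - by apply: measurableI => //; exact: measurableC.
  - exact: measurableC.
have : ((b ^+ 2)%:E * sg U <= 0)%E.
  rewrite -q0 -SU -integral_cst//; last exact: measurableI.
  apply: (@le_trans _ _ (\int[sg]_(y in S `&` U) (q y ^+ 2)%:E)%E).
    apply: ge0_le_integral => //.
    - exact: measurableI.
    - by move=> y _; rewrite lee_fin sqr_ge0.
    - by apply/measurable_EFinP; apply: measurable_funX; apply: measurable_funS mq => // y [].
    - move=> y [_ Uy]; rewrite lee_fin -[leRHS]real_normK ?num_real//.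
      by rewrite ler_pXn2r ?nnegrE ?(ltW b0)//; exact: Uq.
  apply: ge0_subset_integral => //; first exact: measurableI.
  - by apply/measurable_EFinP; apply: measurable_funX.
  - by move=> y _; rewrite lee_fin sqr_ge0.
by apply/negP; rewrite -ltNge mule_gt0// ?lte_fin ?exprn_gt0//; exact: (surf_cap_gt0 x1).
Qed.

End sphere_positivity.

(** * Potentials of densities on a sphere *)

Section sphere_potential.
Context {R : realType} (d : nat).
Local Notation n := d.+1.
Local Notation E := 'rV[R]_n.
Local Notation S := (@esphere R n 1).
Local Notation sg := (@surf R n 1).
Local Notation kd := (d.-1).

(** N(x - r z), for z on the unit sphere.  It is real valued because x - r z stays away
    from 0 as long as |x| > r. *)
Definition shrunk_kernel (r : R) (z : E * E) : R := enorm (z.1 - r *: z.2) ^- kd.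

Lemma measurable_shrunk_kernel r : measurable_fun setT (shrunk_kernel r).
Proof.
have mdist : measurable_fun setT (fun z : E * E => enorm (z.1 - r *: z.2)).
  apply: measurableT_comp (@measurable_enorm R n) _; apply: measurable_fun_rV => i.
  under eq_fun do rewrite !mxE.
  apply: measurable_funB; first exact: measurableT_comp (measurable_coord i) measurable_fst.
  apply: measurable_funM; first exact: measurable_cst.
  exact: measurableT_comp (measurable_coord i) measurable_snd.
rewrite /shrunk_kernel; under eq_fun do rewrite -exprVn -powR_inv1 ?sqrtr_ge0//.
by apply: measurable_funX; exact: measurableT_comp (measurable_powR _) mdist.
Qed.

Lemma exprVn_le (k : nat) (a dl : R) : 0 < dl -> dl <= a -> a ^- k <= dl ^- k.
Proof.
move=> dl0 h; have a0 : 0 < a by apply: lt_le_trans h.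
by rewrite lef_pV2 ?posrE ?exprn_gt0//; apply: lerXn2r; rewrite ?nnegrE ?(ltW dl0) ?(ltW a0).
Qed.

Lemma exprVn_lipschitz (k : nat) (dl : R) : 0 < dl -> exists2 L, 0 <= L &
  forall a b, dl <= a -> dl <= b -> `|a ^- k - b ^- k| <= L * `|a - b|.
Proof.
move=> dl0; elim: k => [|k [L L0 IH]].
  by exists 0 => // a b _ _; rewrite !expr0 subrr normr0 mul0r.
exists (dl^-1 * L + dl ^- k * (dl^-1 * dl^-1)).
  by rewrite addr_ge0 ?mulr_ge0 ?invr_ge0 ?exprn_ge0 ?(ltW dl0).
move=> a b da db; have a0 : 0 < a by apply: lt_le_trans da.
have b0 : 0 < b by apply: lt_le_trans db.
have -> : a ^- k.+1 - b ^- k.+1 = a^-1 * (a ^- k - b ^- k) + b ^- k * (a^-1 * b^-1 * (b - a)).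
  by rewrite !exprS; field; rewrite !expf_neq0 ?gt_eqF.
have da1 : a^-1 <= dl^-1 by rewrite lef_pV2 ?posrE.
have db1 : b^-1 <= dl^-1 by rewrite lef_pV2 ?posrE.
have dk0 : 0 <= dl ^- k by rewrite invr_ge0 exprn_ge0// ltW.
have bk0 : 0 <= b ^- k by rewrite invr_ge0 exprn_ge0// ltW.
apply: le_trans (ler_normD _ _) _; rewrite mulrDl lerD// normrM.
  rewrite ger0_norm ?invr_ge0 ?(ltW a0)// -mulrA ler_pM ?invr_ge0 ?(ltW a0)//; exact: IH.
rewrite (ger0_norm bk0) normrM distrC [`|a^-1 * b^-1|]ger0_norm ?mulr_ge0 ?invr_ge0 ?(ltW a0) ?(ltW b0)//.
rewrite -[leRHS]mulrA ler_pM ?mulr_ge0 ?invr_ge0 ?exprn_ge0 ?(ltW a0) ?(ltW b0)//; first exact: exprVn_le.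
by rewrite ler_wpM2r// ler_pM ?invr_ge0 ?(ltW a0) ?(ltW b0).
Qed.

Variables (r : R) (h : E -> R).
Hypothesis r0 : 0 < r.
Hypothesis r1 : r < 1.
Hypothesis ih : sg.-integrable S (EFin \o h).

Definition sphere_potential (x : E) : R := \int[sg]_(z in S) (shrunk_kernel r (x, z) * h z).

Let mS : measurable S. Proof. exact: measurable_esphere. Qed.

Lemma dist_sphere_ge (x z : E) : S z -> enorm x - r <= enorm (x - r *: z).
Proof. by move=> z1; have := enormB_ge x (r *: z); rewrite enormZ z1 mulr1 gtr0_norm. Qed.

Lemma shrunk_kernel_bound (dl : R) (x z : E) : 0 < dl -> r + dl <= enorm x -> S z ->
  `|shrunk_kernel r (x, z)| <= dl ^- kd.
Proof.
move=> dl0 xr z1; rewrite /shrunk_kernel/= ger0_norm ?invr_ge0 ?exprn_ge0 ?enorm_ge0//.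
by apply: exprVn_le => //; apply: le_trans (dist_sphere_ge x z1); rewrite lerBrDl.
Qed.

Lemma shrunk_kernel_integrable (x : E) : r < enorm x -> sg.-integrable S (fun z => (shrunk_kernel r (x, z) * h z)%:E).
Proof.
move=> rx; have dl0 : 0 < enorm x - r by rewrite subr_gt0.
have mx : measurable_fun S (fun z => shrunk_kernel r (x, z)).
  by apply: measurable_funTS; apply: measurableT_comp (measurable_shrunk_kernel r) _; exact: pair1_measurable.
have := integrableM_bounded mS ih mx (M := (enorm x - r) ^- kd).
under eq_fun do rewrite mulrC; apply => z z1.
by apply: shrunk_kernel_bound => //; rewrite addrC subrK.
Qed.

(** Away from the sphere of radius r the kernel is Lipschitz in x, uniformly in z. *)
Lemma continuous_sphere_potential (x : E) : S x -> {for x, continuous sphere_potential}.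
Proof.
move=> x1; have [rm m1] := midf_lt r1; set m := (r + 1) / 2 in rm m1.
have dl0 : 0 < m - r by rewrite subr_gt0.
have [L L0 HL] := exprVn_lipschitz kd dl0.
pose H := \int[sg]_(z in S) `|h z|; have H0 : 0 <= H by exact: Rintegral_ge0.
have C0 : 0 <= L * H by exact: mulr_ge0.
have C1 : 0 < L * H + 1 by rewrite ltr_wpDl.
have mx : m < enorm x by rewrite x1.
apply: (@cvgrPdist_le R R E (nbhs x) (nbhs_filter x) _ _).2 => eps eps0.
have e0 : 0 < eps / (L * H + 1) by rewrite divr_gt0.
have n1 : \forall y \near x, m < enorm y by exact: (@continuous_enorm R n x _ (lt_nbhsr mx)).
have n2 : \forall y \near x, enorm (x - y) < eps / (L * H + 1).
  have cd : {for x, continuous (fun y : E => enorm (x - y))}.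
    have -> : (fun y : E => enorm (x - y)) = @enorm R n \o aff 1 (- x).
      by apply/funext => y; rewrite /= /aff scale1r -enormN opprB.
    by apply: continuous_comp; [exact: continuous_aff|exact: continuous_enorm].
  have h0 : enorm (x - x) < eps / (L * H + 1) by rewrite subrr enorm0.
  exact: (cd _ (lt_nbhsl h0)).
suff nn : \forall y \near x, `|sphere_potential x - sphere_potential y| <= eps by exact: nn.
apply: filterS2 n1 n2 => y my yx.
have rx : r < enorm x by apply: lt_trans mx.
have ry : r < enorm y by apply: lt_trans my.
have ix := shrunk_kernel_integrable rx; have iy := shrunk_kernel_integrable ry.
have iD : sg.-integrable S (EFin \o (fun z => shrunk_kernel r (x, z) * h z - shrunk_kernel r (y, z) * h z)).
  by have := integrableB mS ix iy.
rewrite /sphere_potential -RintegralB//; apply: le_trans (le_normr_Rintegral mS iD) _.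
have iN : sg.-integrable S (EFin \o (fun z => `|h z|)) by exact: integrable_norm ih.
apply: (@le_trans _ _ (\int[sg]_(z in S) (L * enorm (x - y) * `|h z|))).
  apply: le_Rintegral => //; first exact: integrable_norm iD.
    by have := integrableZl mS (L * enorm (x - y)) iN.
  move=> z z1; rewrite -mulrBl normrM ler_wpM2r//.
  apply: le_trans (HL _ _ _ _) _.
  - by apply: le_trans (dist_sphere_ge x z1); rewrite lerB// ltW.
  - by apply: le_trans (dist_sphere_ge y z1); rewrite lerB// ltW.
  - rewrite ler_wpM2l//=; have -> : x - y = (x - r *: z) - (y - r *: z) by rewrite opprB addrA subrK.
    rewrite ler_norml enormB_ge andbT.
    by rewrite lerNl opprB -[leRHS]enormN opprB enormB_ge.
rewrite RintegralZl// -/H mulrAC.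
apply: (@le_trans _ _ ((L * H) * (eps / (L * H + 1)))); first by rewrite ler_wpM2l// ltW.
by rewrite mulrCA ger_pMr// ler_pdivrMr// mul1r lerDl.
Qed.

End sphere_potential.

(** * Representation of exterior harmonic functions *)

Section representation.
Context {R : realType} (d : nat).
Local Notation n := d.+1.
Local Notation E := 'rV[R]_n.
Local Notation S := (@esphere R n 1).
Local Notation sg := (@surf R n 1).
Local Notation omega := (@omega R d).
Variables (r : R) (f : E -> R).
Hypothesis d2 : (2 <= d)%N.
Hypothesis r0 : 0 < r.
Hypothesis r1 : r < 1.
Hypothesis hf : harmonic_on [set x : E | r < enorm x] f.
Hypothesis cf : {within [set x : E | r <= enorm x], continuous f}.
Hypothesis vf : vanishes_at_infinity f.

Let mS : measurable S. Proof. exact: measurable_esphere. Qed.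

Lemma C2_at_C2data (x : E) : C2_at f x ->
  C2data f (fun i => 'D_(bvec i) f) (fun i => 'D_(bvec i) ('D_(bvec i) f)) x.
Proof.
move=> [c0 c1 c2]; split => // i; have [d1 k1] := c1 i; have [e1 k2] := c2 i i.
by split=> //; exact: derivableP.
Qed.

Section coefficients.
Variables (l : nat) (g : E -> R).
Hypothesis shg : spherical_harmonic l g.
Let k := (2 * l + d - 1)%N.
Let kE : (k + 2 = 2 * l + n)%N. Proof. rewrite /k; lia. Qed.
Let k0 : (0 < k)%N. Proof. rewrite /k; lia. Qed.

Lemma exterior_coef : \int[sg]_(x in S) (f x * g x) =
  r ^+ (l + d.-1) * \int[sg]_(x in S) (dilate r f x * g x).
Proof.
have [p [hp harmp gp]] := shg.
have := @exterior_moment R d (peval p) _ _ l k (C2_peval p) (peval_harmonic harmp) (peval_euler hp)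
  (fun s x _ => peval_homog hp s x) kE k0 r f _ _ r0 cf (fun x rx => C2_at_C2data (hf rx).1)
  (fun x rx => (hf rx).2) vf r1.
have -> : sphere_moment (peval p) f 1 = \int[sg]_(x in S) (f x * g x).
  by apply: eq_Rintegral => x; rewrite inE => x1; rewrite scale1r gp.
have -> : sphere_moment (peval p) f r = \int[sg]_(x in S) (dilate r f x * g x).
  by apply: eq_Rintegral => x; rewrite inE => x1; rewrite gp.
have -> : r ^+ k = r ^+ l * r ^+ (l + d.-1) by rewrite -exprD; congr (_ ^+ _); rewrite /k; lia.
by rewrite -mulrA => /mulfI; apply; rewrite expf_neq0// gt_eqF.
Qed.

Lemma shrunk_kernel_coef (z : E) : S z -> k%:R * \int[sg]_(x in S) (shrunk_kernel r (x, z) * g x) =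
  d.-1%:R * omega * r ^+ l * g z.
Proof.
move=> z1; have [p [hp harmp gp]] := shg.
have rz : enorm (r *: z) < 1 by rewrite enormZ z1 mulr1 gtr0_norm.
have := @kernel_moment R d d2 (peval p) _ _ l k (C2_peval p) (peval_harmonic harmp) (peval_euler hp)
  (fun s x _ => peval_homog hp s x) kE (r *: z) rz.
have -> : peval p (r *: z) = r ^+ l * g z by rewrite (peval_homog hp) gp.
move=> H; rewrite -!mulrA -H; congr (_ * _).
by apply: eq_Rintegral => x; rewrite inE => x1; rewrite scale1r gp.
Qed.

(** After exchanging the integrals, the inner one is a moment of the kernel. *)
Lemma potential_coef (h : E -> R) : sg.-integrable S (EFin \o h) ->
  k%:R * \int[sg]_(x in S) (sphere_potential r h x * g x) =
  d.-1%:R * omega * r ^+ l * \int[sg]_(z in S) (h z * g z).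
Proof.
move=> ih; have [p [_ _ gp]] := shg.
have cp : continuous (peval p) by move=> x; exact: continuous_peval.
have [M M0 pM] := sphere_bounded cp.
pose K (z : E * E) := shrunk_kernel r z * peval p z.1.
have mK : measurable_fun setT K.
  apply: measurable_funM; first exact: measurable_shrunk_kernel.
  by apply: measurableT_comp measurable_fst; exact: continuous_measurable.
have r10 : 0 < 1 - r by rewrite subr_gt0.
have KC x y : S x -> S y -> `|K (x, y)| <= (1 - r) ^- d.-1 * M.
  move=> x1 y1; rewrite normrM ler_pM//; last exact: pM.
  by apply: shrunk_kernel_bound => //; rewrite x1 addrC subrK.
have -> : \int[sg]_(x in S) (sphere_potential r h x * g x) =
    \int[sg]_(x in S) \int[sg]_(z in S) (K (x, z) * h z).
  apply: eq_Rintegral => x; rewrite inE => x1.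
  rewrite -RintegralZr//; last by apply: shrunk_kernel_integrable => //; rewrite x1.
  by apply: eq_Rintegral => z _; rewrite gp// /K/= mulrAC.
rewrite (fubini_kernel sg mS mS mK KC ih).
have ihg : sg.-integrable S (fun z => (h z * g z)%:E).
  have sgc : sphere_cont g by exact: spherical_harmonic_cont shg.
  have [N _ gN] := sphere_cont_bounded sgc.
  apply: integrableM_bounded gN => //; exact: sphere_cont_measurable.
pose C := d.-1%:R * omega * r ^+ l / k%:R.
have kn0 : k%:R != 0 :> R by rewrite pnatr_eq0 -lt0n.
have kC : k%:R * C = d.-1%:R * omega * r ^+ l by rewrite /C mulrC divfK.
transitivity (k%:R * \int[sg]_(z in S) (C * (h z * g z))).
  congr (_ * _); apply: eq_Rintegral => z; rewrite inE => z1.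
  rewrite mulrCA; congr (_ * _); apply: (mulfI kn0).
  rewrite mulrA kC -(shrunk_kernel_coef z1); congr (_ * _).
  by apply: eq_Rintegral => x; rewrite inE => x1; rewrite /K gp.
by rewrite RintegralZl// mulrA kC.
Qed.

End coefficients.

Variables (Y : forall l : nat, 'I_(Zdim d l) -> E -> R) (Df : E -> R).
Hypothesis onbY : harmonic_onb Y.
Hypothesis hD : is_D Y r f Df.

Let h := dilate r Df.

Let ih : sg.-integrable S (EFin \o h).
Proof. by have [shY _ _] := onbY; exact: (@L2_sum_integrable R d Y shY _ _ hD). Qed.

Let q (x : E) : R := f x - r ^+ d.-1 * sphere_potential r h x.

Let cq x : S x -> {for x, continuous q}.
Proof.
move=> x1; have rx : r < enorm x by rewrite x1.
apply: contB; first by have [[cx _ _] _] := hf rx.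
by apply: contM; [exact: contC|exact: continuous_sphere_potential].
Qed.

Let wcq : {within S, continuous q}.
Proof. by apply: continuous_in_subspaceT => x; rewrite inE => /cq. Qed.

Let mq : measurable_fun S q. Proof. exact: within_continuous_measurable. Qed.

Let bounded_on_sphere (u : E -> R) : {within S, continuous u} -> sg.-integrable S (EFin \o u).
Proof.
move=> cu; have [|M M0 uM] := @within_continuous_bounded R n S u _ cu.
  have -> : S = [set x : E | enorm x \in `[1, 1]].
    by apply/seteqP; split => x /=; rewrite /esphere/= in_itv/= -eq_le eq_sym => /eqP.
  exact: compact_annulus.
apply: (@bounded_integrable R _ _ sg S u M) => //; first by apply: surf_lty.
exact: within_continuous_measurable.
Qed.

(** The potential multiplies coefficients by the inverse of the multiplier of D, up to
    the powers of r found in [exterior_coef]. *)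
Lemma coef_defect l (k : 'I_(Zdim d l)) : coef Y q k = 0.
Proof.
have [shY orthoY _] := onbY.
have cY := spherical_harmonic_cont (shY l k).
have [M _ YM] := sphere_cont_bounded cY.
have mY := sphere_cont_measurable cY.
have i1 : sg.-integrable S (fun x => (f x * Y k x)%:E).
  apply: integrableM_bounded YM => //; apply: bounded_on_sphere.
  by apply: continuous_subspaceW cf => x /= ->; exact: ltW.
have wcp : {within S, continuous (sphere_potential r h)}.
  by apply: continuous_in_subspaceT => x; rewrite inE => x1; exact: continuous_sphere_potential.
have i2 : sg.-integrable S (fun x => (sphere_potential r h x * Y k x)%:E).
  by apply: integrableM_bounded YM => //; exact: bounded_on_sphere.
have i3 : sg.-integrable S (fun x => (r ^+ d.-1 * (sphere_potential r h x * Y k x))%:E).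
  by have := integrableZl mS (r ^+ d.-1) i2.
rewrite /coef; under eq_Rintegral do rewrite mulrBl -mulrA.
rewrite RintegralB// RintegralZl// (exterior_coef (shY l k)).
have kn0 : (2 * l + d - 1)%:R != 0 :> R by rewrite pnatr_eq0; lia.
apply/eqP; rewrite subr_eq0; apply/eqP/(mulfI kn0).
rewrite [RHS]mulrCA (potential_coef (shY l k) ih).
have -> : \int[sg]_(z in S) (h z * Y k z) = @D_coef R d Y r f l k.
  exact: (@L2_sum_coef R d Y shY orthoY _ _ hD l k).
rewrite /D_coef /coef exprD; have om0 := @omega_gt0 R d.
have -> : (d - 1)%N = d.-1 by lia.
have dn0 : d.-1%:R != 0 :> R by rewrite pnatr_eq0; lia.
set I := \int[_]_(x in S) (dilate r f x * _); set kk := (2 * l + d - 1)%:R.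
by field; rewrite dn0 gt_eqF.
Qed.

(** The difference of the two sides is continuous on the sphere and orthogonal to a
    complete family. *)
Theorem exterior_representation (x : E) : S x -> f x = r ^+ d.-1 * sphere_potential r h x.
Proof.
move=> x1; apply/eqP; rewrite -subr_eq0; apply/eqP; move: x x1.
have [_ _ complY] := onbY.
have wcq2 : {within S, continuous (fun x => q x ^+ 2)}.
  by apply: continuous_in_subspaceT => x; rewrite inE => x1; apply: contX; exact: cq.
have /integrableP[_ q2] := bounded_on_sphere wcq2.
have q2oo : (\int[sg]_(x in S) (q x ^+ 2)%:E < +oo)%E.
  apply: le_lt_trans q2; rewrite le_eqVlt; apply/orP; left; apply/eqP.
  by apply: eq_integral => x _; rewrite /= ger0_norm ?sqr_ge0.
have [_ H] := complY q mq q2oo.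
apply: sphere_integral_sqr_eq0 => //.
have P0 N x : partial_sum Y (coef Y q) N x = 0.
  by apply: big1 => l _; apply: big1 => k _; rewrite coef_defect mul0r.
move: H; set F := (fun N : nat => _) => H.
have FE : F = cst (\int[sg]_(x in S) (q x ^+ 2)%:E)%E.
  by apply/funext => N; apply: eq_integral => x _; rewrite P0 subr0.
by rewrite -(cvg_lim (@ereal_hausdorff R) H) FE lim_cst.
Qed.
End representation.

(** * Hoelder's inequality on the sphere of radius r *)

Section extended_hoelder.
Context d (T : measurableType d) (R : realType) (mu : {measure set T -> \bar R}).
Local Open Scope ereal_scope.
Implicit Types u v : T -> R.

Lemma hoelder_infty u v : measurable_fun setT u -> measurable_fun setT v ->
  'N[mu]_1[EFin \o (u \* v)%R] <= 'N[mu]_+oo[EFin \o u] * 'N[mu]_1[EFin \o v].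
Proof.
move=> mesu mesv; rewrite !Lnorm1.
have mabs (w : T -> R) : measurable_fun setT w -> measurable_fun setT (fun x : T => `|(EFin \o w) x|).
  move=> mw; apply: measurableT_comp; first exact: abse_measurable.
  exact/measurable_EFinP.
have [mu0|] := boolP (0 < mu setT); last first.
  rewrite -leNgt measure_le0 => /eqP mu0.
  rewrite null_set_integral//; last by apply: mabs; exact: measurable_funM.
  by rewrite mule_ge0 ?Lnorm_ge0// integral_ge0.
have NE : 'N[mu]_+oo[EFin \o u] = ess_sup mu (abse \o (EFin \o u)) by rewrite unlock mu0.
rewrite -ge0_integralZl//; [|exact: mabs|exact: Lnorm_ge0].
apply: ae_ge0_le_integral => //.
- by apply: mabs; exact: measurable_funM.
- by move=> x _; rewrite mule_ge0// Lnorm_ge0.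
- by apply: measurable_funeM; exact: mabs.
have := ess_sup_ge mu (abse \o (EFin \o u)); rewrite -NE; apply: filterS => x /= h _.
by rewrite normrM EFinM lee_wpmul2r.
Qed.

(** Two finite exponents are the classical case; if one exponent is 1, the other one
    is infinite and [hoelder_infty] applies. *)
Lemma hoelder_ereal u v (p q : \bar R) : measurable_fun setT u -> measurable_fun setT v ->
  1 <= p -> 1 <= q -> p^-1 + q^-1 = 1 ->
  'N[mu]_1[EFin \o (u \* v)%R] <= 'N[mu]_p[EFin \o u] * 'N[mu]_q[EFin \o v].
Proof.
move=> mesu mesv; case: p q => [a| |] [b| |]//.
- rewrite !lee_fin => a1 b1; have a0 : (0 < a)%R by exact: lt_le_trans a1.
  have b0 : (0 < b)%R by exact: lt_le_trans b1.
  rewrite !inver (gt_eqF a0) (gt_eqF b0) -EFinD => -[ab]; exact: hoelder.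
- move=> _ _; rewrite invey adde0 => /eqP; rewrite inve_eq1 => /eqP ->.
  rewrite muleC; have -> : (u \* v)%R = (v \* u)%R by apply/funext => x; exact: mulrC.
  exact: hoelder_infty.
- move=> _ _; rewrite invey add0e => /eqP; rewrite inve_eq1 => /eqP ->.
  exact: hoelder_infty.
- by move=> _ _; rewrite invey adde0 => /eqP; rewrite eqe eq_sym oner_eq0.
Qed.

End extended_hoelder.

Section sphere_hoelder.
Context {R : realType} (d : nat).
Local Notation n := d.+1.
Local Notation E := 'rV[R]_n.
Local Notation S := (@esphere R n 1).
Local Notation sg := (@surf R n 1).
Variable r : R.
Hypothesis r0 : 0 < r.

Lemma ge0_integral_surf_dilate (F : E -> \bar R) : measurable_fun setT F -> (forall x, 0 <= F x)%E ->
  (\int[surf r]_x F x = (r ^+ d)%:E * \int[sg]_x F (r *: x))%E.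
Proof.
move=> mF F0; have ms := @measurable_scale R n r setT.
have := ge0_integral_pushforward ms sg measurableT mF (fun y _ => F0 y).
rewrite preimage_setT /comp => <-.
have cn0 : 0 <= r ^+ d by rewrite exprn_ge0// ltW.
rewrite -(@ge0_integral_mscale _ _ _ (image_measure sg ms) _ measurableT (NngNum cn0))//.
by apply: eq_measure_integral => A mA _; exact: surf_dilate.
Qed.

Let restrE (u : E -> R) x : (u \_ (esphere r)) x = ((dilate r u) \_ S) (r^-1 *: x).
Proof.
have rn0 : r != 0 by rewrite gt_eqF.
rewrite !patchE /dilate scalerA divff// scale1r.
congr (if _ then _ else _).
apply/idP/idP; rewrite !inE /esphere/= enormZ ger0_norm ?invr_ge0 ?(ltW r0)//.
  by move=> ->; rewrite mulVf.
by move=> h; rewrite -[LHS](mulKf rn0) mulrCA h mulr1.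
Qed.

Let mrestr (u : E -> R) : measurable_fun S (dilate r u) -> measurable_fun setT (u \_ (esphere r)).
Proof.
move=> mesu; have -> : u \_ (esphere r) = ((dilate r u) \_ S) \o (fun x => r^-1 *: x).
  by apply/funext => x; rewrite restrE.
apply: measurableT_comp; last exact: measurable_scale.
by apply/(measurable_restrictT _ _).1 => //; exact: measurable_esphere.
Qed.

Let EFin_restr (u : E -> R) : (EFin \o u) \_ (esphere r) = EFin \o (u \_ (esphere r)).
Proof. by apply/funext => x; rewrite /= !patchE; case: ifP. Qed.

(** The left-hand side is the integral of |u v| over the sphere of radius r, pulled
    back to the unit sphere. *)
Lemma sphere_hoelder (u v : E -> R) (p q : \bar R) :
  measurable_fun S (dilate r u) -> measurable_fun S (dilate r v) ->
  (1 <= p)%E -> (1 <= q)%E -> (p^-1 + q^-1 = 1)%E ->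
  ((r ^+ d)%:E * \int[sg]_(z in S) `|dilate r u z * dilate r v z|%:E <=
   sphere_norm r p (EFin \o u) * sphere_norm r q (EFin \o v))%E.
Proof.
move=> mesu mesv p1 q1 pq; rewrite /sphere_norm !EFin_restr.
have mA := mrestr mesu; have mB := mrestr mesv.
apply: le_trans (hoelder_ereal _ mA mB p1 q1 pq); rewrite Lnorm1 ge0_integral_surf_dilate//; last first.
  apply: measurableT_comp; first exact: abse_measurable.
  by apply/measurable_EFinP; exact: measurable_funM.
rewrite le_eqVlt; apply/orP; left; apply/eqP; congr (_ * _)%E.
rewrite integral_mkcond; apply: eq_integral => x _.
rewrite /= !restrE !scalerA mulVf ?gt_eqF// scale1r !patchE.
by case: ifP => // _; rewrite mulr0 normr0.
Qed.

End sphere_hoelder.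

(** * Potentials of measures on the unit sphere and the inequality *)

Section measure_potential.
Context {R : realType} (d : nat).
Local Notation n := d.+1.
Local Notation E := 'rV[R]_n.
Local Notation S := (@esphere R n 1).
Local Notation sg := (@surf R n 1).
Variables (r : R) (nu : {finite_measure set E -> \bar R}).
Hypothesis r0 : 0 < r.
Hypothesis r1 : r < 1.

Let mS : measurable S. Proof. exact: measurable_esphere. Qed.

Let r10 : 0 < 1 - r. Proof. by rewrite subr_gt0. Qed.

Let nuS : (nu S < +oo)%E.
Proof. by rewrite -ge0_fin_numE//; exact: fin_num_measure. Qed.

Let kernelC x z : S x -> S z -> `|shrunk_kernel r (x, z)| <= (1 - r) ^- d.-1.
Proof. by move=> x1 z1; apply: shrunk_kernel_bound => //; rewrite x1 addrC subrK. Qed.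

(** The potential of nu at the point r z of the sphere of radius r. *)
Definition shrunk_potential (z : E) : R := \int[nu]_(x in S) shrunk_kernel r (x, z).

Let kernel_nu_integrable z : S z -> nu.-integrable S (fun x => (shrunk_kernel r (x, z))%:E).
Proof.
move=> z1; apply: (@bounded_integrable R _ _ nu S (fun x => shrunk_kernel r (x, z)) ((1 - r) ^- d.-1)) => //.
- by apply: measurable_funTS; apply: measurableT_comp (measurable_shrunk_kernel r) _; exact: pair2_measurable.
- by move=> x x1; exact: kernelC.
Qed.

Lemma integral_newton_kernel (z : E) : S z ->
  (\int[nu]_(x in S) newton_kernel (r *: z) x = (shrunk_potential z)%:E)%E.
Proof.
move=> z1; rewrite /shrunk_potential /Rintegral fineK; last exact: (integrable_fin_num mS (kernel_nu_integrable z1)).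
apply: eq_integral => x; rewrite inE => x1; rewrite /newton_kernel /shrunk_kernel/=.
rewrite -enormN opprB inver ifF//; apply/negbTE; rewrite expf_neq0//.
by rewrite gt_eqF//; apply: lt_le_trans (dist_sphere_ge r0 x z1); rewrite x1.
Qed.

Lemma measurable_shrunk_potential : measurable_fun S shrunk_potential.
Proof.
pose F (xz : E * E) : \bar R := (shrunk_kernel r xz * \1_S xz.1)%:E.
have F0 xz : (0 <= F xz)%E.
  by rewrite lee_fin mulr_ge0 ?invr_ge0 ?exprn_ge0 ?enorm_ge0// indicE ler0n.
have mF : measurable_fun setT F.
  apply/measurable_EFinP; apply: measurable_funM; first exact: measurable_shrunk_kernel.
  by apply: measurableT_comp measurable_fst; exact: measurable_indic.
have mG := @measurable_fun_fubini_tonelli_G _ _ _ _ R nu F mF F0.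
apply: (@eq_measurable_fun _ _ _ _ S (fun z => fine (\int[nu]_x F (x, z))%E)) => [z|].
  rewrite inE => z1; rewrite /shrunk_potential /Rintegral; congr fine.
  rewrite [RHS]integral_mkcond; apply: eq_integral => x _; rewrite patchE /F indicE.
  by case: ifP => xS; rewrite ?mulr1 ?mulr0.
by apply: measurable_funTS; apply: measurableT_comp mG.
Qed.

Lemma shrunk_potential_bounded (z : E) : S z -> `|shrunk_potential z| <= (1 - r) ^- d.-1 * fine (nu S).
Proof.
move=> z1; apply: le_trans (le_normr_Rintegral mS (kernel_nu_integrable z1)) _.
rewrite -Rintegral_cst//; apply: le_Rintegral => //.
- exact: integrable_norm (kernel_nu_integrable z1).
- exact: finite_measure_integrable_cst.
- by move=> x x1; exact: kernelC.
Qed.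

Variables (f h : E -> R).
Hypothesis ih : sg.-integrable S (EFin \o h).
Hypothesis cf : {within [set x : E | r <= enorm x], continuous f}.
Hypothesis fE : forall x, S x -> f x = r ^+ d.-1 * sphere_potential r h x.

Lemma integrable_shrunk : sg.-integrable S (fun z => (h z * shrunk_potential z)%:E).
Proof.
apply: (integrableM_bounded mS ih measurable_shrunk_potential); exact: shrunk_potential_bounded.
Qed.

(** Integrate the representation of f against nu and exchange the integrals. *)
Lemma integral_exterior_harmonic :
  (\int[nu]_(x in S) (f x)%:E = (r ^+ d.-1 * \int[sg]_(z in S) (h z * shrunk_potential z))%:E)%E.
Proof.
rewrite -(fubini_kernel nu mS mS (measurable_shrunk_kernel r) kernelC ih).
have [M M0 fM] := exterior_bounded cf 1.
have iF : nu.-integrable S (EFin \o f).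
  apply: (@bounded_integrable R _ _ nu S f M) => //.
  - apply: measurable_funS (within_continuous_measurable (measurable_exterior r) cf).
      exact: measurable_exterior.
    by move=> x /= ->; exact: ltW.
  - by move=> x x1; apply: fM; rewrite x1// ltW.
have pE x : S x -> \int[sg]_(z in S) (shrunk_kernel r (x, z) * h z) = r ^- d.-1 * f x.
  by move=> x1; rewrite fE// mulKf// expf_neq0// gt_eqF.
have -> : \int[nu]_(x in S) \int[sg]_(z in S) (shrunk_kernel r (x, z) * h z) = \int[nu]_(x in S) (r ^- d.-1 * f x).
  by apply: eq_Rintegral => x; rewrite inE; exact: pE.
rewrite RintegralZl// mulVKf ?expf_neq0 ?gt_eqF//.
by rewrite /Rintegral fineK//; exact: (integrable_fin_num mS iF).
Qed.

End measure_potential.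

Theorem theorem2 (R : realType) (d : nat) (r0 r : R) (p p' : \bar R)
    (Y : forall l : nat, 'I_(Zdim d l) -> 'rV[R]_d.+1 -> R)
    (f Df : 'rV[R]_d.+1 -> R) (sigma : {charge set 'rV[R]_d.+1 -> \bar R}) :
  (2 <= d)%N -> 0 < r0 -> r0 < r -> r < 1 ->
  harmonic_onb Y ->
  class_F Y r f -> is_D Y r f Df ->
  (1 <= p)%E -> (1 <= p')%E -> (p^-1 + p'^-1 = 1)%E ->
  class_M sigma ->
  (forall eta, esphere 1 eta ->
    partial_sum Y (coef Y (dilate r f)) N eta @[N --> \oo] --> f (r *: eta)) ->
  (`|charge_integral sigma (esphere 1) (EFin \o f)| <=
   r0^-1%:E * sphere_norm r p (EFin \o Df)
     * sphere_norm r p' (potential sigma))%E.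
Proof.
move=> d2 r00 r0r r1 onbY [hf cf vf _] hD p1 p1' pp' _ _.
have r_gt0 : 0 < r by exact: lt_trans r0r.
set S := esphere 1; set sg := @surf R d.+1 1.
have mS : measurable S by exact: measurable_esphere.
pose h := dilate r Df.
have ih : sg.-integrable S (EFin \o h).
  by have [shY _ _] := onbY; exact: (@L2_sum_integrable R d Y shY _ _ hD).
have fE x : S x -> f x = r ^+ d.-1 * sphere_potential r h x.
  exact: (exterior_representation d2 r_gt0 r1 hf cf vf onbY hD).
pose Vp := shrunk_potential r (pos_part sigma).
pose Vn := shrunk_potential r (neg_part sigma).
pose v (x : 'rV[R]_d.+1) := fine (potential sigma x).
have vE z : S z -> potential sigma (r *: z) = (Vp z - Vn z)%:E.
  by move=> z1; rewrite /potential /charge_integral !integral_newton_kernel.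
have dvE z : S z -> dilate r v z = Vp z - Vn z by move=> z1; rewrite /dilate /v vE.
have mv : measurable_fun S (dilate r v).
  apply: (@eq_measurable_fun _ _ _ _ S (fun z => Vp z - Vn z)) => [z|].
    by rewrite inE => /dvE.
  by apply: measurable_funB; exact: measurable_shrunk_potential.
have mh : measurable_fun S h by apply/measurable_EFinP; exact: measurable_int ih.
have -> : sphere_norm r p' (potential sigma) = sphere_norm r p' (EFin \o v).
  rewrite /sphere_norm; apply: eq_Lnorm => x; rewrite !patchE; case: ifP => //.
  rewrite inE => xr; have -> : x = r *: (r^-1 *: x) by rewrite scalerA divff ?scale1r// gt_eqF.
  rewrite /v/= vE// /S /esphere/= enormZ xr ger0_norm ?invr_ge0 ?(ltW r_gt0)//.
  by rewrite mulVf// gt_eqF.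
have ip := integrable_shrunk (pos_part sigma) r_gt0 r1 ih.
have iN := integrable_shrunk (neg_part sigma) r_gt0 r1 ih.
have iV : sg.-integrable S (EFin \o (fun z => h z * Vp z - h z * Vn z)).
  by have := integrableB mS ip iN.
have -> : charge_integral sigma S (EFin \o f) =
    (r ^+ d.-1 * \int[sg]_(z in S) (h z * Vp z - h z * Vn z))%:E.
  rewrite /charge_integral !(integral_exterior_harmonic _ r_gt0 r1 ih cf fE).
  by rewrite -EFinB -mulrBr RintegralB.
have H := sphere_hoelder r_gt0 mh mv p1 p1' pp'.
rewrite -muleA; apply: (@le_trans _ _ (r0^-1%:E * ((r ^+ d)%:E *
    \int[sg]_(z in S) `|dilate r Df z * dilate r v z|%:E))%E); last first.
  by apply: lee_wpmul2l => //; rewrite lee_fin invr_ge0 ltW.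
have -> : (\int[sg]_(z in S) `|dilate r Df z * dilate r v z|%:E =
    (\int[sg]_(z in S) `|h z * Vp z - h z * Vn z|)%:E)%E.
  rewrite /Rintegral fineK; last first.
    by apply: (integrable_fin_num mS); exact: integrable_norm iV.
  by apply: eq_integral => z; rewrite inE => z1; rewrite dvE// mulrBr.
rewrite -!EFinM lee_fin normrM ger0_norm ?exprn_ge0 ?(ltW r_gt0)//.
have HI := le_normr_Rintegral mS iV.
rewrite mulrA ler_pM ?exprn_ge0 ?(ltW r_gt0)//.
have -> : r ^+ d.-1 = r^-1 * r ^+ d.
  have -> : d = d.-1.+1 by lia.
  by rewrite exprS mulKf// gt_eqF.
by rewrite ler_wpM2r ?exprn_ge0 ?(ltW r_gt0)// lef_pV2 ?posrE// ltW.
Qed.
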